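(* Let $\gamma:[0,1]\to\mathbb{R}^d$ be a twice-continuously-differentiable unit-speed path such that the map $s\mapsto|\gamma''_s|$ is non-vanishing on $[0,1]$ and is differentiable with bounded derivative. Let $a<b$ be real numbers and let $F:(a,b)\to[0,1]$ be a twice-differentiable function satisfying $$F(t)=\int_a^t|\gamma''_{F(s)}|^{-1}\,ds\quad (t\in(a,b)),\qquad \lim_{s\to a^+}F(s)=0,\qquad \lim_{s\to b^-}F(s)=1.$$ Let $\mu$ be the probability measure with cumulative distribution function $F$, let $X_1,\dots,X_n$ be $n$ i.i.d. random variables drawn from $\mu$, and let $\mu_n:=\frac1n\sum_{i=1}^n\delta_{X_i}$. Then $$c(\gamma)=\lim_{n\to\infty}\mathbb{E}\left[\exp\left(-n\,W_2^2(\mu_n,\mu)\right)\right]^{1/2}.$$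
   Context: $|\cdot|$ is the Euclidean norm; unit-speed means $|\gamma'_s|=1$ for all $s$. For such $\gamma$ constants $a<b$ and a function $F$ as described exist. $W_2$ is the $2$-Wasserstein distance on probability measures on $\mathbb{R}$: $W_2^2(\mu,\nu)=\inf_{\pi}\int\int|x-y|^2\,d\pi(x,y)$, the infimum being over all couplings $\pi$ of $\mu$ and $\nu$. The Hambly-Lyons limit of $\gamma$ is $$c(\gamma):=\mathbb{E}\left[\exp\left(-\int_0^1(B_{0,s})^2|\gamma''_s|^2\,ds\right)\right]^{1/2},$$ where $(B_{0,s})_{s\in[0,1]}$ is a standard Brownian bridge from $0$ to $0$ on $[0,1]$; when $\gamma$ is of class $C^3$ this equals $\mathbb{E}[\exp(\int_0^1(B_{0,s})^2\langle\gamma'_s,\gamma'''_s\rangle ds)]^{1/2}$, since $\langle\gamma'_s,\gamma'''_s\rangle=-|\gamma''_s|^2$. *)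

(* Defs.v *)
From HB Require Import structures.
From mathcomp Require Import all_boot all_order all_algebra.
From mathcomp Require Import all_classical all_reals all_analysis.

Set Implicit Arguments.
Unset Strict Implicit.
Unset Printing Implicit Defensive.

Import Order.TTheory GRing.Theory Num.Theory.
Import numFieldNormedType.Exports.

Local Open Scope classical_set_scope.
Local Open Scope ring_scope.

(* The library norm on row vectors is the sup norm. *)
Definition enorm (R : realType) (d : nat) (v : 'rV[R]_d) : R :=
  Num.sqrt (\sum_(i < d) v 0 i ^+ 2).

(* Derivatives of a function on A, the limit being taken along A only: on
   A = [0, 1] they are one-sided at the endpoints, and the values of f outside
   A play no role. *)
Section derivative_on.
Context (R : realType) (V : normedModType R) (A : set R).

Definition diffquot (f : R -> V) (s t : R) : V := (t - s)^-1 *: (f t - f s).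

Definition derivable_on (f : R -> V) : Prop :=
  forall s, A s -> cvg (diffquot f s t @[t --> within A s^']).

Definition derive_on (f : R -> V) (s : R) : V :=
  lim (diffquot f s t @[t --> within A s^']).

Definition twice_continuously_derivable_on (f : R -> V) : Prop :=
  [/\ derivable_on f, derivable_on (derive_on f) &
      {within A, continuous (derive_on (derive_on f))}].

End derivative_on.

(* gamma'_s and |gamma''_s| for a path gamma on [0, 1] *)
Definition velocity (R : realType) (d : nat) (gamma : R -> 'rV[R]_d) :
  R -> 'rV[R]_d := derive_on `[0, 1] gamma.

Definition curvature (R : realType) (d : nat) (gamma : R -> 'rV[R]_d) (s : R) :
  R := enorm (derive_on `[0, 1] (velocity gamma) s).

(* normal_prob m 0 is not the Dirac mass at m in the library, whence the case
   distinction. *)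
Definition gaussian_law (R : realType) (m sigma : R) (A : set R) : \bar R :=
  if sigma == 0 then \d_m A else normal_prob m sigma A.

Definition gaussian_process (R : realType) (I : set R) (disp : measure_display)
    (T : measurableType disp) (P : probability T R) (B : R -> {RV P >-> R}) :
    Prop :=
  forall (k : nat) (t c : 'I_k -> R), (forall i, I (t i)) ->
    exists m sigma : R, forall A : set R, measurable A ->
      P ((fun w => \sum_(i < k) c i * B (t i) w) @^-1` A)
      = gaussian_law m sigma A.

(* The covariance forces B 0 = B 1 = 0 almost surely. Only the times in [0, 1]
   are meaningful. *)
Record brownian_bridge (R : realType) (disp : measure_display)
    (T : measurableType disp) (P : probability T R) (B : R -> {RV P >-> R}) :
    Prop := BrownianBridge {
  bb_gaussian : gaussian_process `[0, 1] B ;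
  bb_mean : forall t : R, t \in `[0, 1] -> ('E_P[B t] = 0)%E ;
  bb_covariance : forall s t : R, s \in `[0, 1] -> t \in `[0, 1] ->
    covariance P (B s) (B t) = (Num.min s t - s * t)%:E ;
  bb_continuous :
    {ae P, forall w, {within `[0, 1], continuous (fun t : R => B t w)}} }.

(* c(gamma), computed with a given Brownian bridge B *)
Definition hambly_lyons_limit (R : realType) (d : nat) (gamma : R -> 'rV[R]_d)
    (disp : measure_display) (T : measurableType disp) (P : probability T R)
    (B : R -> {RV P >-> R}) : \bar R :=
  ((\int[P]_w expeR (- \int[lebesgue_measure]_(s in `[0%R, 1%R])
      (B s w ^+ 2 * curvature gamma s ^+ 2)%:E)) `^ 2^-1)%E.

(* mu and nu are plain set functions so that empirical_measure, which is a
   probability only for n > 0, needs no packaging. *)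
Definition coupling (R : realType) (mu nu : set R -> \bar R)
    (pi : probability (R * R)%type R) : Prop :=
  forall A : set R, measurable A ->
    pi (A `*` setT) = mu A /\ pi (setT `*` A) = nu A.

Definition wasserstein2_sq (R : realType) (mu nu : set R -> \bar R) : \bar R :=
  ereal_inf [set (\int[pi]_p (`|p.1 - p.2| ^+ 2)%:E)%E
            | pi in [set pi : probability (R * R)%type R | coupling mu nu pi]].

Definition empirical_measure (R : realType) (n : nat) (x : 'I_n -> R)
    (A : set R) : \bar R :=
  ((n%:R^-1)%:E * \sum_(i < n) \d_(x i)%R A)%E.

Definition mutually_independent (R : realType) (disp : measure_display)
    (T : measurableType disp) (P : probability T R) (n : nat)
    (X : 'I_n -> {RV P >-> R}) : Prop :=
  forall (J : {set 'I_n}) (A : 'I_n -> set R), (forall i, measurable (A i)) ->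
    P (\bigcap_(i in [set` J]) (X i @^-1` A i))
    = (\prod_(i in J) P (X i @^-1` A i))%E.

Definition iid (R : realType) (disp : measure_display)
    (T : measurableType disp) (P : probability T R) (n : nat)
    (X : 'I_n -> {RV P >-> R}) (mu : probability R R) : Prop :=
  mutually_independent X /\
  forall i (A : set R), measurable A -> distribution P (X i) A = mu A.

(* Main.v *)
Require Import Defs.
From HB Require Import structures.
From mathcomp Require Import all_boot all_order all_algebra.
From mathcomp Require Import all_classical all_reals all_analysis.
From mathcomp Require Import measurable_realfun.
From mathcomp Require Import ring lra zify.

Set Implicit Arguments.
Unset Strict Implicit.
Unset Printing Implicit Defensive.

Import Order.TTheory GRing.Theory Num.Theory.
Import numFieldNormedType.Exports.

Local Open Scope classical_set_scope.
Local Open Scope ring_scope.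

(** Write [G] for the distribution function of [mu], [kap] for the curvature, and
    [emp x] for [sqrt n] times the difference between the empirical distribution
    function and [G] at [x].  On the line the squared Wasserstein distance is an
    explicit double integral of distribution functions over pairs of thresholds
    [(s, t)]: every coupling has to carry a certain mass across each pair, and the
    coupling by quantiles carries no more ([wasserstein2_sqE]).

    For fixed [s] the inner integral is local, because only those [t] matter for
    which [G t] lies between [G s] and the empirical value at [s].  The equation
    satisfied by [F] says that [G] has derivative [1 / kap \o G], which is Lipschitz;
    replacing [G] by its tangent at [s] shows that the inner integral is
    [kap (G s) * emp s ^+ 2 / n] up to a term of order [(`|emp s| / sqrt n) ^+ 3]
    ([integral_wgap]).  Hence [n] times the squared distance is the integral of
    [kap (G s) * emp s ^+ 2] over [`[a, b]], up to an error whose mean is of order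
    [1 / sqrt n], by uniform bounds on the second and fourth moments of [emp].

    This quadratic functional is compared with Riemann sums over a uniform grid.
    Since the mean of [(emp x - emp y) ^+ 2] is at most [`|G x - G y|], the comparison
    is uniform in [n] ([wasserstein_laplace_approx]).  For a fixed grid, the vector
    [emp (x j)] converges in law to [B (G (x j))]: both covariances are
    [Num.min (G x) (G y) - G x * G y], and the central limit theorem is proved with
    characteristic functions.  To pass to the Laplace transform of a quadratic form,
    [expR (- c * y ^+ 2)] is approximated by powers of cosines, which are
    trigonometric polynomials, with an error controlled by second moments alone
    ([cvg_quadratic_laplace]).  The characteristic function of the normal law comes
    from Gaussian integration by parts ([stein]).

    On the side of the bridge the Riemann sums converge, along almost every path, to
    the integral of [kap (G s) * B (G s) ^+ 2] over [`[a, b]]; the time change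
    [u = G s], with [ds = kap (G s) du], turns it into the integral of
    [B u ^+ 2 * kap u ^+ 2] over [`[0, 1]] ([bridge_functional_limit]).  The uniform
    comparison allows the two limits to be exchanged ([cvg_uniform_approx]). *)

(** * Elementary inequalities for sine, cosine and the exponential *)

Section elementary.
Context {R : realType}.
Implicit Types x y h v : R.

Lemma ge0_of_derive_ge0 (f df : R -> R) x :
  (forall y, is_derive y 1 f (df y)) -> (forall y, 0 <= y -> 0 <= df y) ->
  0 <= f 0 -> 0 <= x -> 0 <= f x.
Proof.
move=> fdf df0 f0 x0.
have [|c] := @MVT_segment _ f df 0 x x0 (fun y _ => fdf y).
  by apply: derivable_within_continuous => y _; apply: ex_derive.
rewrite in_itv/= subr0 => /andP[c0 _] /eqP; rewrite subr_eq => /eqP ->.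
by rewrite addr_ge0// mulr_ge0// df0.
Qed.

(** Starting from [cos x <= 1], each of the next four bounds follows from the
    previous one by integration from [0]. *)
Lemma sin_le x : 0 <= x -> sin x <= x.
Proof.
move=> x0; rewrite -subr_ge0.
apply: (@ge0_of_derive_ge0 (fun y => y - sin y) (fun y => 1 - cos y)) => //.
by rewrite sin0 subr0.
Qed.

Lemma cos_ge x : 0 <= x -> 1 - x ^+ 2 / 2 <= cos x.
Proof.
move=> x0; rewrite -subr_ge0.
apply: (@ge0_of_derive_ge0 (fun y => cos y - (1 - y ^+ 2 / 2)) (fun y => y - sin y)) => //.
- move=> y; apply: is_derive_eq; rewrite /GRing.scale/=; by field.
- by move=> y y0; rewrite subr_ge0 sin_le.
- by rewrite cos0 expr0n/= mul0r !subr0 subrr.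
Qed.

Lemma sin_ge x : 0 <= x -> x - x ^+ 3 / 6 <= sin x.
Proof.
move=> x0; rewrite -subr_ge0.
apply: (@ge0_of_derive_ge0 (fun y => sin y - (y - y ^+ 3 / 6)) (fun y => cos y - (1 - y ^+ 2 / 2))) => //.
- move=> y; apply: is_derive_eq; rewrite /GRing.scale/=; by field.
- by move=> y y0; rewrite subr_ge0 cos_ge.
- by rewrite sin0 expr0n/= mul0r !subr0.
Qed.

Lemma cos_le x : 0 <= x -> cos x <= 1 - x ^+ 2 / 2 + x ^+ 4 / 24.
Proof.
move=> x0; rewrite -subr_ge0.
apply: (@ge0_of_derive_ge0 (fun y => 1 - y ^+ 2 / 2 + y ^+ 4 / 24 - cos y) (fun y => sin y - (y - y ^+ 3 / 6))) => //.
- move=> y; apply: is_derive_eq; rewrite /GRing.scale/=; by field.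
- by move=> y y0; rewrite subr_ge0 sin_ge.
- by rewrite cos0 !expr0n/= !mul0r; lra.
Qed.

Lemma cos_taylor x : `|cos x - (1 - x ^+ 2 / 2)| <= x ^+ 4 / 24.
Proof.
rewrite -cos_norm -(real_normK (num_real x)) (_ : x ^+ 4 = `|x| ^+ 4); last first.
  by rewrite -[4%N]/(2 * 2)%N !exprM real_normK ?num_real.
have x0 := normr_ge0 x; have := cos_ge x0; have := cos_le x0.
by move=> h1 h2; rewrite ler_norml; apply/andP; split; lra.
Qed.

Lemma sin_taylor x : `|sin x - x| <= `|x| ^+ 3 / 6.
Proof.
wlog x0 : x / 0 <= x.
  move=> H; have [/H//|x0] := leP 0 x.
  have := H (- x); rewrite oppr_ge0 sinN normrN opprK => /(_ (ltW x0)).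
  by rewrite addrC distrC.
have := sin_le x0; have := sin_ge x0; rewrite (ger0_norm x0) => h1 h2.
by rewrite ler_norml; apply/andP; split; lra.
Qed.

Lemma expRN_taylor x : 0 <= x -> `|expR (- x) - (1 - x)| <= x ^+ 2 / 2.
Proof.
move=> x0; have e1 : 1 - x <= expR (- x) by exact: expR_ge1Dx.
rewrite ger0_norm ?subr_ge0// -subr_ge0.
apply: (@ge0_of_derive_ge0 (fun y => y ^+ 2 / 2 - (expR (- y) - (1 - y)))
  (fun y => expR (- y) - (1 - y))) => //.
- move=> y; apply: is_derive_eq; rewrite /GRing.scale/=; by field.
- by move=> y y0; rewrite subr_ge0; exact: expR_ge1Dx.
Qed.

Lemma cos_expR x : `|cos x - expR (- (x ^+ 2 / 2))| <= x ^+ 4 / 6.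
Proof.
have h0 : 0 <= x ^+ 2 / 2 by rewrite divr_ge0// sqr_ge0.
have := cos_taylor x; have := expRN_taylor h0.
rewrite !ler_norml => /andP[? ?] /andP[? ?]; apply/andP; split; nra.
Qed.

Lemma distX x y n : `|x| <= 1 -> `|y| <= 1 -> `|x ^+ n - y ^+ n| <= n%:R * `|x - y|.
Proof.
move=> x1 y1; elim: n => [|n ih]; first by rewrite !expr0 subrr normr0 mul0r.
have -> : x ^+ n.+1 - y ^+ n.+1 = (x ^+ n - y ^+ n) * x + y ^+ n * (x - y).
  by rewrite !exprSr; ring.
rewrite (le_trans (ler_normD _ _))// !normrM -addn1 natrD mulrDl mul1r lerD//.
  by rewrite -[leRHS]mulr1 ler_pM.
by rewrite ler_piMl// normrX exprn_ile1.
Qed.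

Lemma norm_expRN_le1 x : 0 <= x -> `|expR (- x)| <= 1.
Proof. by move=> x0; rewrite ger0_norm ?expR_ge0// -expR0 ler_expR oppr_le0. Qed.

(** The N-th power of a cosine is a trigonometric polynomial that imitates a
    Gaussian.  The bound is only quadratic in [x], so that controlling it needs
    no more than second moments: it interpolates between the trivial bound [2]
    and the quartic bound given by Taylor expansion. *)
Lemma cosX_expR x n :
  `|cos x ^+ n - expR (- (n%:R * (x ^+ 2 / 2)))| <= Num.sqrt n%:R * x ^+ 2.
Proof.
have x20 : 0 <= x ^+ 2 / 2 by rewrite divr_ge0// sqr_ge0.
have -> : expR (- (n%:R * (x ^+ 2 / 2))) = expR (- (x ^+ 2 / 2)) ^+ n.
  by rewrite -expRM_natl mulrN.
have c1 := cos_max x; have e1 := norm_expRN_le1 x20.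
set r := Num.sqrt _; have r0 : 0 <= r by exact: sqrtr_ge0.
have r2 : n%:R = r ^+ 2 by rewrite sqr_sqrtr.
have h1 : `|cos x ^+ n - expR (- (x ^+ 2 / 2)) ^+ n| <= n%:R * (x ^+ 4 / 6).
  by rewrite (le_trans (distX n c1 e1))// ler_wpM2l// cos_expR.
have h2 : `|cos x ^+ n - expR (- (x ^+ 2 / 2)) ^+ n| <= 2.
  rewrite (le_trans (ler_normB _ _))// !normrX (_ : 2 = 1 + 1)//.
  by rewrite lerD// exprn_ile1.
rewrite r2 in h1.
have y0 : 0 <= r * x ^+ 2 by rewrite mulr_ge0// sqr_ge0.
(* the quartic bound wins up to 6, and the trivial bound 2 is enough beyond *)
have [h|h] := leP (r * x ^+ 2) 6.
  apply: (le_trans h1); rewrite [leLHS](_ : _ = (r * x ^+ 2) * (r * x ^+ 2) / 6); last by field.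
  by nra.
by rewrite (le_trans h2)//; lra.
Qed.

(** [1 - v / (2 * n)] is the second-order expansion of the characteristic
    function of one among [n] normalized summands with total variance [v]. *)
Lemma onem_exprn_expR v n : 0 <= v -> v <= (2 * n.+1)%:R ->
  `|(1 - v / (2 * n.+1)%:R) ^+ n.+1 - expR (- (v / 2))| <= v ^+ 2 / (8 * n.+1)%:R.
Proof.
move=> v0 vn; set u := v / _.
have n0 : 0 < n.+1%:R :> R by [].
have u0 : 0 <= u by rewrite divr_ge0.
have u1 : u <= 1 by rewrite ler_pdivrMr ?mul1r// ltr0n.
have -> : expR (- (v / 2)) = expR (- u) ^+ n.+1.
  rewrite -expRM_natl mulrN; congr (expR (- _)); rewrite /u natrM; field.
  by rewrite nat1r pnatr_eq0.
have a1 : `|1 - u| <= 1 by rewrite ler_norml; apply/andP; split; lra.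
rewrite (le_trans (distX _ a1 (norm_expRN_le1 u0)))// distrC.
rewrite (le_trans (ler_wpM2l _ (expRN_taylor u0)))//.
rewrite le_eqVlt; apply/orP; left; apply/eqP; rewrite /u !natrM; field.
by rewrite nat1r pnatr_eq0.
Qed.

End elementary.

Lemma expRN_lipschitz {R : realType} (x y : R) : 0 <= x -> 0 <= y ->
  `|expR (- x) - expR (- y)| <= `|x - y|.
Proof.
wlog xy : x y / x <= y.
  by move=> h x0 y0; case: (leP x y) => xy; [exact: h|rewrite distrC (distrC x) h// ltW].
move=> x0 y0; have -> : `|x - y| = y - x by rewrite distrC ger0_norm// subr_ge0.
rewrite ger0_norm ?subr_ge0 ?ler_expR ?lerN2//.
have -> : - y = - x + (x - y) by ring.
rewrite expRD -{1}(mulr1 (expR (- x))) -mulrBr.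
have e1 : expR (- x) <= 1 by rewrite -expR0 ler_expR oppr_le0.
have e0 : 0 <= expR (- x) by exact: expR_ge0.
have := expR_ge1Dx (x - y) => h; nra.
Qed.

(** * Expectations *)

Section expectation_toolkit.
Context {R : realType} {d : measure_display} {T : measurableType d}.
Implicit Types (f g h : T -> R).

(** The integral of a nonnegative function is a supremum over the simple functions
    below it, hence monotone for arbitrary functions.  This matters because the
    squared Wasserstein distance to an empirical measure, an infimum over couplings,
    is not obviously a measurable function of the sample. *)
Lemma ge0_integral_mono (mu : {measure set T -> \bar R}) (f g : T -> \bar R) :
  (forall x, 0 <= f x)%E -> (forall x, f x <= g x)%E ->
  (\int[mu]_x f x <= \int[mu]_x g x)%E.
Proof.
move=> f0 fg; have g0 x : (0 <= g x)%E by exact: le_trans (fg x).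
rewrite !ge0_integralTE//; apply: le_ereal_sup => _ [h hf <-].
by exists h => // x; exact: le_trans (fg x).
Qed.

Variable P : probability T R.

Lemma measure_probability_setT : (P : {measure set T -> \bar R}) setT = 1%E.
Proof. exact: probability_setT. Qed.

Lemma bounded_integrable (M : R) f : measurable_fun setT f ->
  (forall w, `|f w| <= M) -> P.-integrable setT (EFin \o f).
Proof.
move=> mf fM; apply: measurable_bounded_integrable => //.
  by rewrite measure_probability_setT ltry.
by exists M; split; [exact: num_real|move=> x Mx w _; exact: le_trans (ltW Mx)].
Qed.

Lemma Rintegral_probability_cst (c : R) : \int[P]_w c = c.
Proof. by rewrite Rintegral_cst// measure_probability_setT mulr1. Qed.

Lemma integrable_cstr (c : R) : P.-integrable setT (EFin \o (fun=> c)).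
Proof. by apply: (@bounded_integrable `|c|). Qed.

Lemma integrable_mulrl (c : R) f : P.-integrable setT (EFin \o f) ->
  P.-integrable setT (EFin \o (fun w => c * f w)).
Proof.
move=> fi; rewrite (_ : _ \o _ = fun w => (c%:E * (EFin \o f) w)%E).
  exact: integrableZl.
by apply/funext.
Qed.

Lemma integrable_addr f g : P.-integrable setT (EFin \o f) ->
  P.-integrable setT (EFin \o g) -> P.-integrable setT (EFin \o (fun w => f w + g w)).
Proof. by move=> fi gi; exact: (integrableD _ fi gi). Qed.

Lemma integrable_subr f g : P.-integrable setT (EFin \o f) ->
  P.-integrable setT (EFin \o g) -> P.-integrable setT (EFin \o (fun w => f w - g w)).
Proof. by move=> fi gi; exact: (integrableB _ fi gi). Qed.

Lemma integrable_normr f : P.-integrable setT (EFin \o f) ->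
  P.-integrable setT (EFin \o (fun w => `|f w|)).
Proof.
move=> fi; rewrite (_ : _ \o _ = abse \o (EFin \o f)); first exact: integrable_abse.
by apply/funext.
Qed.

Lemma integrable_indicr (A : set T) : measurable A -> P.-integrable setT (EFin \o (\1_A : T -> R)).
Proof.
move=> mA; apply: (@bounded_integrable 1) => [|w]; first exact: measurable_indic.
by rewrite indicE; case: (_ \in _); rewrite ?normr1 ?normr0.
Qed.

Lemma integrable_sumr (I : Type) (r : seq I) (F : I -> T -> R) :
  (forall i, P.-integrable setT (EFin \o F i)) ->
  P.-integrable setT (EFin \o (fun w => \sum_(i <- r) F i w)).
Proof.
move=> iF; rewrite (_ : _ \o _ = fun w => (\sum_(i <- r) (EFin \o F i) w)%E).
  exact: integrable_sum.
by apply/funext => w /=; rewrite sumEFin.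
Qed.

Lemma Rintegral_sumr (I : Type) (r : seq I) (F : I -> T -> R) :
  (forall i, P.-integrable setT (EFin \o F i)) ->
  \int[P]_w (\sum_(i <- r) F i w) = \sum_(i <- r) \int[P]_w F i w.
Proof.
move=> iF; elim: r => [|i r ih].
  by rewrite big_nil; under eq_Rintegral do rewrite big_nil; rewrite Rintegral_probability_cst.
rewrite big_cons -ih; under eq_Rintegral do rewrite big_cons.
by rewrite RintegralD//; exact: integrable_sumr.
Qed.

Lemma EFin_Rintegral f : P.-integrable setT (EFin \o f) ->
  ((\int[P]_w f w)%:E = \int[P]_w (f w)%:E)%E.
Proof. by move=> fi; rewrite /Rintegral fineK//; exact: integrable_fin_num. Qed.

Lemma expectation_dist_le f g h : P.-integrable setT (EFin \o f) ->
  P.-integrable setT (EFin \o g) -> P.-integrable setT (EFin \o h) ->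
  (forall w, `|f w - g w| <= h w) ->
  `|\int[P]_w f w - \int[P]_w g w| <= \int[P]_w h w.
Proof.
move=> fi gi hi fgh; rewrite -RintegralB//.
have fgi : P.-integrable setT (EFin \o (f \- g)) by exact: (integrableB _ fi gi).
rewrite (le_trans (le_normr_Rintegral _ fgi))//; apply: le_Rintegral => //.
  rewrite (_ : _ \o _ = abse \o (EFin \o (f \- g))); first exact: integrable_abse.
  by apply/funext.
by move=> w _; exact: fgh.
Qed.

(** Monotonicity turns [g - h <= f <= g + h] into the corresponding inequality
    between integrals, whether or not [f] is measurable; the positive part of
    [g - h] is the nonnegative minorant needed for the lower bound. *)
Lemma expectation_sandwich (f : T -> \bar R) g h :
  (forall w, 0 <= f w <= 1)%E -> (forall w, 0 <= g w <= 1) ->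
  measurable_fun setT g -> P.-integrable setT (EFin \o h) ->
  (forall w, `|fine (f w) - g w| <= h w) ->
  (\int[P]_w f w)%E \is a fin_num /\
  `|fine (\int[P]_w f w)%E - \int[P]_w g w| <= \int[P]_w h w.
Proof.
move=> f01 g01 mg hi fgh.
have f0 w : (0 <= f w)%E by case/andP: (f01 w).
have ffin w : f w \is a fin_num.
  by rewrite ge0_fin_numE//; case/andP: (f01 w) => _ /le_lt_trans; apply; exact: ltry.
have gi : P.-integrable setT (EFin \o g).
  apply: (@bounded_integrable 1) => // w.
  by case/andP: (g01 w) => ? ?; rewrite ger0_norm.
have intf1 : (\int[P]_w f w <= 1)%E.
  have := @ge0_integral_mono P f (cst 1%E) f0 (fun w => proj2 (andP (f01 w))).
  by rewrite integral_cst// mul1e measure_probability_setT.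
have fin : (\int[P]_w f w)%E \is a fin_num.
  rewrite ge0_fin_numE ?integral_ge0// (le_lt_trans intf1)//.
  by rewrite ltry.
split => //.
have mh : measurable_fun setT h by apply/measurable_EFinP; exact: (measurable_int P).
have up : fine (\int[P]_w f w)%E <= \int[P]_w (g w + h w).
  rewrite -lee_fin fineK// EFin_Rintegral; last first.
    rewrite (_ : _ \o _ = ((EFin \o g) \+ (EFin \o h))%E); first exact: (integrableD _ gi hi).
    by apply/funext.
  apply: ge0_integral_mono => // w; rewrite -(fineK (ffin w)) lee_fin.
  by have := fgh w; rewrite ler_norml => /andP[_]; rewrite lerBlDl.
have gmh : P.-integrable setT (EFin \o (fun w => g w - h w)).
  rewrite (_ : _ \o _ = ((EFin \o g) \- (EFin \o h))%E); first exact: (integrableB _ gi hi).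
  by apply/funext.
have lo : \int[P]_w (g w - h w) <= fine (\int[P]_w f w)%E.
  have h0 w : 0 <= h w by exact: le_trans (fgh w).
  pose k w := Num.max 0 (g w - h w).
  have mk : measurable_fun setT k by apply: measurable_maxr => //; exact: measurable_funB.
  have ki : P.-integrable setT (EFin \o k).
    apply: (@bounded_integrable 1) => // w; rewrite ger0_norm ?le_max ?lexx//.
    rewrite ge_max ler01/=; case/andP: (g01 w) => _ g1.
    by rewrite (le_trans _ g1)// lerBlDr lerDl.
  apply: (@le_trans _ _ (\int[P]_w k w)).
    by apply: le_Rintegral => // w _; rewrite /k le_max lexx orbT.
  rewrite -lee_fin EFin_Rintegral// fineK//; apply: ge0_integral_mono => w.
    by rewrite lee_fin le_max lexx.
  rewrite -(fineK (ffin w)) lee_fin ge_max fine_ge0//=.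
  by have := fgh w; rewrite distrC ler_norml => /andP[_]; rewrite lerBlDl lerBlDr.
rewrite RintegralB// in lo; rewrite RintegralD// in up.
by rewrite ler_norml; apply/andP; split; lra.
Qed.

End expectation_toolkit.
(** * Sums of independent identically distributed discrete variables *)

(** Steps with finitely many values make the law of a sum of independent steps an
    iterated finite average, so that moments and characteristic functions obey
    one-step recursions. *)
Fixpoint walk (R : realType) (K : finType) (p xi : K -> R) (n : nat)
    (phi : R -> R) (x : R) : R :=
  if n is n'.+1 then \sum_k p k * walk p xi n' phi (x + xi k) else phi x.

Section discretized_sample.
Context {R : realType} {d : measure_display} {T : measurableType d}
  {P : probability T R} {n : nat} (X : 'I_n -> {RV P >-> R}) (mu : probability R R).
Hypothesis Xiid : iid X mu.
Context {K : finType} (c : R -> K) (xi : K -> R).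
Hypothesis mc : forall k, measurable (c @^-1` [set k]).

Let p k : R := fine (mu (c @^-1` [set k])).

Let box (B : 'I_n -> set R) : set T := [set w | forall i, B i (X i w)].

Let mbox B : (forall i, measurable (B i)) -> measurable (box B).
Proof.
move=> mB; rewrite (_ : box B = \bigcap_(i in [set: 'I_n]) (X i @^-1` B i)); last first.
  by apply/seteqP; split => [w /= h i _|w h i]; [exact: h|exact: h].
by apply: fin_bigcap_measurable => // i _; rewrite -[X in measurable X]setTI; exact: measurable_funP.
Qed.

Let Pbox B : (forall i, measurable (B i)) -> P (box B) = (\prod_i fine (mu (B i)))%:E.
Proof.
move=> mB; have [ind idl] := Xiid.
have := ind [set: 'I_n]%SET B mB.
rewrite (_ : \bigcap_(i in _) _ = box B); last first.
  apply/seteqP; split => [w h i|w h i _]; last exact: h.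
  by apply: h => /=; rewrite inE.
move=> ->; rewrite -prodEFin big_mkcond/=; apply: eq_bigr => i _; rewrite inE.
by rewrite fineK ?fin_num_measure//; exact: idl.
Qed.

Let S (m : nat) w := \sum_(i < n | (i < m)%N) xi (c (X i w)).

Let SS m (mn : (m < n)%N) w : S m.+1 w = xi (c (X (Ordinal mn) w)) + S m w.
Proof.
rewrite /S (bigD1 (Ordinal mn))//=; congr (_ + _); apply: eq_bigl => i.
by rewrite ltnS -val_eqE/= andbC -ltn_neqAle.
Qed.

(** The induction on the number [m] of variables that are summed carries an
    event [box B] about the remaining ones, so that independence is only used
    through the product rule for such events. *)
Let walk_box m : (m <= n)%N -> forall phi x B, (forall i, measurable (B i)) ->
  (forall i : 'I_n, (i < m)%N -> B i = setT) ->
  P.-integrable setT (EFin \o (fun w => phi (x + S m w) * \1_(box B) w)) /\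
  \int[P]_w (phi (x + S m w) * \1_(box B) w) = walk p xi m phi x * \prod_i fine (mu (B i)).
Proof.
elim: m => [_|m ih mn] phi x B mB BT.
  have -> : (fun w => phi (x + S 0 w) * \1_(box B) w) = (fun w => phi x * \1_(box B) w).
    by apply/funext => w; rewrite /S big_pred0// addr0.
  have i1 : P.-integrable setT (EFin \o \1_(box B) : T -> \bar R) by exact/integrable_indicr/mbox.
  split; first exact: integrable_mulrl.
  rewrite RintegralZl//=; congr (_ * _).
  rewrite /Rintegral; have := @integral_indic _ T R P setT measurableT (box B) (mbox mB).
  by move=> ->; rewrite setIT; have := Pbox mB => /= ->.
pose im := Ordinal mn.
pose Bk k i := if i == im then c @^-1` [set k] else B i.
have mBk k i : measurable (Bk k i) by rewrite /Bk; case: ifP.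
have BkT k (i : 'I_n) : (i < m)%N -> Bk k i = setT.
  move=> im'; rewrite /Bk -val_eqE/= ltn_eqF// BT//; exact: ltnW.
have E : (fun w => phi (x + S m.+1 w) * \1_(box B) w) =
   (fun w => \sum_k (phi ((x + xi k) + S m w) * \1_(box (Bk k)) w)).
  apply/funext => w; rewrite (bigD1 (c (X im w)))//= big1 ?addr0; last first.
    move=> k kc; rewrite indicE memNset ?mulr0//= => /(_ im).
    by rewrite /Bk eqxx/= => ck; rewrite ck eqxx in kc.
  rewrite (SS mn) addrA; congr (_ * _); rewrite !indicE; congr (_%:R); congr nat_of_bool.
  apply/idP/idP; rewrite !inE /= => h i.
    by rewrite /Bk; case: eqP => [->|_].
  have := h i; rewrite /Bk; case: eqP => // -> _.
  by rewrite BT.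
have ihk k := ih (ltnW mn) phi (x + xi k) (Bk k) (mBk k) (BkT k).
split.
  by rewrite E; apply: integrable_sumr => k; case: (ihk k).
rewrite E Rintegral_sumr; last by move=> k; case: (ihk k).
rewrite /= mulr_suml; apply: eq_bigr => k _; rewrite (proj2 (ihk k)).
rewrite (bigD1 im)//= [in RHS](bigD1 im)//= /Bk eqxx (BT im)//=.
have := probability_setT mu => /= ->; rewrite mul1r.
rewrite (eq_bigr (fun i => fine (mu (B i)))); last by move=> i /negPf ->.
by rewrite /p; ring.
Qed.

Lemma expectation_walk phi :
  P.-integrable setT (EFin \o (fun w => phi (\sum_i xi (c (X i w))))) /\
  \int[P]_w phi (\sum_i xi (c (X i w))) = walk p xi n phi 0.
Proof.
have := @walk_box n (leqnn n) phi 0 (fun=> setT) (fun=> measurableT) (fun _ _ => erefl).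
rewrite (_ : (fun w => _) = (fun w => phi (\sum_i xi (c (X i w))))); last first.
  apply/funext => w; rewrite indicE mem_set//= mulr1 add0r /S; congr (phi _).
  by apply: eq_bigl => i; rewrite ltn_ord.
rewrite big1 ?mulr1//= => i _.
by have := probability_setT mu => /= ->.
Qed.

End discretized_sample.

Section walk_estimates.
Context {R : realType} {K : finType} (p xi : K -> R) (M : R).
Hypothesis p0 : forall k, 0 <= p k.
Hypothesis p1 : \sum_k p k = 1.
Hypothesis xi1 : \sum_k p k * xi k = 0.
Hypothesis xiM : forall k, `|xi k| <= M.

Let v := \sum_k p k * xi k ^+ 2.
Let m3 := \sum_k p k * xi k ^+ 3.
Let m4 := \sum_k p k * xi k ^+ 4.

Let avg4 (a b c e f : R) : \sum_k p k * (a + b * xi k + c * xi k ^+ 2 + e * xi k ^+ 3 + f * xi k ^+ 4)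
  = a + c * v + e * m3 + f * m4.
Proof.
transitivity (\sum_k (p k * a + b * (p k * xi k) + c * (p k * xi k ^+ 2) + e * (p k * xi k ^+ 3)
   + f * (p k * xi k ^+ 4))); first by apply: eq_bigr => k _; ring.
by rewrite !big_split/= -!mulr_sumr -mulr_suml p1 xi1 -/v -/m3 -/m4; ring.
Qed.

Lemma walk_sqr m x : walk p xi m (fun y => y ^+ 2) x = x ^+ 2 + m%:R * v.
Proof.
elim: m x => [x|m ih x] /=; first by rewrite mul0r addr0.
rewrite (eq_bigr (fun k => p k * ((x ^+ 2 + m%:R * v) + (2 * x) * xi k
   + 1 * xi k ^+ 2 + 0 * xi k ^+ 3 + 0 * xi k ^+ 4))); last first.
  by move=> k _; rewrite ih; congr (_ * _); ring.
by rewrite avg4; ring.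
Qed.

(** The coefficients are the moments of a sum of [m] centred steps, read off from
    the expansion of a fourth power. *)
Let walk_pow4E m x : walk p xi m (fun y => y ^+ 4) x =
  x ^+ 4 + 6 * m%:R * v * x ^+ 2 + 4 * m%:R * m3 * x + m%:R * m4 + 3 * (m%:R * (m%:R - 1)) * v ^+ 2.
Proof.
elim: m x => [x|m ih x] /=; first by ring.
set A := RHS.
rewrite (eq_bigr (fun k => p k * (
  (x ^+ 4 + 6 * m%:R * v * x ^+ 2 + 4 * m%:R * m3 * x + m%:R * m4 + 3 * (m%:R * (m%:R - 1)) * v ^+ 2)
  + (4 * x ^+ 3 + 12 * m%:R * v * x + 4 * m%:R * m3) * xi k
   + (6 * x ^+ 2 + 6 * m%:R * v) * xi k ^+ 2 + (4 * x) * xi k ^+ 3 + 1 * xi k ^+ 4))); last first.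
  by move=> k _; rewrite ih; congr (_ * _); ring.
by rewrite avg4 /A; ring.
Qed.

Let avg_le (f : K -> R) (c : R) : (forall k, f k <= c) -> \sum_k p k * f k <= c.
Proof.
move=> fc; rewrite -[leRHS]mul1r -p1 mulr_suml; apply: ler_sum => k _.
by rewrite ler_wpM2l.
Qed.

Let M0 (k : K) : 0 <= M := le_trans (normr_ge0 (xi k)) (xiM k).

Let norm_xiX k j : `|xi k| ^+ j <= M ^+ j.
Proof. by rewrite lerXn2r// nnegrE// (M0 k). Qed.

Lemma walk_var_ge0 : 0 <= v.
Proof. by apply: sumr_ge0 => k _; rewrite mulr_ge0// sqr_ge0. Qed.

Lemma walk_var_le : v <= M ^+ 2.
Proof. by apply: avg_le => k; rewrite -(real_normK (num_real _)) norm_xiX. Qed.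

Lemma walk_pow4 m : walk p xi m (fun y => y ^+ 4) 0 <= (m%:R ^+ 2) * (4 * M ^+ 4).
Proof.
have m4M : m4 <= M ^+ 4.
  apply: avg_le => k; rewrite (_ : xi k ^+ 4 = `|xi k| ^+ 4) ?norm_xiX//.
  by rewrite -[4%N]/(2 * 2)%N !exprM real_normK ?num_real.
have v2M : v ^+ 2 <= M ^+ 4.
  rewrite (_ : M ^+ 4 = (M ^+ 2) ^+ 2); last by rewrite -exprM.
  by rewrite lerXn2r ?nnegrE ?walk_var_ge0 ?sqr_ge0// walk_var_le.
have v20 := sqr_ge0 v.
case: m => [|m]; first by rewrite /= !expr0n/= mul0r.
rewrite walk_pow4E !expr0n/= !mulr0 !add0r.
have m1 : 1 <= m.+1%:R :> R by rewrite ler1n.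
set a := m.+1%:R in m1 *.
have M40 : 0 <= M ^+ 4 by exact: le_trans v2M.
have h1 : a * m4 <= a ^+ 2 * M ^+ 4.
  apply: (@le_trans _ _ (a * M ^+ 4)); first by rewrite ler_wpM2l//; lra.
  by rewrite ler_wpM2r// expr2 ler_peMl//; lra.
have h2 : 3 * (a * (a - 1)) * v ^+ 2 <= 3 * a ^+ 2 * M ^+ 4.
  by apply: ler_pM => //; nra.
lra.
Qed.

Let avg_dist (f : K -> R) (x c : R) : (forall k, `|f k - x| <= c) -> `|\sum_k p k * f k - x| <= c.
Proof.
move=> fc; rewrite -[x in _ - x]mul1r -p1 mulr_suml -sumrB.
under eq_bigr do rewrite -mulrBr.
rewrite (le_trans (ler_norm_sum _ _ _))//.
under eq_bigr do rewrite normrM ger0_norm//.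
exact: avg_le.
Qed.

(** One step of the walk multiplies the characteristic function by
    [1 - s ^+ 2 * v / 2], up to a third-order error in the scale [s]. *)
Lemma walk_cos m (s b x : R) : 0 <= s -> s ^+ 2 * v <= 4 ->
  `|walk p xi m (fun y => cos (s * y + b)) x - (1 - s ^+ 2 * v / 2) ^+ m * cos (s * x + b)|
  <= m%:R * ((s * M) ^+ 4 / 24 + (s * M) ^+ 3 / 6).
Proof.
move=> s0 sv; set q := 1 - _; set D := _ / 24 + _.
have v0 := walk_var_ge0.
have sv0 : 0 <= s ^+ 2 * v by rewrite mulr_ge0// sqr_ge0.
have q1 : `|q| <= 1 by rewrite ler_norml /q; apply/andP; split; lra.
have step y : `|\sum_k p k * cos (s * (y + xi k) + b) - q * cos (s * y + b)| <= D.
  set C := cos (s * y + b); set Si := sin (s * y + b).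
  have -> : \sum_k p k * cos (s * (y + xi k) + b) - q * C =
     C * (\sum_k p k * (cos (s * xi k) - (1 - (s * xi k) ^+ 2 / 2)))
     - Si * (\sum_k p k * (sin (s * xi k) - s * xi k)).
    have h1 : \sum_k p k * (cos (s * xi k) - (1 - (s * xi k) ^+ 2 / 2)) =
        \sum_k p k * cos (s * xi k) - q.
      rewrite /q (_ : 1 - _ = \sum_k p k * (1 - (s * xi k) ^+ 2 / 2)).
        by rewrite -sumrB; apply: eq_bigr => k _; rewrite mulrBr.
      transitivity (\sum_k p k * (1 + 0 * xi k + (- s ^+ 2 / 2) * xi k ^+ 2 + 0 * xi k ^+ 3 + 0 * xi k ^+ 4)).
        by rewrite avg4; field.
      by apply: eq_bigr => k _; field.
    have h2 : \sum_k p k * (sin (s * xi k) - s * xi k) = \sum_k p k * sin (s * xi k).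
      under eq_bigr do rewrite mulrBr.
      rewrite sumrB (_ : \sum_k p k * (s * xi k) = s * \sum_k p k * xi k).
        by rewrite xi1 mulr0 subr0.
      by rewrite mulr_sumr; apply: eq_bigr => k _; ring.
    rewrite h1 h2 mulrBr mulr_sumr mulr_sumr.
    rewrite (eq_bigr (fun k => C * (p k * cos (s * xi k)) - Si * (p k * sin (s * xi k)))).
      by rewrite sumrB; ring.
    move=> k _; rewrite (_ : s * (y + xi k) + b = (s * y + b) + s * xi k); last by ring.
    by rewrite cosD -/C -/Si; ring.
  have a1 : `|\sum_k p k * (cos (s * xi k) - (1 - (s * xi k) ^+ 2 / 2))| <= (s * M) ^+ 4 / 24.
    rewrite -[X in `|X|]subr0; apply: avg_dist => k; rewrite subr0 (le_trans (cos_taylor _))//.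
    rewrite ler_wpM2r// (_ : (s * xi k) ^+ 4 = (s * `|xi k|) ^+ 4); last first.
      rewrite !exprMn; congr (_ * _).
      by rewrite -[4%N]/(2 * 2)%N !exprM real_normK ?num_real.
    by rewrite !exprMn ler_wpM2l ?exprn_ge0.
  have a2 : `|\sum_k p k * (sin (s * xi k) - s * xi k)| <= (s * M) ^+ 3 / 6.
    rewrite -[X in `|X|]subr0; apply: avg_dist => k; rewrite subr0 (le_trans (sin_taylor _))//.
    by rewrite ler_wpM2r// normrM (ger0_norm s0) !exprMn ler_wpM2l ?exprn_ge0.
  rewrite (le_trans (ler_normB _ _))// /D lerD// normrM.
    by rewrite -[leRHS]mul1r ler_pM// cos_max.
  by rewrite -[leRHS]mul1r ler_pM// sin_max.
elim: m x => [|m ih] x /=.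
  by rewrite expr0 mul1r subrr normr0 mul0r.
set A := \sum_k _.
have -> : A - q ^+ m.+1 * cos (s * x + b) =
   \sum_k p k * (walk p xi m (fun y => cos (s * y + b)) (x + xi k) - q ^+ m * cos (s * (x + xi k) + b))
   + q ^+ m * (\sum_k p k * cos (s * (x + xi k) + b) - q * cos (s * x + b)).
  rewrite mulrBr mulr_sumr; under [X in _ = X + _]eq_bigr do rewrite mulrBr.
  rewrite sumrB /A exprSr.
  rewrite [X in _ = _ - X + _](_ : _ = \sum_k q ^+ m * (p k * cos (s * (x + xi k) + b))); first by ring.
  by apply: eq_bigr => k _; ring.
have -> : m.+1%:R * D = m%:R * D + D by ring.
rewrite (le_trans (ler_normD _ _))// lerD//.
  by rewrite -[X in `|X|]subr0; apply: avg_dist => k; rewrite subr0.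
rewrite normrM -[leRHS]mul1r ler_pM// normrX exprn_ile1//.
Qed.

End walk_estimates.
(** * Empirical distribution functions *)

Definition dfun (R : realType) (mu : set R -> \bar R) (t : R) : R :=
  fine (mu `]-oo, t]%classic).

Definition le_indic (R : realType) (t y : R) : R := (y <= t)%R%:R.

Section distribution_function.
Context {R : realType} (mu : probability R R).
Local Notation G := (dfun mu).

Lemma EFin_dfun t : mu `]-oo, t]%classic = (G t)%:E.
Proof. by rewrite /dfun fineK// fin_num_measure. Qed.

Lemma dfun_ge0 t : 0 <= G t.
Proof. by rewrite fine_ge0. Qed.

Lemma dfun_le1 t : G t <= 1.
Proof. by rewrite -lee_fin -EFin_dfun probability_le1. Qed.

Lemma dfun_nd s t : s <= t -> G s <= G t.
Proof.
move=> st; rewrite -lee_fin -!EFin_dfun le_measure ?inE//.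
by move=> x /=; rewrite !in_itv/= => /le_trans; apply.
Qed.

Lemma dfun_min s t : G (Num.min s t) = Num.min (G s) (G t).
Proof.
by case: (leP s t) => st; [rewrite min_l ?dfun_nd|rewrite min_r ?dfun_nd// ltW].
Qed.

Lemma le_indic_bounds (t y : R) : 0 <= le_indic t y <= 1.
Proof. by rewrite /le_indic; case: (y <= t); rewrite /= ?lexx ?ler01. Qed.

Lemma le_indic_dfun (t y : R) : `|le_indic t y - G t| <= 1.
Proof.
have := dfun_ge0 t; have := dfun_le1 t; have := le_indic_bounds t y.
by move=> /andP[? ?] ? ?; rewrite ler_norml; apply/andP; split; lra.
Qed.

Lemma measurable_le_indic (t : R) : measurable_fun setT (le_indic t).
Proof.
rewrite (_ : le_indic t = \1_(`]-oo, t]%classic)); first exact: measurable_indic.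
by apply/funext => y; rewrite /le_indic indicE mem_setE in_itv.
Qed.

Lemma integrable_le_indic t : mu.-integrable setT (EFin \o (le_indic t)).
Proof.
apply: (@bounded_integrable _ _ _ mu 1); first exact: measurable_le_indic.
by move=> y; case/andP: (le_indic_bounds t y) => ? ?; rewrite ger0_norm.
Qed.

Lemma expectation_le_indic t : \int[mu]_y (le_indic t y) = G t.
Proof.
rewrite /Rintegral (_ : (fun y => _) = EFin \o \1_(`]-oo, t]%classic)); last first.
  by apply/funext => y; rewrite /le_indic /= indicE mem_setE in_itv.
by have /= -> := @integral_indic _ R R mu setT measurableT `]-oo, t]%classic; rewrite ?setIT.
Qed.

(** This identifies the finite averages that define a walk with expectations under
    [mu]. *)
Lemma cell_average (K : finType) (c : R -> K) (psi : K -> R) :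
  (forall k, measurable (c @^-1` [set k])) ->
  mu.-integrable setT (EFin \o (psi \o c)) /\
  \sum_k fine (mu (c @^-1` [set k])) * psi k = \int[mu]_y psi (c y).
Proof.
move=> mc.
have E : psi \o c = (fun y => \sum_k psi k * \1_(c @^-1` [set k]) y).
  apply/funext => y; rewrite /= (bigD1 (c y))//= big1 ?addr0.
    by rewrite indicE mem_set// mulr1.
  by move=> k kc; rewrite indicE memNset ?mulr0//= => ck; rewrite ck eqxx in kc.
have i1 k : mu.-integrable setT (EFin \o \1_(c @^-1` [set k]) : R -> \bar R).
  by apply: integrable_indicr; exact: mc.
have i2 k : mu.-integrable setT (EFin \o (fun y => psi k * \1_(c @^-1` [set k]) y)).
  exact: integrable_mulrl.
split; first by rewrite E; exact: integrable_sumr.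
rewrite -[RHS]/(\int[mu]_y (psi \o c) y) E Rintegral_sumr//; apply: eq_bigr => k _.
rewrite RintegralZl//= mulrC; congr (_ * _).
rewrite /Rintegral; have := @integral_indic _ R R mu setT measurableT (c @^-1` [set k]) (mc k).
by move=> ->; rewrite setIT.
Qed.

Lemma cov_le_indic s t :
  \int[mu]_y ((le_indic s y - G s) * (le_indic t y - G t)) = Num.min (G s) (G t) - G s * G t.
Proof.
transitivity (\int[mu]_y (le_indic (Num.min s t) y - G t * le_indic s y + (G s * G t - G s * le_indic t y))).
  apply: eq_Rintegral => y _; rewrite /le_indic le_min.
  by case: (y <= s) => /=; case: (y <= t) => /=; ring.
have ii := integrable_le_indic.
rewrite RintegralD ?RintegralB ?RintegralZl ?expectation_le_indic ?Rintegral_probability_cst//;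
  do ?[exact: integrable_cstr | exact: integrable_mulrl | by apply: integrable_subr; [exact: integrable_cstr|exact: integrable_mulrl]
   | by apply: integrable_subr; [|exact: integrable_mulrl]].
by rewrite dfun_min; ring.
Qed.

End distribution_function.

Section empirical_process.
Context {R : realType} {d : measure_display} {T : measurableType d}
  {P : probability T R} {n : nat} (X : 'I_n -> {RV P >-> R}) (mu : probability R R).
Hypothesis Xiid : iid X mu.
Local Notation G := (dfun mu).
Context {m : nat} (x : 'I_m -> R) (th : 'I_m -> R).

Definition cumulative_sum (w : T) : R :=
  \sum_i \sum_j th j * (le_indic (x j) (X i w) - G (x j)).

Definition cumulative_var : R :=
  \sum_i \sum_j th i * th j * (Num.min (G (x i)) (G (x j)) - G (x i) * G (x j)).

(** A summand depends on the sample point only through the bits [y <= x j], so that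
    [cumulative_sum] is a walk with steps indexed by bit vectors. *)
Let K := {ffun 'I_m -> bool}.
Let c (y : R) : K := [ffun j => y <= x j].
Let xi (k : K) : R := \sum_j th j * ((k j)%:R - G (x j)).
Let p (k : K) : R := fine (mu (c @^-1` [set k])).
Let M := \sum_j `|th j|.

Let mc k : measurable (c @^-1` [set k]).
Proof.
rewrite (_ : _ @^-1` _ = \bigcap_(j in [set: 'I_m]) [set y | (y <= x j) = k j]); last first.
  apply/seteqP; split => [y /= <- j _ /=|y /= h]; first by rewrite ffunE.
  by apply/ffunP => j; rewrite ffunE; exact: h.
apply: fin_bigcap_measurable => // j _; case: (k j).
  rewrite (_ : [set y | _] = `]-oo, x j]%classic)//.
rewrite (_ : [set y | _] = `]x j, +oo[%classic)//.
by apply/seteqP; split => y /=; rewrite in_itv/= andbT ltNge; [move=> ->|move/negPf].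
Qed.

Let avg psi := (@cell_average R mu K c psi mc).2.

Let p0 k : 0 <= p k. Proof. exact: fine_ge0. Qed.

Let p1 : \sum_k p k = 1.
Proof.
have := avg (fun=> 1); rewrite Rintegral_probability_cst => <-.
by apply: eq_bigr => k _; rewrite mulr1.
Qed.

Let ind_int j : mu.-integrable setT (EFin \o (fun y : R => le_indic (x j) y - G (x j) : R)).
Proof.
apply: (@bounded_integrable _ _ _ mu 1).
  by apply: measurable_funB => //; exact: measurable_le_indic.
by move=> y; exact: le_indic_dfun.
Qed.

Let xiE y : xi (c y) = \sum_j th j * (le_indic (x j) y - G (x j)).
Proof. by apply: eq_bigr => j _; rewrite ffunE. Qed.

Let xi1 : \sum_k p k * xi k = 0.
Proof.
rewrite avg; under eq_Rintegral do rewrite xiE.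
rewrite Rintegral_sumr; last first.
  by move=> j; apply: integrable_mulrl; exact: ind_int.
rewrite big1// => j _; rewrite RintegralZl// RintegralB// ?expectation_le_indic ?Rintegral_probability_cst.
- by rewrite subrr mulr0.
- exact: integrable_le_indic.
- by apply: (@bounded_integrable _ _ _ mu `|G (x j)|).
Qed.

Let vE : \sum_k p k * xi k ^+ 2 = cumulative_var.
Proof.
rewrite (avg (fun k => xi k ^+ 2)).
have ij i j : mu.-integrable setT (EFin \o (fun y : R => (le_indic (x i) y - G (x i)) * (le_indic (x j) y - G (x j)) : R)).
  apply: (@bounded_integrable _ _ _ mu 1).
    by apply: measurable_funM; apply: measurable_funB => //; exact: measurable_le_indic.
  by move=> y; rewrite normrM -[leRHS]mul1r ler_pM// le_indic_dfun.
have ijZ i j : mu.-integrable setT (EFin \o (fun y : R => th i * th j * ((le_indic (x i) y - G (x i)) * (le_indic (x j) y - G (x j))) : R)).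
  exact: integrable_mulrl.
transitivity (\int[mu]_y (\sum_i \sum_j (th i * th j * ((le_indic (x i) y - G (x i)) * (le_indic (x j) y - G (x j)))))).
  apply: eq_Rintegral => y _; rewrite xiE expr2 mulr_suml; apply: eq_bigr => i _.
  by rewrite mulr_sumr; apply: eq_bigr => j _; ring.
rewrite Rintegral_sumr; last by move=> i; exact: integrable_sumr.
apply: eq_bigr => i _; rewrite Rintegral_sumr//; apply: eq_bigr => j _.
by rewrite RintegralZl// cov_le_indic.
Qed.

Let xiM k : `|xi k| <= M.
Proof.
rewrite (le_trans (ler_norm_sum _ _ _))//; apply: ler_sum => j _.
rewrite normrM ler_piMr// ler_norml.
have := dfun_ge0 mu (x j); have := dfun_le1 mu (x j).
by case: (k j) => /= h1 h2; apply/andP; split; lra.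
Qed.

Let SE w : cumulative_sum w = \sum_i xi (c (X i w)).
Proof. by apply: eq_bigr => i _; rewrite xiE. Qed.

Lemma integrable_cumulative_sum (phi : R -> R) :
  P.-integrable setT (EFin \o (fun w => phi (cumulative_sum w))).
Proof.
by under eq_fun do rewrite SE; have [] := expectation_walk Xiid xi mc phi.
Qed.

Let walkE (phi : R -> R) :
  \int[P]_w phi (cumulative_sum w) = walk p xi n phi 0.
Proof.
by under eq_Rintegral do rewrite SE; have [] := expectation_walk Xiid xi mc phi.
Qed.

Lemma cumulative_var_ge0 : 0 <= cumulative_var.
Proof. by rewrite -vE; exact: walk_var_ge0. Qed.

Lemma cumulative_var_le : cumulative_var <= M ^+ 2.
Proof. by rewrite -vE; exact: (walk_var_le p0 p1 xiM). Qed.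

Lemma expectation_cumulative_sum2 : \int[P]_w (cumulative_sum w ^+ 2) = n%:R * cumulative_var.
Proof.
by rewrite (walkE (fun y => y ^+ 2)) (walk_sqr p1 xi1) expr0n/= add0r vE.
Qed.

Lemma expectation_cumulative_sum4 :
  \int[P]_w (cumulative_sum w ^+ 4) <= n%:R ^+ 2 * (4 * M ^+ 4).
Proof. by rewrite (walkE (fun y => y ^+ 4)); exact: (walk_pow4 p0 p1 xi1 xiM). Qed.

Lemma expectation_cumulative_cos (s b : R) : 0 <= s -> s ^+ 2 * cumulative_var <= 4 ->
  `|\int[P]_w cos (s * cumulative_sum w + b) - (1 - s ^+ 2 * cumulative_var / 2) ^+ n * cos b|
  <= n%:R * ((s * M) ^+ 4 / 24 + (s * M) ^+ 3 / 6).
Proof.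
move=> s0 sv; rewrite (walkE (fun y => cos (s * y + b))).
have := @walk_cos _ _ p xi M p0 p1 xi1 xiM n s b 0 s0.
by rewrite vE mulr0 add0r; exact.
Qed.

End empirical_process.
(** * From characteristic functions to Laplace transforms of quadratic forms *)

Section convergence_tools.
Context {R : realType}.

Lemma dist_prod (I : Type) (r : seq I) (a b : I -> R) :
  (forall i, `|a i| <= 1) -> (forall i, `|b i| <= 1) ->
  `|\prod_(i <- r) a i - \prod_(i <- r) b i| <= \sum_(i <- r) `|a i - b i|.
Proof.
move=> a1 b1; elim: r => [|i r ih]; first by rewrite !big_nil subrr normr0.
rewrite !big_cons.
have -> : a i * \prod_(j <- r) a j - b i * \prod_(j <- r) b j =
  (a i - b i) * \prod_(j <- r) a j + b i * (\prod_(j <- r) a j - \prod_(j <- r) b j) by ring.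
have p1 : `|\prod_(j <- r) a j| <= 1.
  rewrite normr_prod; elim: r {ih} => [|j r ih]; first by rewrite big_nil.
  by rewrite big_cons mulr_ile1// prodr_ge0.
rewrite (le_trans (ler_normD _ _))// !normrM lerD//; first by rewrite ler_piMr.
by rewrite (le_trans _ ih)// ler_piMl.
Qed.

Lemma cvg_eqn (u v : nat -> R) (l l' : R) : u =1 v -> l = l' ->
  v @ \oo --> l' -> u @ \oo --> l.
Proof. by move=> /funext -> ->. Qed.

Lemma cvg_of_rate (C : R) (u : nat -> R) (l : R) (n0 : nat) :
  (forall n, (n0 <= n)%N -> `|u n - l| <= C / Num.sqrt n%:R) -> u @ \oo --> l.
Proof.
move=> h; apply/cvgrPdist_le => e e0; near=> n.
rewrite distrC (le_trans (h n _))//; first by near: n; exact: nbhs_infty_ge.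
have n1 : (0 < n)%N by near: n; exact: nbhs_infty_gt.
have s0 : 0 < Num.sqrt n%:R :> R by rewrite sqrtr_gt0 ltr0n.
rewrite ler_pdivrMr// -ler_pdivrMl// (le_trans (ler_norm _))//.
rewrite -sqrtr_sqr ler_wsqrtr//; near: n; exact: nbhs_infty_ger.
Unshelve. all: by end_near. Qed.

End convergence_tools.

Section quadratic_laplace.
Context {R : realType} {m : nat}.
Context {disp : nat -> measure_display} {T : forall n, measurableType (disp n)}
  (P : forall n, probability (T n) R) (Y : forall n, 'I_m -> T n -> R).
Context {disp' : measure_display} {T' : measurableType disp'}
  (P' : probability T' R) (Y' : 'I_m -> T' -> R).
Arguments Y : clear implicits.

Hypothesis mY : forall n j, measurable_fun setT (Y n j).
Hypothesis mY' : forall j, measurable_fun setT (Y' j).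
Hypothesis char_cvg : forall (th : 'I_m -> R) (b : R),
  \int[P n]_w cos (\sum_j th j * Y n j w + b) @[n --> \oo] -->
  \int[P']_w cos (\sum_j th j * Y' j w + b).
Variable V : R.
Hypothesis Y2 : forall n j, (P n).-integrable setT (EFin \o (fun w => Y n j w ^+ 2)) /\
  \int[P n]_w (Y n j w ^+ 2) <= V.
Hypothesis Y2' : forall j, P'.-integrable setT (EFin \o (fun w => Y' j w ^+ 2)) /\
  \int[P']_w (Y' j w ^+ 2) <= V.

Let lin (th : 'I_m -> R) (b : R) (y : 'I_m -> R) : R := \sum_j th j * y j + b.

(** Functions whose expectation converges, even after multiplication by an
    arbitrary trigonometric factor. *)
Let good (f : ('I_m -> R) -> R) :=
  [/\ forall n, measurable_fun setT (fun w => f (Y n ^~ w)),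
      measurable_fun setT (fun w => f (Y' ^~ w)),
      forall y, `|f y| <= 1 &
      forall th b, \int[P n]_w (f (Y n ^~ w) * cos (lin th b (Y n ^~ w))) @[n --> \oo] -->
                   \int[P']_w (f (Y' ^~ w) * cos (lin th b (Y' ^~ w)))].

Let measurable_cosr d (U : measurableType d) (f : U -> R) :
  measurable_fun setT f -> measurable_fun setT (cos \o f).
Proof. by move=> mf; apply: measurableT_comp mf; apply: continuous_measurable_fun; exact: continuous_cos. Qed.

Let measurable_lin d (U : measurableType d) (Z : 'I_m -> U -> R) th b :
  (forall j, measurable_fun setT (Z j)) ->
  measurable_fun setT (fun w => cos (lin th b (fun j => Z j w))).
Proof.
move=> mZ; apply: measurable_cosr; apply: measurable_funD => //.
by apply: measurable_sum => j; apply: measurable_funM.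
Qed.

Let integrable_good d (U : measurableType d) (Q : probability U R) (Z : 'I_m -> U -> R)
    (f : ('I_m -> R) -> R) th b :
  (forall j, measurable_fun setT (Z j)) ->
  measurable_fun setT (fun w => f (fun j => Z j w)) -> (forall y, `|f y| <= 1) ->
  Q.-integrable setT (EFin \o (fun w => f (fun j => Z j w) * cos (lin th b (fun j => Z j w)))).
Proof.
move=> mZ mf f1; apply: (@bounded_integrable _ _ _ Q 1).
  by apply: measurable_funM => //; exact: measurable_lin.
by move=> w; rewrite normrM mulr_ile1// cos_max.
Qed.

Let lin_shift th b k h y : lin (fun j => th j + (j == k)%:R * h) b y = lin th b y + h * y k.
Proof.
rewrite /lin; under eq_bigr do rewrite mulrDl.
rewrite big_split/= -!addrA; congr (_ + _).
rewrite (bigD1 k)//= big1 ?eqxx/=; first by rewrite mul1r addr0 addrC.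
by move=> i /negPf ->; rewrite !mul0r.
Qed.

Let good1 : good (fun=> 1).
Proof.
split => //; first by move=> y; rewrite normr1.
move=> th b; apply: cvg_eqn (@char_cvg th b) => [n|].
  by apply: eq_Rintegral => w _; rewrite mul1r.
by apply: eq_Rintegral => w _; rewrite mul1r.
Qed.

Let good_cos k h f : good f -> good (fun y => f y * cos (h * y k)).
Proof.
move=> [mf mf' f1 fc]; split.
- move=> n; apply: measurable_funM => //; apply: measurable_cosr.
  by apply: measurable_funM => //; exact: mY.
- apply: measurable_funM => //; apply: measurable_cosr.
  by apply: measurable_funM => //; exact: mY'.
- by move=> y; rewrite normrM mulr_ile1// cos_max.
move=> th b.
pose thp s j := th j + (j == k)%:R * (s * h).
have E d (U : measurableType d) (Q : probability U R) (Z : 'I_m -> U -> R) :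
  (forall j, measurable_fun setT (Z j)) ->
  measurable_fun setT (fun w => f (fun j => Z j w)) ->
  \int[Q]_w (f (Z ^~ w) * cos (h * Z k w) * cos (lin th b (Z ^~ w))) =
  2^-1 * (\int[Q]_w (f (Z ^~ w) * cos (lin (thp 1) b (Z ^~ w)))
          + \int[Q]_w (f (Z ^~ w) * cos (lin (thp (-1)) b (Z ^~ w)))).
  move=> mZ mfZ; rewrite -RintegralD//; last 2 first.
  - exact: integrable_good.
  - exact: integrable_good.
  rewrite -RintegralZl//; last by apply: integrable_addr; exact: integrable_good.
  apply: eq_Rintegral => w _; rewrite !lin_shift !mul1r mulN1r mulNr cosB cosD; by field.
apply: cvg_eqn (fun n => E _ _ (P n) (Y n) (@mY n) (mf n)) (E _ _ P' Y' mY' mf') _.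
by apply: cvgMr; apply: cvgD; exact: fc.
Qed.

Let good_cosX k h n f : good f -> good (fun y => f y * cos (h * y k) ^+ n).
Proof.
elim: n f => [f|n ih f gf].
  by rewrite (_ : (fun y => _) = f)//; apply/funext => y; rewrite expr0 mulr1.
rewrite (_ : (fun y => _) = (fun y => (f y * cos (h * y k)) * cos (h * y k) ^+ n)); last first.
  by apply/funext => y; rewrite exprS mulrA.
exact/ih/good_cos.
Qed.

Let good_prod (h : 'I_m -> R) n (r : seq 'I_m) : good (fun y => \prod_(j <- r) cos (h j * y j) ^+ n).
Proof.
elim: r => [|j r ih].
  rewrite (_ : (fun y => _) = fun=> 1); first exact: good1.
  by apply/funext => y; rewrite big_nil.
rewrite (_ : (fun y => _) = (fun y => (\prod_(j <- r) cos (h j * y j) ^+ n) * cos (h j * y j) ^+ n)).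
  exact: good_cosX.
by apply/funext => y; rewrite big_cons mulrC.
Qed.

Variable c : 'I_m -> R.
Hypothesis c0 : forall j, 0 <= c j.

Let gauss (y : 'I_m -> R) : R := expR (- \sum_j c j * y j ^+ 2).

Let measurable_gauss d (U : measurableType d) (Z : 'I_m -> U -> R) :
  (forall j, measurable_fun setT (Z j)) -> measurable_fun setT (fun w => gauss (Z ^~ w)).
Proof.
move=> mZ; apply: measurableT_comp => //; apply: measurableT_comp => //.
by apply: measurable_sum => j; apply: measurable_funM => //; exact: measurable_funX.
Qed.

(** [cos (y * sqrt (2 * c) / N) ^+ (N ^ 2)] tends to [expR (- c * y ^+ 2)]. *)
Let approx (N : nat) (y : 'I_m -> R) : R :=
  \prod_j cos (Num.sqrt (2 * c j) / N.+1%:R * y j) ^+ (N.+1 ^ 2).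

Let approx_gauss N y : `|approx N y - gauss y| <= \sum_j 2 * c j / N.+1%:R * y j ^+ 2.
Proof.
have N0 : N.+1%:R != 0 :> R by rewrite pnatr_eq0.
have -> : gauss y = \prod_j expR (- (c j * y j ^+ 2)) by rewrite /gauss -sumrN expR_sum.
have h1 j : `|expR (- (c j * y j ^+ 2))| <= 1 by rewrite norm_expRN_le1// mulr_ge0// sqr_ge0.
rewrite (le_trans (dist_prod _ _ h1))//.
  by move=> j; rewrite normrX exprn_ile1// cos_max.
apply: ler_sum => j _.
have := @cosX_expR R (Num.sqrt (2 * c j) / N.+1%:R * y j) (N.+1 ^ 2).
have -> : (Num.sqrt (2 * c j) / N.+1%:R * y j) ^+ 2 = 2 * c j / N.+1%:R ^+ 2 * y j ^+ 2.
  by rewrite !exprMn sqr_sqrtr ?mulr_ge0// exprVn.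
rewrite natrX sqrtr_sqr normr_nat.
rewrite (_ : N.+1%:R ^+ 2 * _ = c j * y j ^+ 2); last by field.
by rewrite (_ : N.+1%:R * _ = 2 * c j / N.+1%:R * y j ^+ 2); last by field.
Qed.

Let approx_dist d (U : measurableType d) (Q : probability U R) (Z : 'I_m -> U -> R) N :
  (forall j, measurable_fun setT (Z j)) ->
  (forall j, Q.-integrable setT (EFin \o (fun w => Z j w ^+ 2)) /\
  \int[Q]_w (Z j w ^+ 2) <= V) ->
  measurable_fun setT (fun w => approx N (Z ^~ w)) ->
  `|\int[Q]_w approx N (Z ^~ w) - \int[Q]_w gauss (Z ^~ w)| <= (\sum_j 2 * c j * V) / N.+1%:R.
Proof.
move=> mZ Z2 ma.
have i1 : Q.-integrable setT (EFin \o (fun w => approx N (Z ^~ w))).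
  apply: (@bounded_integrable _ _ _ Q 1) => // w; rewrite /approx normr_prod.
  by rewrite prodr_ile1// => j _; rewrite normr_ge0/= normrX exprn_ile1// cos_max.
have i2 : Q.-integrable setT (EFin \o (fun w => gauss (Z ^~ w))).
  apply: (@bounded_integrable _ _ _ Q 1) => [|w]; first exact: measurable_gauss.
  by rewrite norm_expRN_le1// sumr_ge0// => j _; rewrite mulr_ge0// sqr_ge0.
have i3 j : Q.-integrable setT (EFin \o (fun w => 2 * c j / N.+1%:R * Z j w ^+ 2)).
  by apply: integrable_mulrl; case: (Z2 j).
apply: (le_trans (expectation_dist_le i1 i2 _ (fun w => approx_gauss N (Z ^~ w)))).
  exact: integrable_sumr.
rewrite Rintegral_sumr// mulr_suml; apply: ler_sum => j _.
rewrite RintegralZl//; last by case: (Z2 j).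
rewrite mulrAC ler_wpM2r ?invr_ge0// ler_wpM2l ?mulr_ge0//; by case: (Z2 j).
Qed.

(** Powers of cosines are trigonometric polynomials, so the expectation of
    [approx N] converges for each [N], and [approx N] is close to the Gaussian
    function in mean, uniformly along the sequence, by the second moment bound. *)
Lemma cvg_quadratic_laplace :
  \int[P n]_w expR (- \sum_j c j * Y n j w ^+ 2) @[n --> \oo] -->
  \int[P']_w expR (- \sum_j c j * Y' j w ^+ 2).
Proof.
apply/cvgrPdist_le => e e0.
have e3 : 0 < e / 3 by rewrite divr_gt0.
pose D := \sum_j 2 * c j * V.
have [N /(_ N (leqnn N)) hN] : exists N, forall N', (N <= N')%N -> D / (e / 3) <= N'%:R.
  by have [N _ h] := nbhs_infty_ger (D / (e / 3)); exists N.
have DN : D / N.+1%:R <= e / 3.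
  rewrite ler_pdivrMr// mulrC -ler_pdivrMr//.
  by rewrite (le_trans hN)// ler_nat.
have [ma ma' _ /(_ (fun=> 0) 0)] := good_prod (fun j => Num.sqrt (2 * c j) / N.+1%:R) (N.+1 ^ 2) (index_enum _).
have l0 y : cos (lin (fun=> 0) 0 y) = 1.
  by rewrite /lin big1 ?addr0 ?cos0// => j _; rewrite mul0r.
have E n : \int[P n]_w (approx N (Y n ^~ w) * cos (lin (fun=> 0) 0 (Y n ^~ w))) = \int[P n]_w approx N (Y n ^~ w).
  by apply: eq_Rintegral => w _; rewrite l0 mulr1.
have E' : \int[P']_w (approx N (Y' ^~ w) * cos (lin (fun=> 0) 0 (Y' ^~ w))) = \int[P']_w approx N (Y' ^~ w).
  by apply: eq_Rintegral => w _; rewrite l0 mulr1.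
move=> /(cvg_eqn (fsym E) (esym E')).
move/cvgrPdist_le => /(_ _ e3) near_h; near=> n.
have h : `|\int[P']_w approx N (Y' ^~ w) - \int[P n]_w approx N (Y n ^~ w)| <= e / 3 by near: n.
have h1 := @approx_dist _ _ (P n) (Y n) N (@mY n) (@Y2 n) (ma n).
have h2 := @approx_dist _ _ P' Y' N mY' Y2' ma'.
rewrite -/D -/(gauss _) in h1 h2.
have {}h1 := le_trans h1 DN; have {}h2 := le_trans h2 DN.
move: h h1 h2; rewrite /gauss.
rewrite !ler_norml => /andP[? ?] /andP[? ?] /andP[? ?]; apply/andP; split; lra.
Unshelve. all: by end_near. Qed.

End quadratic_laplace.
(** * The normal law *)

Section normal_law.
Context {R : realType}.
Implicit Types (m s : R).
Local Notation lam := (@lebesgue_measure R).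

(** Change of variables holds for the Radon-Nikodym derivative, which agrees almost
    everywhere with the explicit density. *)
Lemma ge0_integral_normal_prob m s (g : R -> \bar R) : measurable_fun setT g ->
  (forall x, 0 <= g x)%E ->
  (\int[normal_prob m s]_x g x = \int[lam]_x (g x * (normal_pdf m s x)%:E))%E.
Proof.
move=> mg g0.
rewrite -(Radon_Nikodym_SigmaFinite.change_of_variables (normal_prob_dominates m s))//.
have mf : measurable_fun setT (Radon_Nikodym_SigmaFinite.f (normal_prob m s) lam).
  apply: (measurable_int lam); apply: Radon_Nikodym_SigmaFinite.f_integrable.
  exact: normal_prob_dominates.
apply: ae_eq_integral => //.
- exact: emeasurable_funM.
- by apply: emeasurable_funM => //; apply/measurable_EFinP; exact: measurable_normal_pdf.
apply: ae_eqe_mul2l; apply: integral_ae_eq => //=.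
- by apply: Radon_Nikodym_SigmaFinite.f_integrable; exact: normal_prob_dominates.
- by apply/measurable_EFinP; exact: measurable_normal_pdf.
- move=> E _ mE; rewrite -Radon_Nikodym_SigmaFinite.f_integral//.
  exact: normal_prob_dominates.
Qed.

Lemma integral_normal_prob m s (g : R -> R) : measurable_fun setT g ->
  lam.-integrable setT (EFin \o (fun x => g x * normal_pdf m s x)) ->
  (normal_prob m s).-integrable setT (EFin \o g) /\
  \int[normal_prob m s]_x g x = \int[lam]_x (g x * normal_pdf m s x).
Proof.
move=> mg ig.
have gi : (normal_prob m s).-integrable setT (EFin \o g).
  apply/integrableP; split; first exact/measurable_EFinP.
  rewrite ge0_integral_normal_prob//; last by apply: measurableT_comp => //; exact/measurable_EFinP.
  case/integrableP: ig => _; congr (_ < _)%E; apply: eq_integral => x _ /=.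
  by rewrite -EFinM normrM (ger0_norm (normal_pdf_ge0 _ _ _)).
split => //; rewrite /Rintegral; congr fine.
have pd x := normal_pdf_ge0 m s x.
rewrite integralE [RHS]integralE; congr (_ - _)%E.
  rewrite ge0_integral_normal_prob//; last exact/measurable_funepos/measurable_EFinP.
  by apply: eq_integral => x _ /=; rewrite !funeposE -!EFin_max -EFinM maxr_pMl ?mul0r.
rewrite ge0_integral_normal_prob//; last exact/measurable_funeneg/measurable_EFinP.
apply: eq_integral => x _ /=; rewrite !funenegE -!EFinN -!EFin_max -EFinM maxr_pMl ?mul0r//.
by rewrite mulNr.
Qed.

(** Doubling the standard deviation absorbs a quadratic factor, because
    [(1 + z) * expR (- z) <= 1].  Integrability of functions of quadratic growth thus
    reduces to that of a normal density. *)
Lemma sqr_normal_pdf_le m s x : s != 0 ->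
  (1 + (x - m) ^+ 2) * normal_pdf m s x <=
  2 * (1 + 8 * s ^+ 2) * normal_pdf m (2 * s) x.
Proof.
move=> s0; have s20 : 2 * s != 0 by rewrite mulf_neq0.
rewrite !normal_pdfE// /normal_peak /normal_fun.
set y := (x - m) ^+ 2; have y0 : 0 <= y by exact: sqr_ge0.
have ss : 0 < s ^+ 2 by rewrite exprn_even_gt0.
have pk : (Num.sqrt ((2 * s) ^+ 2 * pi *+ 2)) = 2 * Num.sqrt (s ^+ 2 * pi *+ 2).
  have -> : (2 * s) ^+ 2 * pi *+ 2 = 2 ^+ 2 * (s ^+ 2 * pi *+ 2) by move: (pi : R) => p; ring.
  by rewrite sqrtrM ?sqr_ge0// sqrtr_sqr ger0_norm.
rewrite pk invfM.
have q0 : 0 <= (Num.sqrt (s ^+ 2 * pi *+ 2))^-1 by rewrite invr_ge0 sqrtr_ge0.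
set q := _^-1 in q0 *.
pose e2 := expR (- y / ((2 * s) ^+ 2 *+ 2)).
have e20 : 0 <= e2 by exact: expR_ge0.
have -> : expR (- y / (s ^+ 2 *+ 2)) = e2 * expR (- (3 * y / (8 * s ^+ 2))).
  by rewrite /e2 -expRD; congr expR; field; rewrite s0.
have z0 : 0 <= 3 * y / (8 * s ^+ 2) by apply: divr_ge0; rewrite mulr_ge0// ltW.
set z := 3 * y / _ in z0 *.
have h1 : expR (- z) * (1 + z) <= 1.
  by rewrite expRN mulrC ler_pdivrMr ?expR_gt0// mul1r expR_ge1Dx.
have yz : y = z * (8 * s ^+ 2) / 3 by rewrite /z; field.
rewrite -/e2 (_ : 2 * _ * _ = (1 + 8 * s ^+ 2) * (q * e2)); last by field.
rewrite (_ : (1 + y) * _ = ((1 + y) * expR (- z)) * (q * e2)); last by ring.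
rewrite ler_wpM2r ?mulr_ge0//.
have ez := expR_ge0 (- z); rewrite yz.
nra.
Qed.

Section stein.
Variables (m s : R).
Hypothesis s0 : s != 0.
Local Notation pdf := (normal_pdf m s).
Local Notation N := (normal_prob m s).

Lemma integrable_normal_pdfM (A : R) (g : R -> R) : measurable_fun setT g ->
  (forall x, `|g x| <= A * (1 + (x - m) ^+ 2)) ->
  lam.-integrable setT (EFin \o (fun x => g x * pdf x)).
Proof.
move=> mg gA.
have i1 : lam.-integrable setT (fun x => (A * (2 * (1 + 8 * s ^+ 2)))%:E * (normal_pdf m (2 * s) x)%:E)%E.
  by apply: integrableZl => //; exact: integrable_normal_pdf.
apply: (le_integrable measurableT _ _ i1).
  by apply/measurable_EFinP; apply: measurable_funM => //; exact: measurable_normal_pdf.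
move=> x _ /=; rewrite lee_fin normrM (ger0_norm (normal_pdf_ge0 _ _ _)).
rewrite (le_trans _ (ler_norm _))//.
have A0 : 0 <= A.
  have := le_trans (normr_ge0 _) (gA m); by rewrite subrr expr0n addr0 mulr1.
rewrite -[leRHS]mulrA (le_trans _ (ler_wpM2l A0 (sqr_normal_pdf_le m x s0)))//.
by rewrite mulrA ler_wpM2r// normal_pdf_ge0.
Qed.

Let dpdf (x : R) : is_derive x 1 pdf (- ((x - m) / s ^+ 2) * pdf x).
Proof.
rewrite !normal_pdfE// /normal_fun.
apply: is_derive_eq; rewrite /GRing.scale/=.
by field.
Qed.

(** Gaussian integration by parts.  The boundary term [f * pdf] vanishes at
    infinity because its product with [x - m] is bounded. *)
Lemma stein (f df : R -> R) (A : R) :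
  (forall x : R, is_derive x 1 f (df x)) -> continuous df ->
  (forall x, `|df x| <= A) -> (forall x, `|f x| <= A * (1 + `|x - m|)) ->
  \int[N]_x (s ^+ 2 * df x - (x - m) * f x) = 0.
Proof.
move=> fdf cdf dfA fA.
have A0 : 0 <= A by exact: le_trans (dfA 0).
have cf : continuous f.
  by move=> x; apply: differentiable_continuous; apply/derivable1_diffP; apply: ex_derive.
have cxm : continuous (fun x : R => x - m) by move=> x; apply: cvgB => //; exact: cvg_cst.
have cg : continuous (fun x => s ^+ 2 * df x - (x - m) * f x).
  move=> x; apply: cvgB; first by apply: cvgMr; exact: cdf.
  by apply: cvgM; [exact: cxm|exact: cf].
have mg := continuous_measurable_fun cg.
pose g x := s ^+ 2 * df x - (x - m) * f x.
have ss : 0 < s ^+ 2 by rewrite exprn_even_gt0.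
have gB x : `|g x| <= (s ^+ 2 * A + 2 * A) * (1 + (x - m) ^+ 2).
  have h1 := dfA x; have h2 := fA x.
  rewrite (le_trans (ler_normB _ _))// (normrM (s ^+ 2)) (normrM (x - m)) (gtr0_norm ss).
  rewrite -(real_normK (num_real (x - m))); set y := `|x - m| in h2 *.
  have y0 : 0 <= y by exact: normr_ge0.
  rewrite mulrDl lerD//.
    by rewrite -[leRHS]mulrA ler_pM2l// (le_trans h1)// ler_peMr// lerDl sqr_ge0.
  rewrite (le_trans (ler_wpM2l y0 h2))//.
  have : 0 <= A * ((1 + y ^+ 2) * 2 - y * (1 + y)) by rewrite mulr_ge0//; nra.
  lra.
have ig := integrable_normal_pdfM mg gB.
rewrite (integral_normal_prob mg ig).2.
pose h x := g x * pdf x.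
have ch : continuous h.
  by move=> x; apply: cvgM; [exact: cg|exact: continuous_normal_pdf].
pose H x := s ^+ 2 * (f x * pdf x).
have dH (x : R) : is_derive x 1 H (h x).
  have := fdf x; have := dpdf x => ? ?.
  rewrite /H; apply: is_derive_eq; rewrite /GRing.scale/= /h /g.
  by field.
pose D := 2 * (A * (2 * (1 + 8 * s ^+ 2)) * normal_peak (2 * s)).
have Hbnd x : `|x - m| * `|H x| <= s ^+ 2 * D.
  rewrite /H (normrM (s ^+ 2)) (normrM (f x)) (gtr0_norm ss) (ger0_norm (normal_pdf_ge0 _ _ _)) mulrCA ler_pM2l//.
  rewrite /D.
  apply: (@le_trans _ _ ((2 * A * (1 + (x - m) ^+ 2)) * pdf x)).
    rewrite mulrA ler_wpM2r ?normal_pdf_ge0// -(real_normK (num_real (x - m))).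
    have h2 := fA x; have y0 := normr_ge0 (x - m); set y := `|x - m| in h2 y0 *.
    rewrite (le_trans (ler_wpM2l y0 h2))//.
    have : 0 <= A * ((1 + y ^+ 2) * 2 - y * (1 + y)) by rewrite mulr_ge0//; nra.
    lra.
  rewrite -mulrA -2!mulrA ler_wpM2l// ler_wpM2l//.
  have k0 : 0 <= 2 * (1 + 8 * s ^+ 2) by move: (ltW ss); lra.
  rewrite (le_trans (sqr_normal_pdf_le m x s0))// ler_wpM2l//.
  by rewrite normal_pdf_ub// mulf_neq0.
have FTC n : (\int[lam]_(x in `[(m - n.+1%:R)%R, (m + n.+1%:R)%R]) (h x)%:E = (H (m + n.+1%:R) - H (m - n.+1%:R))%:E)%E.
  rewrite (@continuous_FTC2 _ h H) ?EFinB//.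
  - by rewrite ltrD2l gtrN.
  - exact: continuous_subspaceT.
  - have cH : continuous H.
      by move=> x; apply: differentiable_continuous; apply/derivable1_diffP; apply: ex_derive.
    split; first by move=> x _; apply: ex_derive.
      by apply: cvg_at_right_filter; exact: cH.
    by apply: cvg_at_left_filter; exact: cH.
  - by move=> x _; rewrite derive1E derive_val.
have cvg1 : (\int[lam]_(x in `[(m - n.+1%:R)%R, (m + n.+1%:R)%R]) (h x)%:E @[n --> \oo] --> \int[lam]_x (h x)%:E)%E.
  have mh : measurable_fun setT h by exact: continuous_measurable_fun.
  pose u n := (EFin \o h) \_ `[(m - n.+1%:R)%R, (m + n.+1%:R)%R].
  have -> : (fun n => \int[lam]_(x in `[(m - n.+1%:R)%R, (m + n.+1%:R)%R]) (h x)%:E)%E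
     = (fun n => \int[lam]_x u n x)%E.
    by apply/funext => n; rewrite integral_mkcond.
  apply: (@dominated_cvg _ _ _ lam setT measurableT u (EFin \o h) (abse \o (EFin \o h))).
  - by move=> n; apply/measurable_restrict => //; apply: measurable_funTS; exact/measurable_EFinP.
  - move=> x _; apply: cvg_near_cst; near=> n.
    rewrite /u patchE mem_set//= in_itv/=.
    have : `|x - m| <= n.+1%:R.
      apply: (@le_trans _ _ n%:R); last by rewrite ler_nat.
      by near: n; exact: nbhs_infty_ger.
    by rewrite ler_norml => /andP[? ?]; apply/andP; split; lra.
  - by [].
  - exact: integrable_abse.
  - move=> n x _; rewrite /u patchE; case: ifP => //= _.
    by rewrite normr0 lee_fin.
have cvg0 : (H (m + n.+1%:R) - H (m - n.+1%:R)) @[n --> \oo] --> (0 : R).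
  apply: (@cvg_of_rate _ (2 * (s ^+ 2 * D)) _ 0 1) => n n1.
  rewrite subr0.
  have n0 : 0 < n.+1%:R :> R by [].
  have b1 : `|H (m + n.+1%:R)| <= s ^+ 2 * D / n.+1%:R.
    rewrite ler_pdivlMr// mulrC (le_trans _ (Hbnd (m + n.+1%:R)))//.
    by rewrite (_ : m + n.+1%:R - m = n.+1%:R) ?normr_nat//; ring.
  have b2 : `|H (m - n.+1%:R)| <= s ^+ 2 * D / n.+1%:R.
    rewrite ler_pdivlMr// mulrC (le_trans _ (Hbnd (m - n.+1%:R)))//.
    by rewrite (_ : m - n.+1%:R - m = - n.+1%:R) ?normrN ?normr_nat//; ring.
  rewrite (le_trans (ler_normB _ _))// (le_trans (lerD b1 b2))//.
  have E0 : 0 <= s ^+ 2 * D by exact: le_trans (mulr_ge0 (normr_ge0 _) (normr_ge0 _)) (Hbnd 0).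
  rewrite (_ : _ + _ = 2 * (s ^+ 2 * D) / n.+1%:R); last by rewrite -mulrDl; congr (_ / _); ring.
  rewrite ler_wpM2l//; first by apply: mulr_ge0.
  have q0 : 0 < Num.sqrt n%:R :> R by rewrite sqrtr_gt0 ltr0n.
  rewrite lef_pV2 ?posrE// -[leRHS]normr_nat -sqrtr_sqr ler_wsqrtr//.
  by rewrite -natrX ler_nat expnS expn1; lia.
have -> : \int[lam]_x (g x * pdf x) = fine (\int[lam]_x (h x)%:E) by [].
rewrite (_ : \int[lam]_x (h x)%:E = 0%:E)%E//.
apply: (cvg_unique (@ereal_hausdorff R) cvg1).
rewrite (funext FTC); apply: cvg_EFin; first exact: nearW.
exact: cvg0.
Unshelve. all: by end_near. Qed.

End stein.

End normal_law.
Section normal_moments.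
Context {R : realType}.
Variables (m s : R).
Hypothesis s0 : s != 0.
Local Notation N := (normal_prob m s).

Let cvgxm : continuous (fun x : R => x - m).
Proof. by move=> x; apply: cvgB => //; exact: cvg_cst. Qed.

Lemma integrable_normal_prob (A : R) (g : R -> R) : continuous g ->
  (forall x, `|g x| <= A * (1 + (x - m) ^+ 2)) -> N.-integrable setT (EFin \o g).
Proof.
move=> cg gA; have mg := continuous_measurable_fun cg.
exact: (integral_normal_prob mg (integrable_normal_pdfM s0 mg gA)).1.
Qed.

Lemma integrable_normal_center : N.-integrable setT (EFin \o (fun x => x - m)).
Proof.
apply: (@integrable_normal_prob 1) => // x; rewrite mul1r.
by rewrite -(real_normK (num_real (x - m))); set y := `|x - m|; nra.
Qed.

Lemma integrable_normal_center2 : N.-integrable setT (EFin \o (fun x => (x - m) ^+ 2)).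
Proof.
apply: (@integrable_normal_prob 1) => [x|x]; last first.
  by rewrite mul1r ger0_norm ?sqr_ge0// lerDr.
by apply: cvgM; exact: cvgxm.
Qed.

Lemma normal_mean : \int[N]_x (x - m) = 0.
Proof.
have := @stein R m s s0 (fun=> 1) (fun=> 0) 1 (fun x => is_derive_cst _ _ _).
have -> : \int[N]_x (s ^+ 2 * 0 - (x - m) * 1) = \int[N]_x (-1 * (x - m)).
  by apply: eq_Rintegral => x _; ring.
rewrite RintegralZl//; last exact: integrable_normal_center.
move=> h; have : -1 * \int[N]_x (x - m) = 0.
  apply: h => [x|x|x]; first exact: cvg_cst.
    by rewrite normr0.
  by rewrite normr1 mul1r lerDl.
by move/eqP; rewrite mulN1r oppr_eq0 => /eqP.
Qed.

Lemma normal_variance : \int[N]_x ((x - m) ^+ 2) = s ^+ 2.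
Proof.
have dx (x : R) : is_derive x 1 (fun x : R => x - m) 1.
  by apply: is_derive_eq; rewrite subr0.
have := @stein R m s s0 (fun x => x - m) (fun=> 1) 1 dx.
have -> : \int[N]_x (s ^+ 2 * 1 - (x - m) * (x - m)) = s ^+ 2 - \int[N]_x ((x - m) ^+ 2).
  under eq_Rintegral do rewrite mulr1 -expr2.
  rewrite RintegralB//; last exact: integrable_normal_center2.
    by congr (_ - _); exact: (@Rintegral_probability_cst _ _ _ N).
  exact: (@integrable_cstr _ _ _ N).
move=> h; apply/eqP; rewrite eq_sym -subr_eq0; apply/eqP; apply: h => [x|x|x].
- exact: cvg_cst.
- by rewrite normr1.
- by rewrite mul1r lerDr.
Qed.

Let psi (b t : R) : R := \int[N]_x cos (t * (x - m) + b).

Let dcos (b t x : R) : is_derive t 1 (fun t => cos (t * (x - m) + b)) (- (x - m) * sin (t * (x - m) + b)).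
Proof. by apply: is_derive_eq; rewrite /GRing.scale/=; ring. Qed.

Let ccos (b t : R) : continuous (fun x : R => cos (t * (x - m) + b)).
Proof.
move=> x; apply: (@continuous_comp _ _ _ (fun x : R => t * (x - m) + b) cos); last exact: continuous_cos.
by apply: cvgD; [apply: cvgMr; exact: cvgxm|exact: cvg_cst].
Qed.

Let psi_derive (b t : R) : is_derive t 1 (psi b) (- (s ^+ 2 * t) * psi b t).
Proof.
pose f t x := cos (t * (x - m) + b).
have tI : `]t - 1, t + 1[%classic t by rewrite /= in_itv/=; apply/andP; split; lra.
have intf u : `]t - 1, t + 1[%classic u -> N.-integrable setT (EFin \o f u).
  move=> _; apply: (@bounded_integrable _ _ _ N 1); last by move=> x; exact: cos_max.
  by apply: continuous_measurable_fun; exact: ccos.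
have df u x : `]t - 1, t + 1[%classic u -> setT x -> derivable (f ^~ x) u 1.
  by move=> _ _; have := dcos b u x => h; apply: ex_derive.
have pE u x : partial1of2 f u x = - (x - m) * sin (u * (x - m) + b).
  by rewrite /partial1of2 derive1E; have := dcos b u x => h; apply: derive_val.
have G0 x : 0 <= `|x - m| by [].
have iG : N.-integrable setT (EFin \o (fun x => `|x - m|)).
  exact: (integrable_normr integrable_normal_center).
have Gub u x : `]t - 1, t + 1[%classic u -> setT x -> `|partial1of2 f u x| <= `|x - m|.
  by move=> _ _; rewrite pE normrM normrN ler_piMr// sin_max.
have der := derivable_under_integral measurableT tI intf df G0 iG Gub.
have := differentiation_under_integral measurableT tI intf df G0 iG Gub.
rewrite derive1E => val.
apply: DeriveDef; first exact: der.
rewrite [LHS]val.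
under eq_Rintegral do rewrite pE.
have dsin (x : R) : is_derive x 1 (fun x => sin (t * (x - m) + b)) (t * cos (t * (x - m) + b)).
  by apply: is_derive_eq; rewrite /GRing.scale/=; ring.
have cc : continuous (fun x => t * cos (t * (x - m) + b)).
  by move=> x; apply: cvgMr; exact: ccos.
have := @stein R m s s0 (fun x => sin (t * (x - m) + b)) (fun x => t * cos (t * (x - m) + b)) (1 + `|t|) dsin cc.
have i1 : N.-integrable setT (EFin \o (fun x => - (x - m) * sin (t * (x - m) + b))).
  apply: (@integrable_normal_prob 1) => [x|x].
    apply: cvgM; first by apply: cvgN; exact: cvgxm.
    apply: (@continuous_comp _ _ _ (fun x : R => t * (x - m) + b) sin); last exact: continuous_sin.
    by apply: cvgD; [apply: cvgMr; exact: cvgxm|exact: cvg_cst].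
  rewrite mul1r normrM normrN -(real_normK (num_real (x - m))).
  have := sin_max (t * (x - m) + b); have := normr_ge0 (x - m).
  by set y := `|x - m|; set z := `|sin _|; nra.
have -> : \int[N]_x (s ^+ 2 * (t * cos (t * (x - m) + b)) - (x - m) * sin (t * (x - m) + b))
   = s ^+ 2 * t * psi b t + \int[N]_x (- (x - m) * sin (t * (x - m) + b)).
  rewrite /psi -RintegralZl//; last exact: intf.
  rewrite -RintegralD//; last by apply: (@integrable_mulrl _ _ _ N); exact: intf.
  by apply: eq_Rintegral => x _; ring.
move=> h; rewrite mulNr; apply/eqP; rewrite -addr_eq0 addrC; apply/eqP; apply: h => x.
  by rewrite normrM (le_trans (ler_wpM2l _ (cos_max _)))// mulr1 lerDr.
by rewrite (le_trans (sin_max _))// -[leLHS]mulr1 ler_pM// lerDl.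
Qed.

(** As a function of [t] the characteristic function solves
    [psi' t = - (s ^+ 2 * t) * psi t], by Gaussian integration by parts. *)
Lemma normal_char (t b : R) :
  \int[N]_x cos (t * (x - m) + b) = expR (- (s ^+ 2 * t ^+ 2 / 2)) * cos b.
Proof.
pose E u := psi b u * expR (s ^+ 2 * u ^+ 2 / 2).
have dE (u : R) : is_derive u 1 E 0.
  have := psi_derive b u => h; apply: is_derive_eq; rewrite /GRing.scale/=.
  by field.
have := is_derive_0_is_cst t 0 dE.
rewrite /E /psi expr0n/= mulr0 mul0r expR0 mulr1 => h.
rewrite expRN [RHS]mulrC; apply: (canRL (mulfK _)); first by rewrite gt_eqF// expR_gt0.
rewrite h; under eq_Rintegral do rewrite mul0r add0r.
exact: (@Rintegral_probability_cst _ _ _ N).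
Qed.

End normal_moments.

Lemma integral_law {R : realType} d d' (T : measurableType d) (U : measurableType d')
    (P : probability T R) (Q : probability U R) (S : T -> U) (g : U -> R) :
  measurable_fun setT S -> (forall A, measurable A -> P (S @^-1` A) = Q A) ->
  measurable_fun setT g -> Q.-integrable setT (EFin \o g) ->
  P.-integrable setT (EFin \o (g \o S)) /\ \int[P]_w g (S w) = \int[Q]_x g x.
Proof.
move=> mS PQ mg ig.
have eqQ (f : U -> \bar R) : (\int[pushforward P S]_x f x = \int[Q]_x f x)%E.
  by apply: eq_measure_integral => A mA _; exact: PQ.
have i1 : P.-integrable setT (EFin \o (g \o S)).
  case/integrableP: ig => mg' gfin; apply/integrableP; split.
    by apply/measurable_EFinP; exact: measurableT_comp.
  rewrite -eqQ ge0_integral_pushforward// in gfin.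
  by apply: measurableT_comp => //; exact/measurable_EFinP.
split => //; rewrite /Rintegral -eqQ integral_pushforward//.
exact/measurable_EFinP.
Qed.

Section gaussian_variable.
Context {R : realType} {d : measure_display} {T : measurableType d} (P : probability T R).
Variables (S : T -> R) (m s : R).
Hypothesis mS : measurable_fun setT S.
Hypothesis lawS : forall A, measurable A -> P (S @^-1` A) = gaussian_law m s A.

Let measurable_center : measurable_fun setT (fun x : R => x - m).
Proof. exact: measurable_funB. Qed.

Let measurable_center2 : measurable_fun setT (fun x : R => (x - m) ^+ 2).
Proof. exact: measurable_funX. Qed.

Let measurable_coslin t b : measurable_fun setT (fun x : R => cos (t * (x - m) + b)).
Proof.
apply: (@measurableT_comp _ _ _ _ _ _ (cos : R -> R)).
  by apply: continuous_measurable_fun; exact: continuous_cos.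
by apply: measurable_funD => //; apply: measurable_funM.
Qed.

Let dirac_integral (Q : probability R R) (g : R -> R) : (forall A, measurable A -> Q A = \d_m A) ->
  measurable_fun setT g ->
  Q.-integrable setT (EFin \o g) /\ \int[Q]_x g x = g m.
Proof.
move=> QE mg; have E (f : R -> \bar R) : measurable_fun setT f -> (\int[Q]_x f x = f m)%E.
  move=> mf; rewrite (@eq_measure_integral _ _ _ _ (\d_m)); last by move=> A mA _; exact: QE.
  by rewrite integral_dirac// diracT mul1e.
split; last by rewrite /Rintegral E//; exact/measurable_EFinP.
apply/integrableP; split; first exact/measurable_EFinP.
by rewrite E ?ltry//; apply: measurableT_comp => //; exact/measurable_EFinP.
Qed.

(** Everything is transported from the law of [S], which is a Dirac mass for
    [s = 0] and has the normal density otherwise. *)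
Lemma gaussian_variable_facts :
  [/\ P.-integrable setT (EFin \o S),
      P.-integrable setT (EFin \o (fun w => S w ^+ 2)),
      \int[P]_w S w = m,
      \int[P]_w ((S w - m) ^+ 2) = s ^+ 2 &
      forall b, \int[P]_w cos ((S w - m) + b) = expR (- (s ^+ 2 / 2)) * cos b].
Proof.
suff [i1 i2 e1 e2 e3] : [/\ P.-integrable setT (EFin \o (fun w => S w - m)),
      P.-integrable setT (EFin \o (fun w => (S w - m) ^+ 2)),
      \int[P]_w (S w - m) = 0,
      \int[P]_w ((S w - m) ^+ 2) = s ^+ 2 &
      forall b, \int[P]_w cos (1 * (S w - m) + b) = expR (- (s ^+ 2 * 1 ^+ 2 / 2)) * cos b].
  have ic := @integrable_cstr _ _ _ P.
  have iS : P.-integrable setT (EFin \o S).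
    rewrite (_ : S = fun w => (S w - m) + m); first exact: integrable_addr.
    by apply/funext => w; rewrite subrK.
  split => //.
  - rewrite (_ : (fun w => _) = fun w => (S w - m) ^+ 2 + (2 * m * (S w - m) + m ^+ 2)).
      by apply: integrable_addr => //; apply: integrable_addr => //; exact: integrable_mulrl.
    by apply/funext => w; ring.
  - by move: e1; rewrite RintegralB// Rintegral_probability_cst => /eqP; rewrite subr_eq0 => /eqP.
  - move=> b; have := e3 b; rewrite expr1n mulr1 => <-.
    by apply: eq_Rintegral => w _; rewrite mul1r.
have [s0|s0] := eqVneq s 0.
  have PD : forall A, measurable A -> P (S @^-1` A) = \d_m A.
    by move=> A mA; rewrite lawS// /gaussian_law s0 eqxx.
  have D g mg := @dirac_integral (@distribution _ _ _ _ _ P (mfun_Sub (mem_set mS))) g PD mg.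
  have TT g mg := @integral_law R _ _ T R P (@distribution _ _ _ _ _ P (mfun_Sub (mem_set mS))) S g mS (fun _ _ => erefl) mg (D g mg).1.
  split.
  - exact: (TT _ measurable_center).1.
  - exact: (TT _ measurable_center2).1.
  - by rewrite (TT _ measurable_center).2 (D _ measurable_center).2 subrr.
  - by rewrite (TT _ measurable_center2).2 (D _ measurable_center2).2 subrr s0 !expr0n.
  - move=> b; rewrite (TT _ (measurable_coslin 1 b)).2 (D _ (measurable_coslin 1 b)).2.
    by rewrite subrr mulr0 add0r s0 expr0n/= !mul0r oppr0 expR0 mul1r.
have PN : forall A, measurable A -> P (S @^-1` A) = normal_prob m s A.
  by move=> A mA; rewrite lawS// /gaussian_law (negbTE s0).
have TT g mg := @integral_law R _ _ T (measurableTypeR R) P (normal_prob m s) S g mS PN mg.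
have [i1 e1] := @TT (fun x => x - m) measurable_center (@integrable_normal_center R m s s0).
have [i2 e2] := @TT (fun x => (x - m) ^+ 2) measurable_center2 (@integrable_normal_center2 R m s s0).
split => //.
- by rewrite e1; exact: normal_mean.
- by rewrite e2; exact: normal_variance.
- move=> b; have ic : (normal_prob m s).-integrable setT (EFin \o (fun x : R => cos (1 * (x - m) + b))).
    apply: (@bounded_integrable _ _ _ (normal_prob m s) 1); last by move=> x; exact: cos_max.
    exact: measurable_coslin.
  have [_ ->] := @TT (fun x => cos (1 * (x - m) + b)) (measurable_coslin 1 b) ic.
  exact: normal_char.
Qed.

End gaussian_variable.
(** * The empirical process and the Brownian bridge *)

Definition empirical_process {R : realType} {d : measure_display} {T : measurableType d}
    {P : probability T R} {n : nat} (X : 'I_n -> {RV P >-> R}) (mu : probability R R)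
    (x : R) (w : T) : R :=
  (Num.sqrt n%:R)^-1 * \sum_i (le_indic x (X i w) - dfun mu x).

Section empirical_process_moments.
Context {R : realType} {d : measure_display} {T : measurableType d}
  {P : probability T R} {n : nat} (X : 'I_n -> {RV P >-> R}) (mu : probability R R).
Hypothesis Xiid : iid X mu.
Local Notation G := (dfun mu).
Local Notation emp := (empirical_process X mu).

Lemma measurable_empirical_process x : measurable_fun setT (emp x).
Proof.
apply: measurable_funM => //; apply: measurable_sum => i; apply: measurable_funB => //.
by apply: measurableT_comp => //; exact: measurable_le_indic.
Qed.

Lemma lin_empirical_process m (x th : 'I_m -> R) w :
  \sum_j th j * emp (x j) w = (Num.sqrt n%:R)^-1 * cumulative_sum X mu x th w.
Proof.
rewrite /cumulative_sum exchange_big/= mulr_sumr; apply: eq_bigr => j _.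
by rewrite /empirical_process -mulr_sumr; ring.
Qed.

Let emp1 x w : emp x w = (Num.sqrt n%:R)^-1 * cumulative_sum X mu (fun=> x) (fun _ : 'I_1 => 1) w.
Proof. by rewrite -lin_empirical_process big_ord1 mul1r. Qed.

Let sqrtn2 : n%:R * (Num.sqrt n%:R)^-1 ^+ 2 <= 1 :> R.
Proof.
rewrite exprVn sqr_sqrtr//; case: n => [|k]; first by rewrite mul0r.
by rewrite divff.
Qed.

Lemma integrable_empirical_processX (k : nat) x :
  P.-integrable setT (EFin \o (fun w => emp x w ^+ k)).
Proof.
under eq_fun do rewrite emp1.
exact: (integrable_cumulative_sum Xiid _ _ (fun y => ((Num.sqrt n%:R)^-1 * y) ^+ k)).
Qed.

Lemma expectation_empirical_process2 x : \int[P]_w (emp x w ^+ 2) <= 1.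
Proof.
under eq_Rintegral do rewrite emp1 exprMn.
rewrite RintegralZl//; last exact: (integrable_cumulative_sum Xiid _ _ (fun y => y ^+ 2)).
rewrite expectation_cumulative_sum2// /cumulative_var !big_ord1 !mul1r minxx.
have v1 : G x - G x * G x <= 1 by have := dfun_ge0 mu x; have := dfun_le1 mu x; nra.
have v0 : 0 <= G x - G x * G x by have := dfun_ge0 mu x; have := dfun_le1 mu x; nra.
by rewrite mulrA [X in X * _]mulrC mulr_ile1// mulr_ge0// sqr_ge0.
Qed.

Lemma expectation_empirical_process4 x : \int[P]_w (emp x w ^+ 4) <= 4.
Proof.
under eq_Rintegral do rewrite emp1 exprMn.
rewrite RintegralZl//; last exact: (integrable_cumulative_sum Xiid _ _ (fun y => y ^+ 4)).
have := expectation_cumulative_sum4 Xiid (fun=> x) (fun _ : 'I_1 => 1).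
rewrite big_ord1 normr1 expr1n mulr1 => h.
rewrite (le_trans (ler_wpM2l _ h))//.
rewrite mulrA ler_piMl//.
rewrite (_ : _ * _ = (n%:R * (Num.sqrt n%:R)^-1 ^+ 2) ^+ 2); last by ring.
by rewrite exprn_ile1// mulr_ge0// sqr_ge0.
Qed.

(** The increment has variance [D * (1 - D)] for [D = `|G x - G y|]. *)
Lemma expectation_empirical_process_dist x y :
  P.-integrable setT (EFin \o (fun w => (emp x w - emp y w) ^+ 2)) /\
  \int[P]_w ((emp x w - emp y w) ^+ 2) <= `|G x - G y|.
Proof.
pose xx (j : 'I_2) := if j == ord0 then x else y.
pose th (j : 'I_2) : R := if j == ord0 then 1 else -1.
have E w : emp x w - emp y w = (Num.sqrt n%:R)^-1 * cumulative_sum X mu xx th w.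
  by rewrite -lin_empirical_process !big_ord_recl big_ord0/= /xx /th/=; ring.
under eq_fun do rewrite E.
split; first exact: (integrable_cumulative_sum Xiid _ _ (fun y => ((Num.sqrt n%:R)^-1 * y) ^+ 2)).
under eq_Rintegral do rewrite exprMn.
rewrite RintegralZl//; last exact: (integrable_cumulative_sum Xiid _ _ (fun y => y ^+ 2)).
rewrite expectation_cumulative_sum2// mulrA [X in X * _]mulrC.
have v0 := cumulative_var_ge0 mu xx th.
rewrite (le_trans (ler_piMl v0 sqrtn2))//.
rewrite /cumulative_var !big_ord_recl !big_ord0 /xx /th/=.
rewrite !minxx [Num.min (G y) _]minC.
have := sqr_ge0 (G x - G y).
case: (leP (G x) (G y)) => xy h.
  by rewrite ler0_norm ?subr_le0//; nra.
by rewrite gtr0_norm ?subr_gt0//; nra.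
Qed.

End empirical_process_moments.

(** Central limit theorem for finitely many values of the empirical process.  Up to
    [n] third-order errors of size [n ^ (- 3 / 2)], the characteristic function of
    the sum is [(1 - v / (2 * n)) ^+ n]; the phase [b] treats its real and imaginary
    parts together. *)
Lemma cvg_empirical_char {R : realType} (mu : probability R R)
    (disp : nat -> measure_display) (T : forall n, measurableType (disp n))
    (P : forall n, probability (T n) R) (X : forall n, 'I_n -> {RV P n >-> R})
    (Xiid : forall n, iid (X n) mu) (m : nat) (x th : 'I_m -> R) (b : R) :
  \int[P n]_w cos (\sum_j th j * empirical_process (X n) mu (x j) w + b) @[n --> \oo] -->
  expR (- (cumulative_var mu x th / 2)) * cos b.
Proof.
set v := cumulative_var _ _ _; pose M := \sum_j `|th j|.
have M0 : 0 <= M by apply: sumr_ge0.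
have v0 : 0 <= v by exact: cumulative_var_ge0.
have vM : v <= M ^+ 2 by exact: cumulative_var_le.
have [N _ hN] := nbhs_infty_ger v.
apply: (@cvg_of_rate _ (M ^+ 4 / 24 + M ^+ 3 / 6 + v ^+ 2 / 8) _ _ N.+1) => n Nn.
case: n Nn => // n Nn.
have vn : v <= n.+1%:R by apply: hN; exact: ltnW.
set q := Num.sqrt n.+1%:R.
have n0 : 0 < n.+1%:R :> R by [].
have q0 : 0 < q by rewrite sqrtr_gt0.
have qq : q ^+ 2 = n.+1%:R by rewrite sqr_sqrtr.
have q1 : 1 <= q by rewrite -[leLHS]sqrtr1 ler_wsqrtr// ler1n.
have s2 : q^-1 ^+ 2 = n.+1%:R^-1 by rewrite exprVn qq.
under eq_Rintegral do rewrite lin_empirical_process.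
rewrite -/q; clearbody q.
have sv : q^-1 ^+ 2 * v <= 4.
  rewrite s2 mulrC ler_pdivrMr//; lra.
have qi0 : 0 <= q^-1 by rewrite invr_ge0 ltW.
have := @expectation_cumulative_cos R _ _ _ n.+1 (X n.+1) mu (Xiid n.+1) m x th q^-1 b qi0 sv.
rewrite -/v -/M s2 => h1.
have h2 := onem_exprn_expR v0 (_ : v <= (2 * n.+1)%:R).
have {}h2 : `|(1 - v / (2 * n.+1)%:R) ^+ n.+1 - expR (- (v / 2))| <= v ^+ 2 / (8 * n.+1)%:R.
  by apply: h2; rewrite natrM; lra.
have e1 : 1 - n.+1%:R^-1 * v / 2 = 1 - v / (2 * n.+1)%:R.
  by rewrite natrM; field; rewrite nat1r pnatr_eq0.
rewrite e1 in h1.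
have h3 : `|(1 - v / (2 * n.+1)%:R) ^+ n.+1 * cos b - expR (- (v / 2)) * cos b| <= v ^+ 2 / (8 * n.+1)%:R.
  by rewrite -mulrBl normrM (le_trans _ h2)// ler_piMr// cos_max.
have h4 : n.+1%:R * ((q^-1 * M) ^+ 4 / 24 + (q^-1 * M) ^+ 3 / 6) <= (M ^+ 4 / 24 + M ^+ 3 / 6) / q.
  rewrite -qq [leLHS](_ : _ = M ^+ 4 / 24 / q ^+ 2 + M ^+ 3 / 6 / q); last by field; rewrite gt_eqF.
  rewrite mulrDl lerD2r ler_wpM2l ?divr_ge0 ?exprn_ge0// lef_pV2 ?posrE ?exprn_gt0//.
  by rewrite expr2 ler_peMr// ltW.
have h5 : v ^+ 2 / (8 * n.+1)%:R <= v ^+ 2 / 8 / q.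
  rewrite natrM -qq invfM mulrA ler_wpM2l ?divr_ge0 ?sqr_ge0// lef_pV2 ?posrE ?exprn_gt0//.
  by rewrite expr2 ler_peMr// ltW.
rewrite mulrDl (le_trans _ (lerD h4 h5))//.
apply: (le_trans _ (lerD h1 h3)).
by apply: (le_trans _ (ler_normD _ _)); rewrite addrA subrK.
Qed.

Section bridge.
Context {R : realType} {d : measure_display} {T : measurableType d}
  {P : probability T R} (B : R -> {RV P >-> R}).
Hypothesis BB : brownian_bridge B.

Lemma bridge_integrable t : t \in `[0, 1] ->
  P.-integrable setT (EFin \o B t) /\ P.-integrable setT (EFin \o (fun w => B t w ^+ 2)).
Proof.
move=> t01.
have gp := bb_gaussian BB.
have [m [s law]] := gp _ (fun _ : 'I_1 => t) (fun=> 1) (fun=> t01).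
have mS : measurable_fun setT (fun w => \sum_(i < 1) 1 * B t w).
  by apply: measurable_sum => i; apply: measurable_funM.
have [i1 i2 _ _ _] := gaussian_variable_facts mS law.
have E w : \sum_(i < 1) 1 * B t w = B t w by rewrite big_ord1 mul1r.
by split; [move: i1|move: i2]; under eq_fun do rewrite E.
Qed.

Lemma bridge_mean t : t \in `[0, 1] -> \int[P]_w B t w = 0.
Proof. by move=> t01; have := bb_mean BB t01; rewrite unlock /Rintegral => ->. Qed.

Lemma bridge_cov s t : s \in `[0, 1] -> t \in `[0, 1] ->
  P.-integrable setT (EFin \o (fun w => B s w * B t w)) /\
  \int[P]_w (B s w * B t w) = Num.min s t - s * t.
Proof.
move=> s01 t01; have [_ s2] := bridge_integrable s01; have [_ t2] := bridge_integrable t01.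
split.
  apply: (le_integrable measurableT _ _ (integrable_addr s2 t2)).
    by apply/measurable_EFinP; apply: measurable_funM.
  move=> w _ /=; rewrite lee_fin normrM [leRHS]ger0_norm ?addr_ge0 ?sqr_ge0//.
  rewrite -(real_normK (num_real (B s w))) -(real_normK (num_real (B t w))).
  by have := normr_ge0 (B s w); have := normr_ge0 (B t w); nra.
have := bb_covariance BB s01 t01; rewrite covariance.unlock (bb_mean BB s01) (bb_mean BB t01).
rewrite expectation.unlock /Rintegral => h.
have -> : (\int[P]_w (B s w * B t w)%:E)%E = (Num.min s t - s * t)%:E => //.
by rewrite -h; apply: eq_integral => w _; rewrite !fctE /= !subr0.
Qed.

Lemma bridge_char m (t th : 'I_m -> R) (b : R) : (forall j, t j \in `[0, 1]) ->
  \int[P]_w cos (\sum_j th j * B (t j) w + b) =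
  expR (- ((\sum_i \sum_j th i * th j * (Num.min (t i) (t j) - t i * t j)) / 2)) * cos b.
Proof.
move=> t01.
have gp := bb_gaussian BB.
have [mm [s law]] := gp _ t th t01.
have mS : measurable_fun setT (fun w => \sum_(i < m) th i * B (t i) w).
  by apply: measurable_sum => i; apply: measurable_funM.
have [i1 i2 e1 e2 e3] := gaussian_variable_facts mS law.
have m0 : mm = 0.
  rewrite -e1 Rintegral_sumr; last by move=> j; apply: integrable_mulrl; case: (bridge_integrable (t01 j)).
  rewrite big1// => j _; rewrite RintegralZl ?bridge_mean ?mulr0//.
  by case: (bridge_integrable (t01 j)).
move: e2 e3; rewrite m0 => e2 e3.
under eq_Rintegral do rewrite -[X in X + b]subr0.
rewrite e3 -e2; congr (expR (- (_ / 2)) * _).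
have ii i j := (bridge_cov (t01 i) (t01 j)).1.
transitivity (\int[P]_w (\sum_i \sum_j th i * th j * (B (t i) w * B (t j) w))).
  apply: eq_Rintegral => w _; rewrite subr0 expr2 mulr_suml; apply: eq_bigr => i _.
  by rewrite mulr_sumr; apply: eq_bigr => j _; ring.
rewrite Rintegral_sumr; last by move=> i; apply: integrable_sumr => j; exact: integrable_mulrl.
apply: eq_bigr => i _; rewrite Rintegral_sumr; last by move=> j; exact: integrable_mulrl.
by apply: eq_bigr => j _; rewrite RintegralZl// (bridge_cov (t01 i) (t01 j)).2.
Qed.

End bridge.

(** Convergence of the empirical process to the Brownian bridge, in the form of
    Laplace transforms of diagonal quadratic forms of finitely many values. *)
Lemma cvg_empirical_laplace {R : realType} (mu : probability R R)
    (disp : nat -> measure_display) (T : forall n, measurableType (disp n))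
    (P : forall n, probability (T n) R) (X : forall n, 'I_n -> {RV P n >-> R})
    (disp' : measure_display) (T' : measurableType disp') (P' : probability T' R)
    (B : R -> {RV P' >-> R}) (m : nat) (x c : 'I_m -> R) :
  (forall n, iid (X n) mu) -> brownian_bridge B -> (forall j, 0 <= c j) ->
  \int[P n]_w expR (- \sum_j c j * empirical_process (X n) mu (x j) w ^+ 2) @[n --> \oo] -->
  \int[P']_w expR (- \sum_j c j * B (dfun mu (x j)) w ^+ 2).
Proof.
move=> Xiid BB c0.
have G01 j : dfun mu (x j) \in `[0, 1] by rewrite in_itv/= dfun_ge0 dfun_le1.
apply: (@cvg_quadratic_laplace _ _ _ _ P (fun n j => empirical_process (X n) mu (x j)) _ _ P'
  (fun j => B (dfun mu (x j))) _ _ _ 1) => //.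
- by move=> n j; exact: measurable_empirical_process.
- by move=> th b; rewrite bridge_char//; exact: cvg_empirical_char.
- move=> n j; split; first exact: integrable_empirical_processX.
  exact: expectation_empirical_process2.
- move=> j; split; first by case: (bridge_integrable BB (G01 j)).
  under eq_Rintegral do rewrite expr2.
  rewrite (bridge_cov BB (G01 j) (G01 j)).2 minxx.
  by have := dfun_ge0 mu (x j); have := dfun_le1 mu (x j); nra.
Qed.
(** * The quadratic Wasserstein distance on the line *)

(** Let [F] and [G] be distribution functions with [v = F s].  A transport plan from
    [F] to [G] has to carry at least the mass [wgap G v s t] across the thresholds
    [s] and [t]: from [`]-oo, s]] to [`]t, +oo[] if [s < t], and from [`]s, +oo[] to
    [`]-oo, t]] otherwise. *)
Definition wgap {R : realType} (G : R -> R) (v s t : R) : R :=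
  if s < t then Num.max 0 (v - G t) else Num.max 0 (G t - v).

Lemma lebesgue_measure_segment {R : realType} (x y : R) (p q : bool) : x <= y ->
  @lebesgue_measure R [set` Interval (BSide p x) (BSide q y)] = (y - x)%:E.
Proof.
rewrite le_eqVlt => /predU1P[->|xy]; rewrite lebesgue_measure_itv/= lte_fin ?ltxx ?subrr//.
by rewrite xy EFinB.
Qed.

Lemma integral_cst_indic {R : realType} (A : set R) (r l : R) : measurable A -> 0 <= r ->
  @lebesgue_measure R A = l%:E ->
  (\int[@lebesgue_measure R]_t (r * \1_A t)%:E = (r * l)%:E)%E.
Proof.
move=> mA r0 lA; under eq_integral do rewrite EFinM.
rewrite ge0_integralZl//; last exact/measurable_EFinP/measurable_indic.
transitivity (r%:E * @lebesgue_measure R A)%E; last by rewrite lA.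
by congr (_ * _)%E; rewrite integral_indic// setIT.
Qed.

Section transport_cost.
Context {R : realType}.
Local Notation lam := (@lebesgue_measure R).

Let crossing (p : R * R) (s t : R) : bool :=
  if s < t then (p.1 <= s) && (t < p.2) else (s < p.1) && (p.2 <= t).

Let reach (p : R * R) (s : R) : R :=
  if p.1 <= s then Num.max 0 (p.2 - s) else Num.max 0 (s - p.2).

Lemma integral_ramp_right (a b : R) : a <= b ->
  (\int[lam]_(s in `[a, b]) (2 * (b - s))%:E = ((b - a) ^+ 2)%:E)%E.
Proof.
rewrite le_eqVlt => /predU1P[->|ab]; first by rewrite set_itv1 integral_set1 subrr expr0n.
have d1 (x : R) : is_derive x 1 (fun s => - (b - s) ^+ 2) (2 * (b - x)).
  by apply: is_derive_eq; rewrite /GRing.scale/=; ring.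
have cF : continuous (fun s : R => - (b - s) ^+ 2).
  by move=> x; apply: differentiable_continuous; apply/derivable1_diffP; apply: ex_derive.
rewrite (@continuous_FTC2 _ (fun s => 2 * (b - s)) (fun s => - (b - s) ^+ 2))//.
- by rewrite subrr expr0n/= oppr0 -EFinB sub0r opprK.
- apply: continuous_subspaceT => x; apply: cvgM; first exact: cvg_cst.
  by apply: cvgB => //; exact: cvg_cst.
- split; first by move=> x _; apply: ex_derive.
    by apply: cvg_at_right_filter; exact: cF.
  by apply: cvg_at_left_filter; exact: cF.
- by move=> x _; rewrite derive1E derive_val.
Qed.

Lemma integral_ramp_left (a b : R) : a <= b ->
  (\int[lam]_(s in `[a, b]) (2 * (s - a))%:E = ((b - a) ^+ 2)%:E)%E.
Proof.
rewrite le_eqVlt => /predU1P[->|ab]; first by rewrite set_itv1 integral_set1 subrr expr0n.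
have d1 (x : R) : is_derive x 1 (fun s => (s - a) ^+ 2) (2 * (x - a)).
  by apply: is_derive_eq; rewrite /GRing.scale/=; ring.
have cF : continuous (fun s : R => (s - a) ^+ 2).
  by move=> x; apply: differentiable_continuous; apply/derivable1_diffP; apply: ex_derive.
rewrite (@continuous_FTC2 _ (fun s => 2 * (s - a)) (fun s => (s - a) ^+ 2))//.
- by rewrite subrr expr0n/= sube0.
- apply: continuous_subspaceT => x; apply: cvgM; first exact: cvg_cst.
  by apply: cvgB => //; exact: cvg_cst.
- split; first by move=> x _; apply: ex_derive.
    by apply: cvg_at_right_filter; exact: cF.
  by apply: cvg_at_left_filter; exact: cF.
- by move=> x _; rewrite derive1E derive_val.
Qed.

Let reach_sqr p : (\int[lam]_s (2 * reach p s)%:E = (`|p.1 - p.2| ^+ 2)%:E)%E.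
Proof.
case: p => x y /=; rewrite real_normK ?num_real//.
have [xy|yx] := leP x y.
  rewrite (_ : (fun s => _) = (fun s => (2 * (y - s))%:E) \_ `[x, y]); last first.
    apply/funext => s; rewrite patchE mem_setE in_itv/= /reach/=.
    case: (leP x s) => xs /=; last by rewrite max_l ?mulr0// subr_le0 (le_trans (ltW xs)).
    by case: (leP s y) => sy; [rewrite max_r ?subr_ge0|rewrite max_l ?mulr0// subr_le0 ltW].
  by rewrite -integral_mkcond integral_ramp_right// -sqrrN opprB.
rewrite (_ : (fun s => _) = (fun s => (2 * (s - y))%:E) \_ `[y, x[); last first.
  apply/funext => s; rewrite patchE mem_setE in_itv/= /reach/=.
  case: (leP x s) => xs /=; first by rewrite andbF max_l ?mulr0// subr_le0 (le_trans (ltW yx)).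
  by case: (leP y s) => ys /=; [rewrite max_r ?subr_ge0|rewrite max_l ?mulr0// subr_le0 ltW].
rewrite -integral_mkcond integral_itv_bndo_bndc ?integral_ramp_left ?ltW//.
by apply/measurable_EFinP; apply: measurable_funM => //; apply: measurable_funB.
Qed.

Let integral_crossing p s : (\int[lam]_t (2 * (crossing p s t)%:R)%:E = (2 * reach p s)%:E)%E.
Proof.
pose I : set R := [set` (if p.1 <= s then `]s, p.2[ else `[p.2, s])].
have mI : measurable I by exact: measurable_itv.
rewrite (_ : (fun t => _) = (fun t => 2%:E * (\1_I t)%:E)%E); last first.
  apply/funext => t; rewrite EFinM indicE mem_setE; congr (2%:E * (_%:R)%:E)%E.
  rewrite /crossing; case: (leP p.1 s) => ps /=; rewrite in_itv/=; case: (ltP s t) => //= st.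
  - by rewrite andbF.
  - by rewrite andbT.
rewrite ge0_integralZl//; last exact/measurable_EFinP/measurable_indic.
rewrite integral_indic// setIT EFinM; congr (_ * _)%E.
rewrite /I /reach; case: ifP => ps /=; rewrite lebesgue_measure_itv/= lte_fin.
  by case: (ltP s p.2) => h; [rewrite -EFinB max_r// subr_ge0 ltW|rewrite max_l// subr_le0].
by case: (ltP p.2 s) => h; [rewrite -EFinB max_r// subr_ge0 ltW|rewrite max_l// subr_le0].
Qed.

(** Layer-cake formula: [(x - y) ^+ 2] is twice the area of the triangle formed by
    the pairs of thresholds that a move from [x] to [y] crosses, and Tonelli's
    theorem moves the integration over thresholds outside. *)
Lemma transport_cost (pi : probability (R * R)%type R) :
  (\int[pi]_p (`|p.1 - p.2| ^+ 2)%:E =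
   \int[lam]_s \int[lam]_t \int[pi]_p (2 * (crossing p s t)%:R)%:E)%E.
Proof.
under eq_integral do rewrite -reach_sqr.
rewrite (@fubini_tonelli _ _ _ _ _ pi lam (fun q => (2 * reach q.1 q.2)%:E)%E)//; last 2 first.
- apply/measurable_EFinP; apply: measurable_funM => //; rewrite /reach.
  have m1 : measurable_fun setT (fun q : (R * R) * measurableTypeR R => q.1.1) by exact: measurableT_comp.
  have m2 : measurable_fun setT (fun q : (R * R) * measurableTypeR R => q.1.2) by exact: measurableT_comp.
  have m3 : measurable_fun setT (fun q : (R * R) * measurableTypeR R => q.2 : R) by exact: measurable_snd.
  apply: measurable_fun_ifT; first exact: measurable_fun_ler.
    by apply: measurable_maxr => //; exact: measurable_funB.
  by apply: measurable_maxr => //; exact: measurable_funB.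
- by move=> q; rewrite lee_fin mulr_ge0// /reach; case: ifP => _; rewrite le_max lexx.
apply: eq_integral => s _ /=; under eq_integral do rewrite -integral_crossing.
rewrite (@fubini_tonelli _ _ _ _ _ pi lam (fun q => (2 * (crossing q.1 s q.2)%:R)%:E)%E)//.
apply/measurable_EFinP; apply: measurable_funM => //.
  have m1 : measurable_fun setT (fun q : (R * R) * measurableTypeR R => q.1.1) by exact: measurableT_comp.
  have m2 : measurable_fun setT (fun q : (R * R) * measurableTypeR R => q.1.2) by exact: measurableT_comp.
  have m3 : measurable_fun setT (fun q : (R * R) * measurableTypeR R => q.2 : R) by exact: measurable_snd.
  rewrite (_ : (fun q => _) = (fun q => if crossing q.1 s q.2 then 1 else 0)); last first.
    by apply/funext => q; case: crossing.
  apply: measurable_fun_ifT => //; apply: measurable_fun_ifT.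
  + exact: measurable_fun_ltr.
  + by apply: measurable_and; [exact: measurable_fun_ler|exact: measurable_fun_ltr].
  + by apply: measurable_and; [exact: measurable_fun_ltr|exact: measurable_fun_ler].
Qed.

Lemma expectation_crossing (pi : probability (R * R)%type R) s t :
  (\int[pi]_p (2 * (crossing p s t)%:R)%:E =
   2%:E * pi (if (s < t)%R then `]-oo, s]%classic `*` `]t, +oo[%classic else `]s, +oo[%classic `*` `]-oo, t]%classic))%E.
Proof.
set A := (if _ then _ else _).
have mA : measurable A by rewrite /A; case: ifP => _; exact: measurableX.
rewrite (_ : (fun p => _) = (fun p => 2%:E * (\1_A p)%:E)%E); last first.
  apply/funext => p; rewrite EFinM; congr (2%:E * (_%:R)%:E)%E.
  rewrite /crossing /A; apply/esym; case: ifP => _.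
    by rewrite in_setX !mem_setE !in_itv/= andbT.
  by rewrite in_setX !mem_setE !in_itv/= andbT.
rewrite ge0_integralZl//; last exact/measurable_EFinP/measurable_indic.
by rewrite integral_indic// setIT.
Qed.

End transport_cost.
Section wasserstein_lower_bound.
Context {R : realType} (mu nu : set R -> \bar R) (F G : R -> R).
Local Notation lam := (@lebesgue_measure R).
Hypothesis muF : forall s, mu `]-oo, s]%classic = (F s)%:E.
Hypothesis nuG : forall s, nu `]-oo, s]%classic = (G s)%:E.

(** Integrate over all thresholds the inequality
    [mu `]-oo, s] - nu `]-oo, t] <= pi (`]-oo, s] `*` `]t, +oo[)]. *)
Lemma coupling_cost_ge (pi : probability (R * R)%type R) : coupling mu nu pi ->
  (\int[lam]_s \int[lam]_t (2 * wgap G (F s) s t)%:E <=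
   \int[pi]_p (`|p.1 - p.2| ^+ 2)%:E)%E.
Proof.
move=> cpl; rewrite transport_cost.
have wgap0 s t : 0 <= wgap G (F s) s t by rewrite /wgap; case: ifP => _; rewrite le_max lexx.
apply: ge0_integral_mono => s.
  by apply: integral_ge0 => t _; rewrite lee_fin mulr_ge0.
apply: ge0_integral_mono => t; first by rewrite lee_fin mulr_ge0.
rewrite expectation_crossing EFinM lee_pmul2l//.
have [muA _] := cpl `]-oo, s]%classic (measurable_itv _).
have [_ nuA] := cpl `]-oo, t]%classic (measurable_itv _).
have sub (A B C : set (R * R)) : measurable A -> measurable B -> measurable C ->
    B `<=` C `|` A -> (pi B - pi A <= pi C)%E.
  move=> mA mB mC BCA; rewrite leeBlDr ?fin_num_measure//.
  apply: (le_trans (le_measure pi _ _ BCA)); rewrite ?inE//; first exact: measurableU.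
  exact: measureU2.
rewrite /wgap; case: ltP => st; rewrite EFin_max ge_max measure_ge0/= EFinB -muF -nuG -muA -nuA.
  apply: sub; do ?exact: measurableX.
  move=> [x y] /= [xs _]; case: (leP y t) => yt; [right|left] => //=.
  by split => //; rewrite in_itv/= yt.
apply: sub; do ?exact: measurableX.
move=> [x y] /= [_ yt]; case: (leP x s) => xs; [right|left] => //=.
by split => //; rewrite in_itv/= xs.
Qed.

End wasserstein_lower_bound.

Section quantile_function.
Context {R : realType} (mu : probability R R).
Local Notation F := (dfun mu).

(** Outside [`]0, 1[] the set of candidates may be empty or unbounded below, whence
    the default value. *)
Definition quantile (u : R) : R :=
  if 0 < u < 1 then inf [set s | u <= F s] else 0.

Let idRV : {RV mu >-> R} := mfun_Sub (mem_set (@measurable_id _ R setT)).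

Let cdfE : cdf idRV = EFin \o F.
Proof. by apply/funext => s; rewrite /= /cdf /distribution /pushforward -EFin_dfun. Qed.

Let F_y : F @ +oo --> (1 : R).
Proof. by have := cvg_cdfy1 idRV; rewrite cdfE => h; exact: (fine_cvg h). Qed.

Let F_Ny : F @ -oo --> (0 : R).
Proof. by have := cvg_cdfNy0 idRV; rewrite cdfE => h; exact: (fine_cvg h). Qed.

Let F_rc s : F t @[t --> s^'+] --> F s.
Proof. by have := @cdf_right_continuous _ _ _ _ idRV s; rewrite cdfE => h; exact: (fine_cvg h). Qed.

(** Galois connection between the quantile and the distribution function; the
    direction from left to right rests on right continuity. *)
Lemma quantile_le (u s : R) : 0 < u < 1 -> (quantile u <= s) = (u <= F s).
Proof.
move=> u01; rewrite /quantile u01; case/andP: u01 => u0 u1.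
pose S := [set s | u <= F s].
have [a aF] : exists a, forall s, s < a -> F s < u.
  have /cvgr_lt/(_ _ u0)[a [_ h]] := F_Ny; by exists a.
have hS : has_inf S.
  split.
    have /cvgr_gt/(_ _ u1)[b [_ h]] := F_y; exists (b + 1); apply/ltW/h.
    by rewrite ltrDl.
  exists a => x /= ux; rewrite leNgt; apply/negP => /aF; by rewrite ltNge ux.
apply/idP/idP => h; last by apply: ge_inf => //; case: hS.
rewrite leNgt; apply/negP => Fu; have /cvgr_lt/(_ _ Fu) nF := @F_rc s.
near s^'+ => t; have ts : 0 < t - s by rewrite subr_gt0.
have : F t < u by near: t.
have [e Se et] := inf_adherent ts hS.
rewrite ltNge => /negP; apply; apply: (le_trans Se); apply: dfun_nd; apply/ltW/(lt_le_trans et).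
by rewrite addrCA -lerBrDl subrr subr_le0.
Unshelve. all: by end_near. Qed.

Lemma measurable_quantile : measurable_fun setT quantile.
Proof.
apply: (measurability (@RGenOInfty.G R)) => [|/= _ [_] [x] -> <-].
  exact: RGenOInfty.measurableE.
rewrite setTI.
rewrite (_ : _ @^-1` _ = (`]0, 1[ `&` `]F x, +oo[) `|`
  (~` `]0, 1[ `&` (if 0 > x then setT else set0))).
  apply: measurableU; apply: measurableI => //; first exact: measurableC.
  by case: ifP.
apply/seteqP; split => u /=; rewrite !in_itv/= !andbT.
  have [u01|/negP u01] := boolP (0 < u < 1).
    by move=> xu; left; split => //; rewrite ltNge -quantile_le// -ltNge.
  by rewrite /quantile; move/negP/negbTE: (u01) => -> ->; right.
move=> [[u01]|[u01]]; first by rewrite !ltNge quantile_le.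
by rewrite /quantile; move/negP/negbTE: (u01) => ->; case: ifP.
Qed.

End quantile_function.
Section uniform_law.
Context {R : realType}.
Local Notation lam := (@lebesgue_measure R).

Definition uniform_law : set (measurableTypeR R) -> \bar R :=
  mrestr lam (measurable_itv `]0, 1[).

HB.instance Definition _ := Measure.on uniform_law.

Lemma uniform_law_setT : uniform_law setT = 1%E.
Proof. by rewrite /uniform_law /mrestr setTI lebesgue_measure_itv/= lte_fin ltr01 oppr0 adde0. Qed.

HB.instance Definition _ := @Measure_isProbability.Build _ _ R uniform_law uniform_law_setT.

Lemma uniform_law_itv (v w : R) : 0 <= v -> w <= 1 ->
  (uniform_law `]v, w]%classic <= (Num.max 0 (w - v))%:E)%E.
Proof.
move=> v0 w1; apply: (@le_trans _ _ (lam `]v, w]%classic)).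
  by apply: le_measure => //; rewrite ?inE//; exact: measurableI.
rewrite lebesgue_measure_itv/= lte_fin; case: ltP => vw; rewrite lee_fin le_max ?lexx//.
by rewrite orbT.
Qed.

End uniform_law.

Section quantile_coupling.
Context {R : realType}.
Local Notation U := (@uniform_law R).

(** The same function, with the Borel structure that carries Lebesgue measure on its
    domain. *)
Definition quantile_fun (mu : probability R R) : measurableTypeR R -> R := quantile mu.

Lemma measurable_quantile_fun mu : measurable_fun setT (quantile_fun mu).
Proof. exact: measurable_quantile. Qed.

HB.instance Definition _ mu := isMeasurableFun.Build _ _ _ _ (quantile_fun mu) (measurable_quantile_fun mu).

Lemma quantile_gt_law (mu : probability R R) (x : R) :
  U (quantile_fun mu @^-1` `]x, +oo[%classic) = mu `]x, +oo[%classic.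
Proof.
have -> : mu `]x, +oo[%classic = (1 - dfun mu x)%:E.
  by rewrite -setCitvl (@probability_setC _ _ _ mu)// EFin_dfun -EFinB.
rewrite /uniform_law /mrestr (_ : _ `&` _ = `]dfun mu x, 1[%classic).
  rewrite lebesgue_measure_itv/= lte_fin; case: ltP => // h.
  by have := dfun_le1 mu x => h'; rewrite (@le_anti _ _ (dfun mu x) 1) ?subrr// h' h.
apply/seteqP; split => u /=; rewrite !in_itv/=.
  by rewrite andbT /quantile_fun => -[+ u01]; rewrite ltNge quantile_le// -ltNge => ->; case/andP: u01.
move=> /andP[xu u1]; have u01 : 0 < u < 1 by rewrite u1 (le_lt_trans (dfun_ge0 mu x)).
by split => //; rewrite andbT /quantile_fun ltNge quantile_le// -ltNge.
Qed.

Lemma quantile_law (mu : probability R R) (A : set R) : measurable A ->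
  U (quantile_fun mu @^-1` A) = mu A.
Proof.
move=> mA; have := RGenOInfty.measurableE R => E.
apply: (@g_sigma_algebra_measure_unique _ R R (@RGenOInfty.G R) _ (fun k => `]- k%:R, +oo[%classic) _ _ (distribution U (quantile_fun mu)) mu) => //.
- by move=> _ [x ->]; exact: measurable_itv.
- by move=> k; exists (- k%:R).
- apply/seteqP; split => // x _; exists (Num.truncn (- x)).+1 => //=.
  by rewrite in_itv/= andbT ltrNl truncnS_gt.
- move=> _ _ [x ->] [y ->]; exists (Num.max x y).
  by apply/seteqP; split => z /=; rewrite !in_itv/= !andbT gt_max => /andP.
- by move=> _ [x ->]; exact: quantile_gt_law.
- by move=> k; rewrite (le_lt_trans (probability_le1 _ _)) ?ltry.
- by have : (@RGenOInfty.G R).-sigma.-measurable A by rewrite -E.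
Qed.

(** The coupling by quantiles of one uniform variable sends to
    [`]-oo, s] `*` `]t, +oo[] the interval [`]G t, F s]], so it attains the lower
    bound for all pairs of thresholds at once. *)
Lemma wasserstein2_sqE (mu nu : probability R R) :
  wasserstein2_sq mu nu =
  (\int[@lebesgue_measure R]_s \int[@lebesgue_measure R]_t
     (2 * wgap (dfun nu) (dfun mu s) s t)%:E)%E.
Proof.
apply/le_anti/andP; split; last first.
  apply: le_ereal_inf_tmp => _ [pi cpl <-]; apply: coupling_cost_ge cpl => s; exact: EFin_dfun.
pose q : measurableTypeR R -> R * R := fun u => (quantile_fun mu u, quantile_fun nu u).
have mq : measurable_fun setT q by apply: measurable_fun_pair; exact: measurable_quantile_fun.
pose qRV : {RV U >-> (R * R)%type} := mfun_Sub (mem_set mq).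
pose pi : probability (R * R)%type R := distribution U qRV.
have piE A : pi A = U (q @^-1` A) by [].
apply: (@le_trans _ _ (\int[pi]_p (`|p.1 - p.2| ^+ 2)%:E)%E).
  apply: ereal_inf_lbound; exists pi => // A mA; split.
    rewrite piE -(quantile_law mu mA); congr (U _).
    by apply/seteqP; split => u /= => [[]|].
  rewrite piE -(quantile_law nu mA); congr (U _).
  by apply/seteqP; split => u /= => [[]|].
rewrite transport_cost.
apply: ge0_integral_mono => s.
  by apply: integral_ge0 => t _; apply: integral_ge0 => p _; rewrite lee_fin mulr_ge0.
apply: ge0_integral_mono => t.
  by apply: integral_ge0 => p _; rewrite lee_fin mulr_ge0.
rewrite expectation_crossing EFinM lee_pmul2l// piE /wgap.
have key (A : set R) v w : measurable A -> 0 <= v -> w <= 1 ->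
    (forall u, 0 < u < 1 -> A u -> v < u <= w) -> (U A <= (Num.max 0 (w - v))%:E)%E.
  move=> mA v0 w1 h; apply: le_trans (uniform_law_itv v0 w1).
  rewrite /uniform_law /mrestr; apply: le_measure; rewrite ?inE//; try exact: measurableI.
  by move=> u [Au u01]; split => //=; rewrite in_itv/=; apply: h.
case: ltP => st.
  apply: key; rewrite ?dfun_ge0 ?dfun_le1//.
    by rewrite -[X in measurable X]setTI; apply: (mq) => //; exact: measurableX.
  move=> u u01 [] /=; rewrite !in_itv/= andbT /quantile_fun quantile_le// => ->.
  by rewrite ltNge quantile_le// -ltNge => ->.
apply: key; rewrite ?dfun_ge0 ?dfun_le1//.
  by rewrite -[X in measurable X]setTI; apply: (mq) => //; exact: measurableX.
move=> u u01 [] /=; rewrite !in_itv/= andbT /quantile_fun ltNge quantile_le// -ltNge => ->.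
by rewrite quantile_le.
Qed.

End quantile_coupling.

Section empirical_probability.
Context {R : realType} (n : nat) (x : 'I_n.+1 -> R).

Lemma empirical_measure_prob :
  exists nu : probability R R, empirical_measure x = nu :> (set R -> \bar R).
Proof.
have n0 : 0 <= n.+1%:R^-1 :> R by [].
pose m := mscale (NngNum n0) (msum (fun k => \d_(x (inord k))) n.+1).
have mE : empirical_measure x = m.
  apply/funext => A; rewrite /m /mscale /msum /empirical_measure /=; congr (_ * _)%E.
  by apply: eq_bigr => i _; rewrite inord_val.
have m1 : m setT = 1%E.
  rewrite /m /mscale/= /msum/= (eq_bigr (fun=> 1%E)) => [|i _]; last by rewrite diracT.
  by rewrite sumEFin sumr_const card_ord -EFinM mulVf.
by exists (HB.pack_for (probability R R) m (@Measure_isProbability.Build _ _ R m m1)).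
Qed.

Lemma dfun_empirical t :
  dfun (empirical_measure x) t = n.+1%:R^-1 * \sum_i le_indic t (x i).
Proof.
rewrite /dfun /empirical_measure (eq_bigr (fun i => (le_indic t (x i))%:E)) ?sumEFin// => i _.
by rewrite diracE /le_indic mem_setE in_itv.
Qed.

Lemma wasserstein2_sq_empirical (mu : probability R R) :
  wasserstein2_sq (empirical_measure x) mu =
  (\int[@lebesgue_measure R]_s \int[@lebesgue_measure R]_t
     (2 * wgap (dfun mu) (n.+1%:R^-1 * \sum_i le_indic s (x i)) s t)%:E)%E.
Proof.
have [nu E] := empirical_measure_prob; rewrite E wasserstein2_sqE -E.
by apply: eq_integral => s _; rewrite dfun_empirical.
Qed.

End empirical_probability.
(** * Local expansion of the transport cost *)

Section integral_squeeze.
Context {d} {T : measurableType d} {R : realType} (mu : {measure set T -> \bar R}).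

(** The upper bound is monotonicity of the integral; for the lower one the positive
    part of [g - h] is a measurable function below [f]. *)
Lemma integral_squeeze (f : T -> \bar R) (g h : T -> R) (g0 h0 : R) :
  measurable_fun setT g -> measurable_fun setT h ->
  (forall x, 0 <= f x)%E -> (forall x, 0 <= g x) -> (forall x, 0 <= h x) ->
  (\int[mu]_x (g x)%:E = g0%:E)%E -> (\int[mu]_x (h x)%:E = h0%:E)%E ->
  (forall x, f x <= (g x + h x)%:E)%E -> (forall x, (g x - h x)%:E <= f x)%E ->
  (\int[mu]_x f x)%E \is a fin_num /\ `|fine (\int[mu]_x f x)%E - g0| <= h0.
Proof.
move=> mg mh f0 g_ge0 h_ge0 gE hE fle fge.
have f0' : (0 <= \int[mu]_x f x)%E by exact: integral_ge0.
have up : (\int[mu]_x f x <= (g0 + h0)%:E)%E.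
  rewrite EFinD -gE -hE -ge0_integralD//; first last.
  - exact/measurable_EFinP.
  - by move=> x _; rewrite lee_fin.
  - exact/measurable_EFinP.
  - by move=> x _; rewrite lee_fin.
  exact: ge0_integral_mono.
have lo : (g0%:E <= \int[mu]_x f x + h0%:E)%E.
  have m1 : measurable_fun setT (fun x => Num.max 0 (g x - h x)).
    by apply: measurable_maxr => //; exact: measurable_funB.
  apply: (@le_trans _ _ (\int[mu]_x ((Num.max 0 (g x - h x))%:E + (h x)%:E))%E).
    rewrite -gE; apply: ge0_integral_mono => x; first by rewrite lee_fin.
    by rewrite -EFinD lee_fin -lerBlDr le_max lexx orbT.
  rewrite ge0_integralD//; first last.
  - exact/measurable_EFinP.
  - by move=> x _; rewrite lee_fin.
  - exact/measurable_EFinP.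
  - by move=> x _; rewrite lee_fin le_max lexx.
  rewrite hE leeD2r//; apply: ge0_integral_mono => x; first by rewrite lee_fin le_max lexx.
  by rewrite EFin_max ge_max f0 fge.
have fn : (\int[mu]_x f x)%E \is a fin_num.
  by rewrite ge0_fin_numE// (le_lt_trans up)// ltry.
split => //; move: up lo; rewrite -(fineK fn) -EFinD !lee_fin => up lo.
by rewrite ler_norml; apply/andP; split; lra.
Qed.

End integral_squeeze.

Lemma dist_maxr0 {R : realDomainType} (x y : R) : `|Num.max 0 x - Num.max 0 y| <= `|x - y|.
Proof.
wlog xy : x y / x <= y.
  by move=> h; case: (leP x y) => xy; [exact: h|rewrite distrC (distrC x) h// ltW].
have ny : `|x - y| = y - x by rewrite distrC ger0_norm// subr_ge0.
rewrite ny; case: (leP 0 x) => x0; case: (leP 0 y) => y0; rewrite ler_norml; apply/andP; split; lra.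
Qed.

(** [N] stands for the vertical distance between the level [v] and [G] at horizontal
    distance [x] from [s], and [D - x / c] for its linearization.  The first
    alternative covers the points beyond the support of the law, where [G] no longer
    follows its tangent. *)
Lemma tent_dist {R : realFieldType} (c K C D x N : R) :
  0 < c -> c <= K -> 0 <= D -> 0 <= x -> 0 <= C ->
  (N <= 0 /\ D - x / c <= C * x ^+ 2) \/ `|N - (D - x / c)| <= C * x ^+ 2 ->
  (K * D < x -> N <= 0) ->
  `|2 * Num.max 0 N - 2 * Num.max 0 (D - x / c)| <=
    if x <= K * D then 2 * (C * (K * D) ^+ 2) else 0.
Proof.
move=> c0 cK D0 x0 C0 near far; rewrite -mulrBr normrM (ger0_norm (ler0n R 2)).
case: ifPn => [xK|]; last first.
  rewrite -ltNge => Kx; rewrite max_l ?far// max_l ?subr0 ?normr0 ?mulr0//.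
  by rewrite subr_le0 ler_pdivlMr// mulrC (le_trans _ (ltW Kx))// ler_wpM2r.
rewrite ler_pM2l//; apply: (@le_trans _ _ (C * x ^+ 2)); last first.
  by rewrite ler_wpM2l// lerXn2r// nnegrE// (le_trans x0).
case: near => [[N0 h]|h]; last exact: le_trans (dist_maxr0 _ _) h.
rewrite max_l// sub0r normrN ger0_norm ?le_max ?lexx//.
by rewrite ge_max h mulr_ge0// sqr_ge0.
Qed.

Section transport_expansion.
Context {R : realType} (G kap : R -> R) (a b K C : R).
Local Notation lam := (@lebesgue_measure R).
Hypothesis C0 : 0 <= C.
Hypothesis kapK : forall u, 0 <= u <= 1 -> 0 < kap u <= K.
Hypothesis G_nd : forall s t, s <= t -> G s <= G t.
Hypothesis Ga : forall t, t <= a -> G t = 0.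
Hypothesis Gb : forall t, b <= t -> G t = 1.
Hypothesis G_expand : forall s t, a <= s -> s <= t -> t <= b -> (t - s) / K <= G t - G s.
Hypothesis G_tangent : forall s t, a <= s <= b -> a <= t <= b ->
  `|G t - G s - (t - s) / kap (G s)| <= C * (t - s) ^+ 2.

Let K0 : 0 < K.
Proof. by have /andP[] := @kapK 0 (introT andP (conj (lexx 0) ler01)) => /lt_le_trans h /h. Qed.

Let K00 := ltW K0.

Let wgap_ge0 v s t : 0 <= wgap G v s t.
Proof. by rewrite /wgap; case: ifP => _; rewrite le_max lexx. Qed.

(** [D] is the vertical gap between [v] and [G s], [g] the tent obtained by
    replacing [G] with its tangent line at [s], and [A] an interval outside which
    both functions vanish. *)
Let tent_squeeze v s c D (g : R -> R) (A : set R) : measurable A -> lam A = (K * D)%:E ->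
  0 <= D -> measurable_fun setT g -> (forall t, 0 <= g t) ->
  (\int[lam]_t (g t)%:E = (c * D ^+ 2)%:E)%E ->
  (forall t, `|2 * wgap G v s t - g t| <= 2 * (C * (K * D) ^+ 2) * \1_A t) ->
  (\int[lam]_t (2 * wgap G v s t)%:E)%E \is a fin_num /\
  `|fine (\int[lam]_t (2 * wgap G v s t)%:E)%E - c * D ^+ 2| <= 2 * C * K ^+ 3 * D ^+ 3.
Proof.
move=> mA lA D0 mg g0 gE key; pose h t := 2 * (C * (K * D) ^+ 2) * \1_A t.
have h0 : 0 <= 2 * (C * (K * D) ^+ 2) by rewrite mulr_ge0// mulr_ge0// sqr_ge0.
have mh : measurable_fun setT h by apply: measurable_funM => //; exact: measurable_indic.
have wg0 t : (0 <= (2 * wgap G v s t)%:E)%E by rewrite lee_fin mulr_ge0.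
have hE : (\int[lam]_t (h t)%:E = (2 * C * K ^+ 3 * D ^+ 3)%:E)%E.
  by rewrite (integral_cst_indic mA h0 lA); congr (_%:E); ring.
apply: (@integral_squeeze _ _ _ lam _ g h _ _ mg mh wg0 g0 _ gE hE) => t.
- by rewrite /h mulr_ge0// indicE.
- by rewrite lee_fin /h; have := key t; rewrite ler_norml => /andP[_ ?]; lra.
- by rewrite lee_fin /h; have := key t; rewrite ler_norml => /andP[? _]; lra.
Qed.

Let tent_indic D x : 2 * (C * (K * D) ^+ 2) * (x <= K * D)%R%:R =
  if x <= K * D then 2 * (C * (K * D) ^+ 2) else 0.
Proof. by case: ifP; rewrite ?mulr1 ?mulr0. Qed.

(** Near [s] the function [G] has slope [1 / kap (G s)], so [wgap G v s] is close to
    a triangle of height [`|v - G s|] and base [kap (G s) * `|v - G s|].  By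
    [G_expand] only a segment of length [K * `|v - G s|] contributes; there the
    deviation from the tangent is quadratic, and its integral is cubic. *)
Lemma integral_wgap s v : a <= s <= b -> 0 <= v <= 1 ->
  (\int[lam]_t (2 * wgap G v s t)%:E)%E \is a fin_num /\
  `|fine (\int[lam]_t (2 * wgap G v s t)%:E)%E - kap (G s) * (v - G s) ^+ 2| <=
    2 * C * K ^+ 3 * `|v - G s| ^+ 3.
Proof.
move=> /andP[aS sb] /andP[v0 v1].
have G01 : 0 <= G s <= 1 by rewrite -(Ga (lexx a)) -(Gb (lexx b)) !G_nd.
set c := kap (G s); have /andP[c0 cK] : 0 < c <= K by exact: kapK.
have c00 := ltW c0.
have [vs|sv] := leP (G s) v.
  pose D := v - G s; have D0 : 0 <= D by rewrite subr_ge0.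
  pose g t := (2 * (c^-1 * (s + c * D - t))) * \1_(`]s, s + c * D]%classic : set R) t.
  have mg : measurable_fun setT g.
    apply: measurable_funM; last exact: measurable_indic.
    by do 2 (apply: measurable_funM => //); apply: measurable_funB.
  have key t : `|2 * wgap G v s t - g t| <=
      2 * (C * (K * D) ^+ 2) * \1_(`[s, s + K * D]%classic : set R) t.
    rewrite /g !indicE !mem_setE !in_itv/= /wgap.
    case: (ltP s t) => st /=; last first.
      rewrite max_l ?mulr0 ?subr0 ?normr0 ?mulr_ge0 ?ler0n ?sqr_ge0//.
      by rewrite subr_le0 (le_trans _ vs)// G_nd.
    have x0 : 0 <= t - s by rewrite subr_ge0 ltW.
    have tE : (t <= s + K * D) = (t - s <= K * D) by rewrite lerBlDl.
    have gE : 2 * (c^-1 * (s + c * D - t)) * (t <= s + c * D)%R%:R =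
              2 * Num.max 0 (D - (t - s) / c).
      have -> : D - (t - s) / c = c^-1 * (s + c * D - t) by field; rewrite gt_eqF.
      case: (leP t (s + c * D)) => tc; rewrite ?mulr1 ?mulr0.
        by rewrite max_r// mulr_ge0 ?invr_ge0 ?subr_ge0// ltW.
      by rewrite max_l ?mulr0// mulr_ge0_le0 ?invr_ge0 ?subr_le0// ltW.
    rewrite gE tE (ltW st)/= tent_indic.
    apply: tent_dist => //.
      case: (leP t b) => tb.
        right; rewrite (_ : v - G t - _ = - (G t - G s - (t - s) / c)); last by rewrite /D; ring.
        by rewrite normrN; apply: G_tangent; apply/andP; split => //; apply: le_trans (ltW st).
      left; split; first by rewrite (Gb (ltW tb)) subr_le0.
      have := @G_tangent s b; rewrite aS sb lexx (le_trans aS sb) => /(_ isT isT).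
      rewrite (Gb (lexx b)) ler_norml => /andP[_ h1].
      have y0 : 0 <= b - s by rewrite subr_ge0.
      have yx : b - s <= t - s by rewrite lerB// ltW.
      have h2 : (b - s) / c <= (t - s) / c by rewrite ler_pM2r ?invr_gt0.
      have h3 : C * (b - s) ^+ 2 <= C * (t - s) ^+ 2 by rewrite ler_wpM2l// lerXn2r// nnegrE.
      by rewrite -/c in h1; rewrite /D; lra.
    move=> Kx; case: (leP t b) => tb; last by rewrite (Gb (ltW tb)) subr_le0.
    have := G_expand aS (ltW st) tb; rewrite ler_pdivrMr// => h1.
    have : K * D < (G t - G s) * K by exact: lt_le_trans h1.
    by rewrite mulrC ltr_pM2r// /D => h2; lra.
  have gE : (\int[lam]_t (g t)%:E = (c * D ^+ 2)%:E)%E.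
    rewrite (_ : (fun t => _) = (fun t => ((2 * (c^-1 * (s + c * D - t)))%:E)) \_ `]s, s + c * D]); last first.
      by apply/funext => t; rewrite patchE /g indicE; case: ifP => _; rewrite ?mulr1 ?mulr0.
    have sD : s <= s + c * D by rewrite lerDl mulr_ge0// ltW.
    rewrite -integral_mkcond integral_itv_obnd_cbnd; last first.
      apply/measurable_EFinP.
      by do 2 (apply: measurable_funM => //); apply: measurable_funB.
    under eq_integral do rewrite mulrCA EFinM.
    rewrite ge0_integralZl//; last 3 first.
    - apply/measurable_EFinP; apply: measurable_funM => //; apply: measurable_funB => //.
    - move=> t /=; rewrite in_itv/= => /andP[_ tD]; by rewrite lee_fin mulr_ge0// subr_ge0.
    - by rewrite lee_fin invr_ge0 ltW.
    rewrite integral_ramp_right// -EFinM; congr (_%:E); rewrite /D; field; by rewrite gt_eqF.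
  have nD : `|v - G s| = D by rewrite ger0_norm.
  have sK : s <= s + K * D by rewrite lerDl mulr_ge0.
  rewrite nD; apply: (tent_squeeze _ _ D0 mg _ gE key) => // [|t].
    by rewrite lebesgue_measure_segment//; congr (_%:E); ring.
  rewrite /g indicE mem_setE in_itv/=; case: andP => [[_ tD]|_]; rewrite ?mulr0 ?mulr1//.
  by rewrite mulr_ge0// mulr_ge0 ?invr_ge0 ?subr_ge0.
pose D := G s - v; have D0 : 0 <= D by rewrite subr_ge0 ltW.
pose g t := (2 * (c^-1 * (t - (s - c * D)))) * \1_(`[s - c * D, s]%classic : set R) t.
have mg : measurable_fun setT g.
  apply: measurable_funM; last exact: measurable_indic.
  by do 2 (apply: measurable_funM => //); apply: measurable_funB.
have key t : `|2 * wgap G v s t - g t| <=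
    2 * (C * (K * D) ^+ 2) * \1_(`[s - K * D, s]%classic : set R) t.
  rewrite /g !indicE !mem_setE !in_itv/= /wgap.
  case: (ltP s t) => st /=.
    rewrite !andbF max_l ?mulr0 ?subr0 ?normr0//.
    by rewrite subr_le0 (le_trans (ltW sv))// G_nd// ltW.
  rewrite !andbT.
  have x0 : 0 <= s - t by rewrite subr_ge0.
  have tE : (s - K * D <= t) = (s - t <= K * D) by rewrite lerBlDl addrC -lerBlDl.
  have gE : 2 * (c^-1 * (t - (s - c * D))) * (s - c * D <= t)%R%:R =
            2 * Num.max 0 (D - (s - t) / c).
    have -> : D - (s - t) / c = c^-1 * (t - (s - c * D)) by field; rewrite gt_eqF.
    case: (leP (s - c * D) t) => tc; rewrite ?mulr1 ?mulr0.
      by rewrite max_r// mulr_ge0 ?invr_ge0 ?subr_ge0// ltW.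
    by rewrite max_l ?mulr0// mulr_ge0_le0 ?invr_ge0 ?subr_le0// ltW.
  rewrite gE tE tent_indic.
  apply: tent_dist => //.
    case: (leP a t) => ta.
      right; rewrite (_ : G t - v - _ = G t - G s - (t - s) / c); last by rewrite /D; ring.
      by rewrite -(sqrrN (s - t)) opprB; apply: G_tangent; apply/andP; split => //; apply: le_trans sb.
    left; split; first by rewrite (Ga (ltW ta)) sub0r oppr_le0.
    have := @G_tangent s a; rewrite aS sb lexx (le_trans aS sb) => /(_ isT isT).
    rewrite (Ga (lexx a)) ler_norml => /andP[h1 _].
    have y0 : 0 <= s - a by rewrite subr_ge0.
    have yx : s - a <= s - t by rewrite lerB// ltW.
    have h2 : (s - a) / c <= (s - t) / c by rewrite ler_pM2r ?invr_gt0.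
    have h3 : C * (s - a) ^+ 2 <= C * (s - t) ^+ 2 by rewrite ler_wpM2l// lerXn2r// nnegrE.
    rewrite -/c -(opprB s a) sqrrN mulNr in h1; rewrite /D; lra.
  move=> Kx; case: (leP a t) => ta; last by rewrite (Ga (ltW ta)) sub0r oppr_le0.
  have := G_expand ta st sb; rewrite ler_pdivrMr// => h1.
  have : K * D < (G s - G t) * K by exact: lt_le_trans h1.
  by rewrite mulrC ltr_pM2r// /D => h2; lra.
have gE : (\int[lam]_t (g t)%:E = (c * D ^+ 2)%:E)%E.
  rewrite (_ : (fun t => _) = (fun t => ((2 * (c^-1 * (t - (s - c * D))))%:E)) \_ `[s - c * D, s]); last first.
    by apply/funext => t; rewrite patchE /g indicE; case: ifP => _; rewrite ?mulr1 ?mulr0.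
  have sD : s - c * D <= s by rewrite gerBl mulr_ge0// ltW.
  rewrite -integral_mkcond.
  under eq_integral do rewrite mulrCA EFinM.
  rewrite ge0_integralZl//; last 3 first.
  - apply/measurable_EFinP; apply: measurable_funM => //; apply: measurable_funB => //.
  - move=> t /=; rewrite in_itv/= => /andP[tD _]; by rewrite lee_fin mulr_ge0// subr_ge0.
  - by rewrite lee_fin invr_ge0 ltW.
  rewrite integral_ramp_left// -EFinM; congr (_%:E); rewrite /D; field; by rewrite gt_eqF.
have nD : `|v - G s| = D by rewrite distrC ger0_norm.
have sK : s - K * D <= s by rewrite gerBl mulr_ge0.
rewrite nD -(sqrrN (v - G s)) opprB; apply: (tent_squeeze _ _ D0 mg _ gE key) => // [|t].
  by rewrite lebesgue_measure_segment//; congr (_%:E); ring.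
rewrite /g indicE mem_setE in_itv/=; case: andP => [[tD _]|_]; rewrite ?mulr0 ?mulr1//.
by rewrite mulr_ge0// mulr_ge0 ?invr_ge0 ?subr_ge0.
Qed.

Lemma integral_wgap_out s v : (s <= a /\ v = 0) \/ (b <= s /\ v = 1) ->
  (\int[lam]_t (2 * wgap G v s t)%:E = 0)%E.
Proof.
move=> h; apply: integral0_eq => t _; rewrite /wgap; congr (_%:E).
case: h => -[sab ->]; case: ltP => st; rewrite max_l ?mulr0//.
- by rewrite sub0r oppr_le0 -(Ga (lexx a)); case: (leP a t) => [/G_nd//|/ltW/Ga ->]; rewrite Ga.
- by rewrite subr0 (Ga (le_trans st sab)).
- by rewrite (Gb (le_trans sab (ltW st))) subrr.
- by rewrite subr_le0 -(Gb (lexx b)); case: (leP t b) => [/G_nd//|/ltW/Gb ->]; rewrite Gb.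
Qed.

End transport_expansion.
(** * Curvature and cumulative distribution function *)

Lemma lipschitz_continuous {R : realType} (f : R -> R) (L : R) :
  (forall s t, `|f s - f t| <= L * `|s - t|) -> continuous f.
Proof.
move=> fL x; apply/cvgrPdist_le => e e0.
have L0 : 0 <= L by have := fL 0 1; rewrite sub0r normrN normr1 mulr1; apply: le_trans.
have L1 : 0 < L + 1 by rewrite ltr_wpDl.
exists (e / (L + 1)) => /=; first by rewrite divr_gt0.
move=> y /= xy; apply: le_trans (fL x y) _.
apply: (@le_trans _ _ ((L + 1) * (e / (L + 1)))); last by rewrite mulrC divfK// gt_eqF.
by apply: ler_pM => //; [rewrite lerDl|exact: ltW].
Qed.

Section derivative_on_unit.
Context {R : realType} (f : R -> R).
Local Notation I := (`[0, 1]%classic : set R).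
Hypothesis fd : derivable_on I f.

Let dqP (s e : R) : I s -> 0 < e -> exists2 r : R, 0 < r &
  forall t, I t -> t != s -> `|t - s| < r -> `|derive_on I f s - diffquot f s t| <= e.
Proof.
move=> Is e0.
have /cvgrPdist_le/(_ _ e0) := fd Is.
rewrite near_withinE => -[r /= r0 h]; exists r => // t It ts tr.
apply: h => //=; first by rewrite distrC.
Qed.

Let incr s t : t != s -> f t - f s = (t - s) * diffquot f s t.
Proof. by move=> ts; rewrite /diffquot /GRing.scale/= mulrA divff ?mul1r// subr_eq0. Qed.

Lemma derivable_on_continuous : {within I, continuous f}.
Proof.
apply/subspace_continuousP => s Is; apply/cvgrPdist_le => e e0; rewrite near_withinE.
have [r r0 h] := dqP Is (ltr01 : 0 < 1 :> R).
set D := derive_on I f s in h.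
have D0 : 0 < `|D| + 1 by rewrite ltr_pwDr.
exists (Num.min r (e / (`|D| + 1))) => /=; first by rewrite lt_min r0 divr_gt0.
move=> t /=; rewrite distrC lt_min => /andP[tr te] It.
have [->|ts] := eqVneq t s; first by rewrite subrr normr0 ltW.
rewrite distrC incr// normrM.
apply: (@le_trans _ _ (e / (`|D| + 1) * (`|D| + 1))); last by rewrite divfK// gt_eqF.
apply: ler_pM => //; first exact: ltW.
rewrite -lerBlDl; apply: le_trans (h _ It ts tr); rewrite distrC.
exact: lerB_dist.
Qed.

Lemma derive_on_interior (s : R) : s \in `]0, 1[ -> is_derive s (1 : R) f (derive_on I f s).
Proof.
rewrite in_itv/= => /andP[s0 s1].
have Is : I s by rewrite /= in_itv/= !ltW.
suff h : h^-1 *: (f (h *: 1 + s) - f s) @[h --> 0^'] --> derive_on I f s.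
  by apply: DeriveDef; [apply: cvgP h|exact: cvg_lim h].
apply/cvgrPdist_le => e e0; rewrite near_withinE.
have [r r0 hr] := dqP Is e0.
exists (Num.min r (Num.min s (1 - s))) => /=; first by rewrite !lt_min r0 s0 subr_gt0.
move=> h /=; rewrite sub0r normrN !lt_min => /and3P[hr' hs hs1] h0.
have hA : (h *: (1 : R) : R) = h by rewrite /GRing.scale/= mulr1.
rewrite hA; have := hr (h + s); rewrite /diffquot !addrK; apply => //.
  rewrite /= in_itv/=; move: hs hs1; rewrite !ltr_norml => /andP[? ?] /andP[? ?].
  by apply/andP; split; lra.
by rewrite -subr_eq0 addrK.
Qed.

Lemma derivable_on_lipschitz (M : R) :
  (forall s, s \in `[0, 1] -> `|derive_on I f s| <= M) ->
  forall s t, s \in `[0, 1] -> t \in `[0, 1] -> `|f s - f t| <= M * `|s - t|.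
Proof.
move=> fM.
have H s t : 0 <= s -> s < t -> t <= 1 -> `|f t - f s| <= M * `|t - s|.
  move=> s0 st t1.
  have [x xst| |c cst ->] := @MVT R f (derive_on I f) s t st.
  - apply: derive_on_interior; move: xst; rewrite !in_itv/= => /andP[sx xt].
    by rewrite (le_lt_trans s0 sx) (lt_le_trans xt t1).
  - apply: continuous_subspaceW derivable_on_continuous => x /=; rewrite !in_itv/= => /andP[sx xt].
    by rewrite (le_trans s0 sx) (le_trans xt t1).
  rewrite normrM ler_wpM2r// fM//; move: cst; rewrite !in_itv/= => /andP[sx xt].
  by rewrite (le_trans s0 (ltW sx)) (le_trans (ltW xt) t1).
move=> s t; rewrite !in_itv/= => /andP[s0 s1] /andP[t0 t1].
case: (ltgtP s t) => [st|ts|->]; last by rewrite !subrr normr0 mulr0.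
  by rewrite distrC (distrC s) H.
by rewrite H.
Qed.

End derivative_on_unit.

Section profile.
Context {R : realType} (kap : R -> R) (k K L : R).
Local Notation lam := (@lebesgue_measure R).
Hypothesis k0 : 0 < k.
Hypothesis kapkK : forall u, 0 <= u <= 1 -> k <= kap u <= K.
Hypothesis kapL : forall u v, 0 <= u <= 1 -> 0 <= v <= 1 -> `|kap u - kap v| <= L * `|u - v|.

(** The curvature is controlled on [`[0, 1]] only; clamping its argument gives a
    continuous, hence measurable, function on the line. *)
Let clamp (u : R) : R := Num.max 0 (Num.min u 1).

Let clamp01 u : 0 <= clamp u <= 1.
Proof. by rewrite /clamp le_max lexx/= ge_max ler01 ge_min lexx orbT. Qed.

Let clampE u : 0 <= u <= 1 -> clamp u = u.
Proof. by move=> /andP[u0 u1]; rewrite /clamp min_l// max_r. Qed.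

Let clamp_lip u v : `|clamp u - clamp v| <= `|u - v|.
Proof.
apply: le_trans (dist_maxr0 _ _) _.
wlog uv : u v / u <= v.
  by move=> h; case: (leP u v) => uv; [exact: h|rewrite distrC (distrC u) h// ltW].
have nuv : `|u - v| = v - u by rewrite distrC ger0_norm// subr_ge0.
by rewrite nuv; case: (leP u 1) => ?; case: (leP v 1) => ?; rewrite ler_norml; apply/andP; split; lra.
Qed.

Let L0 : 0 <= L.
Proof.
by have := @kapL 0 1; rewrite !lexx ler01 sub0r normrN normr1 mulr1 => /(_ isT isT); apply: le_trans.
Qed.

Let continuous_clamped : continuous (fun u => kap (clamp u)).
Proof.
apply: (@lipschitz_continuous _ _ L) => u v; apply: le_trans (kapL (clamp01 u) (clamp01 v)) _.
by rewrite ler_wpM2l.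
Qed.

Let measurable_curvature_inv : measurable_fun setT (fun u => (kap (clamp u))^-1).
Proof.
apply: continuous_measurable_fun => u; apply: cvgV; last exact: continuous_clamped.
by rewrite gt_eqF// (lt_le_trans k0)//; have /andP[] := kapkK (clamp01 u).
Qed.

Context (mu : probability R R) (a b : R) (F : R -> R).
Local Notation G := (dfun mu).
Hypothesis ltab : a < b.
Hypothesis F_eq : forall t, t \in `]a, b[ ->
  ((F t)%:E = \int[lam]_(s in `]a, t]) ((kap (F s))^-1)%:E)%E.
Hypothesis F_a : F s @[s --> a^'+] --> (0 : R).
Hypothesis F_b : F s @[s --> b^'-] --> (1 : R).
Hypothesis mu_cdf : forall t, t \in `]a, b[ -> mu [set` `]-oo, t]] = (F t)%:E.

Let GF t : a < t -> t < b -> G t = F t.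
Proof. by move=> at_ tb; rewrite /dfun mu_cdf// in_itv/= at_ tb. Qed.

Lemma profile_before t : t <= a -> G t = 0.
Proof.
move=> ta; apply/eqP; rewrite eq_le dfun_ge0 andbT.
apply: (@cvgr_to_ge _ _ (at_right_proper_filter a) _ _ _ _ F_a).
near=> s; have as_ : a < s by near: s; exact: nbhs_right_gt.
have sb : s < b by near: s; exact: nbhs_right_lt.
rewrite -GF//.
by apply: dfun_nd; apply: (le_trans ta); exact: ltW.
Unshelve. all: by end_near. Qed.

Lemma profile_after t : b <= t -> G t = 1.
Proof.
move=> bt; apply/eqP; rewrite eq_le dfun_le1 /=.
apply: (@cvgr_to_le _ _ (at_left_proper_filter b) _ _ _ _ F_b).
near=> s; have sb : s < b by near: s; exact: nbhs_left_lt.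
have as_ : a < s by near: s; exact: nbhs_left_gt.
rewrite -GF//.
by apply: dfun_nd; apply: le_trans bt; exact: ltW.
Unshelve. all: by end_near. Qed.

Let q (r : R) : R := (kap (clamp (G r)))^-1.

Let qE r : q r = (kap (G r))^-1.
Proof. by rewrite /q clampE// dfun_ge0 dfun_le1. Qed.

Let q0 r : 0 <= q r.
Proof.
by rewrite invr_ge0 ltW// (lt_le_trans k0)//; have /andP[] := kapkK (clamp01 (G r)).
Qed.

Let mq (D : set R) : measurable_fun D q.
Proof.
apply: measurable_funTS; apply: (measurableT_comp measurable_curvature_inv).
by apply: nondecreasing_measurable => // s t; exact: dfun_nd.
Qed.

Let G_int t : a <= t -> t < b -> (G t)%:E = (\int[lam]_(s in `]a, t]) (q s)%:E)%E.
Proof.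
rewrite le_eqVlt => /predU1P[<- _|at_ tb].
  by rewrite set_itvoc0 integral_set0 profile_before.
rewrite GF// F_eq ?in_itv/= ?at_//; apply: eq_integral => s; rewrite inE/= in_itv/= => /andP[as_ st].
by rewrite qE GF// (le_lt_trans st tb).
Qed.

Let increment_interior s t (m M : R) : a <= s -> s <= t -> t < b ->
  (forall r, s <= r <= t -> m <= (kap (G r))^-1 <= M) ->
  m * (t - s) <= G t - G s <= M * (t - s).
Proof.
move=> as_ st tb mM.
have sb : s < b by exact: le_lt_trans tb.
have mq' (D : set R) : measurable_fun (D : set (measurableTypeR R)) (EFin \o q).
  by apply/measurable_EFinP; exact: mq.
have GI : ((G t)%:E = (G s)%:E + \int[lam]_(r in `]s, t]) (q r)%:E)%E.
  rewrite !G_int//; last exact: le_trans st.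
  rewrite -ge0_integral_setU//=.
  - by rewrite -itv_bndbnd_setU// bnd_simp.
  - by move=> r _; rewrite lee_fin.
  - apply/disj_setPS => r /= []; rewrite !in_itv/= => /andP[_ rs] /andP[sr _].
    by move: (lt_le_trans sr rs); rewrite ltxx.
have E : (\int[lam]_(r in `]s, t]) (q r)%:E = (G t - G s)%:E)%E.
  by rewrite EFinB GI addrAC subee// add0e.
have len : lam `]s, t]%classic = (t - s)%:E by exact: lebesgue_measure_segment.
have cst (c : R) : (\int[lam]_(r in `]s, t]) c%:E = (c * (t - s))%:E)%E.
  by rewrite integral_cst//= len.
apply/andP; split.
  have [m0|m0] := leP 0 m; last first.
    by apply: (@le_trans _ _ 0); [rewrite mulr_le0_ge0 ?subr_ge0// ltW|rewrite subr_ge0 dfun_nd].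
  rewrite -lee_fin -E -cst; apply: ge0_le_integral => //.
  move=> r; rewrite /= in_itv/= => /andP[sr rt]; rewrite lee_fin qE.
  by have := mM r; rewrite (ltW sr) rt => /(_ isT)/andP[].
rewrite -lee_fin -E -cst; apply: ge0_le_integral => //.
- by move=> r _; rewrite lee_fin.
- move=> r; rewrite /= in_itv/= => /andP[sr rt]; rewrite lee_fin qE.
  by have := mM r; rewrite (ltW sr) rt => /(_ isT)/andP[].
Qed.

(** The increments of [G] are integrals of [1 / kap \o G].  Arbitrary bounds [m] and
    [M] for this integrand give the global Lipschitz estimates as well as, on short
    intervals, the quality of the tangent line. *)
Lemma increment_bounds s t (m M : R) : a <= s -> s <= t -> t <= b ->
  (forall r, s <= r <= t -> m <= (kap (G r))^-1 <= M) ->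
  m * (t - s) <= G t - G s <= M * (t - s).
Proof.
move=> as_ st; rewrite le_eqVlt => /predU1P[tb|tb] mM; last exact: increment_interior.
subst t.
have [->|sb] := eqVneq s b; first by rewrite !subrr !mulr0 lexx.
have {}sb : s < b by rewrite lt_neqAle sb st.
have H t' : s < t' -> t' < b -> m * (t' - s) <= G t' - G s <= M * (t' - s).
  move=> st' t'b; apply: increment_interior => //; first exact: ltW.
  by move=> r /andP[sr rt]; apply: mM; rewrite sr (le_trans rt (ltW t'b)).
have M0 : 0 <= M.
  by have := mM b; rewrite lexx (ltW sb) => /(_ isT)/andP[_]; apply: le_trans; rewrite -qE.
apply/andP; split.
  have cm : m * (t' - s) @[t' --> b^'-] --> m * (b - s).
    apply: cvg_at_left_filter; apply: cvgM; first exact: cvg_cst.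
    by apply: cvgB; [exact: cvg_id|exact: cvg_cst].
  apply: (@cvgr_to_le _ _ (at_left_proper_filter b) _ _ _ _ cm).
  near=> t'; have t'b : t' < b by near: t'; exact: nbhs_left_lt.
  have st' : s < t' by near: t'; exact: nbhs_left_gt.
  have /andP[h _] := H _ st' t'b; apply: le_trans h _.
  by rewrite lerD2r; apply: dfun_nd; exact: ltW.
rewrite lerBlDr profile_after//; apply: (@cvgr_to_le _ _ (at_left_proper_filter b) _ _ _ _ F_b).
near=> t'; have t'b : t' < b by near: t'; exact: nbhs_left_lt.
have st' : s < t' by near: t'; exact: nbhs_left_gt.
have at' : a < t' by exact: le_lt_trans st'.
rewrite -GF//.
have /andP[_ h] := H _ st' t'b; rewrite -lerBlDr; apply: le_trans h _.
by rewrite ler_wpM2l// lerD2r ltW.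
Unshelve. all: by end_near. Qed.

Lemma measurable_profile_curvature : measurable_fun setT (fun t => kap (G t)).
Proof.
rewrite (_ : (fun t => _) = (fun u => kap (clamp u)) \o G); last first.
  by apply/funext => t /=; rewrite clampE// dfun_ge0 dfun_le1.
apply: measurableT_comp; first exact: continuous_measurable_fun.
by apply: nondecreasing_measurable => // s t; exact: dfun_nd.
Qed.

Let G01 t : 0 <= G t <= 1.
Proof. by rewrite dfun_ge0 dfun_le1. Qed.

Lemma profile_bounds s t : a <= s -> s <= t -> t <= b ->
  (t - s) / K <= G t - G s <= (t - s) / k.
Proof.
move=> as_ st tb; rewrite ![(t - s) / _]mulrC; apply: increment_bounds => // r _.
have /andP[h1 h2] := kapkK (G01 r); have kp : 0 < kap (G r) by exact: lt_le_trans h1.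
by rewrite !lef_pV2 ?posrE ?h1 ?h2// (lt_le_trans kp).
Qed.

Lemma profile_lipschitz s t : `|G s - G t| <= k^-1 * `|s - t|.
Proof.
wlog st : s t / s <= t.
  by move=> h; case: (leP s t) => st; [exact: h|rewrite distrC (distrC s) h// ltW].
have -> : `|s - t| = t - s by rewrite distrC ger0_norm// subr_ge0.
rewrite distrC ger0_norm ?subr_ge0 ?dfun_nd// mulrC.
have ik : 0 < k^-1 by rewrite invr_gt0.
have ts0 : 0 <= (t - s) / k by rewrite mulr_ge0 ?subr_ge0// ltW.
have [ta|at_] := leP t a; first by rewrite !profile_before ?subrr// (le_trans st).
have [bs|sb] := leP b s; first by rewrite !profile_after ?subrr// (le_trans bs).
have -> : G t = G (Num.min t b).
  by case: (leP t b) => [//|/ltW bt]; rewrite !profile_after.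
have -> : G s = G (Num.max s a).
  by case: (leP a s) => [as_|/ltW sa]; rewrite // !profile_before.
have h1 : a <= Num.max s a by rewrite le_max lexx orbT.
have h2 : Num.max s a <= Num.min t b by rewrite ge_max !le_min st (ltW sb) (ltW at_) ltW.
have h3 : Num.min t b <= b by rewrite ge_min lexx orbT.
have /andP[_ h] := profile_bounds h1 h2 h3; apply: le_trans h _; rewrite ler_pM2r//.
by apply: lerB; rewrite ?ge_min ?le_max lexx.
Qed.

Lemma profile_curvature_lipschitz s t : `|kap (G s) - kap (G t)| <= L / k * `|s - t|.
Proof.
apply: le_trans (kapL (G01 s) (G01 t)) _; rewrite -mulrA ler_wpM2l//.
exact: profile_lipschitz.
Qed.
(** Over a length [h] the function [G] varies by at most [h / k], hence its derivative
    [1 / kap \o G] by at most [L / k ^+ 3 * h]. *)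
Lemma profile_tangent s t : a <= s <= b -> a <= t <= b ->
  `|G t - G s - (t - s) / kap (G s)| <= L / k ^+ 3 * (t - s) ^+ 2.
Proof.
have Glip x y : a <= x -> x <= y -> y <= b -> `|G x - G y| <= (y - x) / k.
  by move=> ax xy yb; rewrite distrC ger0_norm ?subr_ge0 ?dfun_nd//; case/andP: (profile_bounds ax xy yb).
have qlip u v : 0 <= u <= 1 -> 0 <= v <= 1 -> `|(kap u)^-1 - (kap v)^-1| <= L / k ^+ 2 * `|u - v|.
  move=> u01 v01; have /andP[ku _] := kapkK u01; have /andP[kv _] := kapkK v01.
  have ku0 : 0 < kap u by exact: lt_le_trans ku.
  have kv0 : 0 < kap v by exact: lt_le_trans kv.
  have -> : (kap u)^-1 - (kap v)^-1 = (kap v - kap u) * ((kap u)^-1 * (kap v)^-1).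
    by field; rewrite !gt_eqF.
  have iu0 : 0 <= (kap u)^-1 by rewrite invr_ge0 ltW.
  have iv0 : 0 <= (kap v)^-1 by rewrite invr_ge0 ltW.
  have iuk : (kap u)^-1 <= k^-1 by rewrite lef_pV2.
  have ivk : (kap v)^-1 <= k^-1 by rewrite lef_pV2.
  rewrite normrM (ger0_norm (mulr_ge0 iu0 iv0)).
  have -> : L / k ^+ 2 * `|u - v| = L * `|v - u| * (k^-1 * k^-1).
    by rewrite (distrC u); field; rewrite gt_eqF.
  apply: ler_pM => //; [exact: mulr_ge0|exact: kapL|exact: ler_pM].
have near x y r : a <= x -> y <= b -> x <= r <= y ->
    forall p, x <= p <= y -> `|(kap (G r))^-1 - (kap (G p))^-1| <= L / k ^+ 3 * (y - x).
  move=> ax yb /andP[xr ry] p /andP[xp py]; apply: le_trans (qlip _ _ (G01 _) (G01 _)) _.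
  have -> : L / k ^+ 3 * (y - x) = L / k ^+ 2 * ((y - x) / k) by field; rewrite gt_eqF.
  apply: ler_wpM2l; first by apply: divr_ge0 => //; apply: exprn_ge0; exact: ltW.
  have h : forall x' y', x <= x' -> x' <= y' -> y' <= y -> `|G x' - G y'| <= (y - x) / k.
    move=> x' y' xx xy yy; apply: le_trans (Glip _ _ _ _ _) _ => //; [exact: le_trans xx|exact: le_trans yb|].
    by rewrite ler_pM2r ?invr_gt0// lerB.
  by case: (leP r p) => rp; [exact: h|rewrite distrC; apply: h => //; exact: ltW].
move=> /andP[as_ sb] /andP[at_ tb].
have [st|ts] := leP s t.
  have := @increment_bounds s t ((kap (G s))^-1 - L / k ^+ 3 * (t - s))
    ((kap (G s))^-1 + L / k ^+ 3 * (t - s)) as_ st tb.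
  case/(_ _)/andP; last by move=> h1 h2; rewrite ler_norml; apply/andP; split; lra.
  move=> r srt; have := near s t r as_ tb srt s; rewrite lexx st => /(_ isT).
  by rewrite ler_norml => /andP[h1 h2]; apply/andP; split; lra.
have ts' := ltW ts.
have := @increment_bounds t s ((kap (G s))^-1 - L / k ^+ 3 * (s - t))
    ((kap (G s))^-1 + L / k ^+ 3 * (s - t)) at_ ts' sb.
case/(_ _)/andP; last by move=> h1 h2; rewrite ler_norml; apply/andP; split; lra.
move=> r srt; have := near t s r at_ sb srt s; rewrite lexx ts' => /(_ isT).
by rewrite ler_norml => /andP[h1 h2]; apply/andP; split; lra.
Qed.

End profile.
(** * The rescaled transport cost is a quadratic functional of the empirical process *)

Section integral_of_process.
Context {d} {T : measurableType d} {R : realType} (P : probability T R).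
Context (a b : R) (H : T -> R -> R) (M D : R).
Local Notation lam := (@lebesgue_measure R).
Hypothesis ab : a <= b.
Hypothesis mH : measurable_fun setT (fun p : T * measurableTypeR R => H p.1 p.2).
Hypothesis H0 : forall w s, 0 <= H w s.
Hypothesis HM : forall w s, H w s <= M * \1_(`]a, b]%classic : set R) s.
Hypothesis HD : forall s, \int[P]_w H w s <= D.

Let int_ab (c : R) : 0 <= c -> (\int[lam]_s (c * \1_(`]a, b]%classic : set R) s)%:E = (c * (b - a))%:E)%E.
Proof. by move=> c0; apply: integral_cst_indic => //; exact: lebesgue_measure_segment. Qed.

Let H_out w s : s \notin `]a, b] -> H w s = 0.
Proof.
move=> sab; apply/eqP; rewrite eq_le H0 andbT; apply: le_trans (HM w s) _.
by rewrite indicE mem_setE (negbTE sab) mulr0.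
Qed.

Let total w : R := \int[lam]_s H w s.

Let bound : R := `|M| * (b - a).

Let mEH : measurable_fun setT (fun p : T * measurableTypeR R => (H p.1 p.2)%:E).
Proof. exact/measurable_EFinP. Qed.

Let integral_le w : (\int[lam]_s (H w s)%:E <= bound%:E)%E.
Proof.
rewrite -int_ab//; apply: ge0_integral_mono => s; first by rewrite lee_fin.
rewrite lee_fin; apply: le_trans (HM w s) _; rewrite ler_wpM2r//; last exact: ler_norm.
Qed.

Lemma integral_process_fin w : (\int[lam]_s (H w s)%:E = (total w)%:E)%E.
Proof.
rewrite /total /Rintegral fineK// ge0_fin_numE; first exact: le_lt_trans (integral_le w) (ltry _).
by apply: integral_ge0 => s _; rewrite lee_fin.
Qed.

Lemma integrable_integral_process : P.-integrable setT (EFin \o total).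
Proof.
apply: (@bounded_integrable _ _ _ P bound) => [|w].
  apply/measurable_EFinP; rewrite (_ : EFin \o total = fun w => (\int[lam]_s (H w s)%:E)%E); last first.
    by apply/funext => w; rewrite integral_process_fin.
  exact: (@measurable_fun_fubini_tonelli_F _ _ _ _ _ lam (fun p => (H p.1 p.2)%:E) mEH (fun p => H0 p.1 p.2)).
have t0 : 0 <= total w.
  by rewrite -lee_fin -integral_process_fin; apply: integral_ge0 => s _; rewrite lee_fin.
by rewrite ger0_norm// -lee_fin -integral_process_fin.
Qed.

(** Tonelli's theorem; the pathwise bound [M] may be as large as a power of the sample
    size, while [D] bounds the mean. *)
Lemma expectation_integral_process : \int[P]_w total w <= D * (b - a).
Proof.
have mHs s : measurable_fun setT (fun w => H w s).
  exact: (measurableT_comp mH (pair2_measurable s)).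
have iH s : P.-integrable setT (EFin \o (fun w => H w s)).
  apply: (@bounded_integrable _ _ _ P `|M|) => // w.
  rewrite ger0_norm//; apply: le_trans (HM w s) _; rewrite indicE; case: (_ \in _).
    by rewrite mulr1 ler_norm.
  by rewrite mulr0.
have D0 : 0 <= D.
  by apply: le_trans (HD a); apply: Rintegral_ge0 => w _.
rewrite -lee_fin (EFin_Rintegral integrable_integral_process).
under eq_integral do rewrite -integral_process_fin.
rewrite (@fubini_tonelli _ _ _ _ _ P lam (fun p => (H p.1 p.2)%:E) mEH (fun p => H0 p.1 p.2))/=.
rewrite -int_ab//; apply: ge0_integral_mono => s; first by apply: integral_ge0 => w _; rewrite lee_fin.
have [sab|sab] := boolP (s \in `]a, b]); last first.
  rewrite integral0_eq ?lee_fin ?mulr_ge0// ?indicE// => w _; by rewrite H_out.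
by rewrite indicE mem_setE sab mulr1 -(EFin_Rintegral (iH s)) lee_fin.
Qed.

End integral_of_process.
(** * Discretization of the quadratic functional *)

Section uniform_grid.
Context {R : realType} (a b : R) (m : nat).
Local Notation lam := (@lebesgue_measure R).
Hypothesis ltab : a < b.

Definition step : R := (b - a) / m.+1%:R.

Definition grid (i : nat) : R := a + i%:R * step.

Lemma step_gt0 : 0 < step.
Proof. by rewrite divr_gt0// subr_gt0. Qed.

Lemma grid_le i j : (i <= j)%N -> grid i <= grid j.
Proof. by move=> ij; rewrite lerD2l ler_wpM2r ?ler_nat// ltW// step_gt0. Qed.

Lemma grid0 : grid 0 = a.
Proof. by rewrite /grid mul0r addr0. Qed.

Lemma grid_last : grid m.+1 = b.
Proof. by rewrite /grid /step mulrC divfK ?pnatr_eq0//; ring. Qed.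

Lemma gridS i : grid i.+1 - grid i = step.
Proof. by rewrite /grid -natr1; ring. Qed.

Definition cell (i : nat) : set R := `]grid i, grid i.+1]%classic.

Lemma cell_sub (i : 'I_m.+1) : cell i `<=` `]a, b]%classic.
Proof.
move=> s; rewrite /cell /= !in_itv/= => /andP[is_ si]; apply/andP; split.
  by apply: le_lt_trans is_; rewrite -grid0 grid_le.
by apply: le_trans si _; rewrite -grid_last grid_le.
Qed.

Lemma cell_find s : s \in `]a, b] ->
  exists j : 'I_m.+1, [/\ 0 <= grid j.+1 - s <= step, a <= grid j.+1 <= b &
    forall u : 'I_m.+1 -> R, \sum_(i < m.+1) \1_(cell i) s * u i = u j].
Proof.
rewrite in_itv/= => /andP[as_ sb].
have ex : exists i, s <= grid i by exists m.+1; rewrite grid_last.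
case: (ex_minnP ex) => -[|j]; first by rewrite grid0 leNgt as_.
move=> sj mn.
have js : grid j < s by rewrite ltNge; apply/negP => /mn; rewrite ltnn.
have jm : (j < m.+1)%N by apply: mn; rewrite grid_last.
exists (Ordinal jm) => /=; split.
- have := gridS j => h; apply/andP; split; lra.
- by rewrite -{1}grid0 -{1}grid_last !grid_le.
move=> u; rewrite (bigD1 (Ordinal jm))//= big1 ?addr0.
  by rewrite indicE mem_setE in_itv/= js sj mul1r.
move=> i ij; rewrite indicE mem_setE in_itv/=.
case: (ltngtP i j) => h.
- by rewrite [X in _ && X]leNgt (le_lt_trans (grid_le h) js) andbF mul0r.
- by rewrite ltNge (le_trans sj (grid_le h)) mul0r.
- by move/eqP: ij; case; exact: val_inj.
Qed.

Lemma integral_step (u : 'I_m.+1 -> R) : (forall i, 0 <= u i) ->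
  (\int[lam]_s (\sum_(i < m.+1) \1_(cell i) s * u i)%:E = (\sum_(i < m.+1) step * u i)%:E)%E.
Proof.
move=> u0; under eq_integral do rewrite -sumEFin.
rewrite ge0_integral_sum//; last 2 first.
- move=> i; apply/measurable_EFinP; apply: measurable_funM => //; apply: measurable_indic; exact: measurable_itv.
- by move=> i s _; rewrite lee_fin mulr_ge0// indicE.
rewrite -sumEFin; apply: eq_bigr => i _.
under eq_integral do rewrite mulrC.
rewrite (@integral_cst_indic _ _ _ step) ?[step * _]mulrC//; first exact: measurable_itv.
by rewrite lebesgue_measure_segment ?gridS ?grid_le.
Qed.

End uniform_grid.

Section wasserstein_approximation.
Context {R : realType} {d : measure_display} {T : measurableType d}
  {P : probability T R} {n' : nat} (X : 'I_n'.+1 -> {RV P >-> R}) (mu : probability R R).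
Hypothesis Xiid : iid X mu.
Context (kap : R -> R) (a b K C L L' : R).
Local Notation lam := (@lebesgue_measure R).
Local Notation n := n'.+1.
Local Notation G := (dfun mu).
Local Notation emp := (empirical_process X mu).
Hypothesis ltab : a < b.
Hypothesis C0 : 0 <= C.
Hypothesis kapK : forall u, 0 <= u <= 1 -> 0 < kap u <= K.
Hypothesis Ga : forall t, t <= a -> G t = 0.
Hypothesis Gb : forall t, b <= t -> G t = 1.
Hypothesis G_expand : forall s t, a <= s -> s <= t -> t <= b -> (t - s) / K <= G t - G s.
Hypothesis G_tangent : forall s t, a <= s <= b -> a <= t <= b ->
  `|G t - G s - (t - s) / kap (G s)| <= C * (t - s) ^+ 2.
Hypothesis G_lip : forall s t, a <= s <= b -> a <= t <= b -> `|G s - G t| <= L * `|s - t|.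
Hypothesis kapG_lip : forall s t, a <= s <= b -> a <= t <= b ->
  `|kap (G s) - kap (G t)| <= L' * `|s - t|.
Hypothesis mkG : measurable_fun setT (fun s => kap (G s)).
Context (m : nat) (e : R).
Hypothesis e0 : 0 < e.

Local Notation grid := (grid a b m).
Local Notation cell := (cell a b m).
Local Notation step := (step a b m).

Definition quadratic_sum (w : T) : R :=
  \sum_(j < m.+1) step * kap (G (grid j.+1)) * emp (grid j.+1) w ^+ 2.

Let A : R := 2 * C * K ^+ 3 / Num.sqrt n%:R.

Let ind (s : R) : R := \1_(`]a, b]%classic : set R) s.

(** The integrand of the error: the cubic remainder of the transport cost at [s],
    multiplied by the sample size, and the effect of moving [s] to the right end of
    its cell. *)
Let H (w : T) (s : R) : R := A * (`|emp s w| ^+ 3 * ind s) +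
  `|kap (G s) * emp s w ^+ 2 * ind s -
    \sum_(j < m.+1) \1_(cell j) s * (kap (G (grid j.+1)) * emp (grid j.+1) w ^+ 2)|.

Let G01 t : 0 <= G t <= 1. Proof. by rewrite dfun_ge0 dfun_le1. Qed.

Let kap0 t : 0 <= kap (G t).
Proof. by have /andP[/ltW] := kapK (G01 t). Qed.

Let kapGK t : kap (G t) <= K.
Proof. by have /andP[] := kapK (G01 t). Qed.

Let K0 : 0 < K.
Proof. by have /andP[] := kapK (G01 a) => /lt_le_trans h /h. Qed.

Let A0 : 0 <= A.
Proof. by rewrite /A divr_ge0// mulr_ge0 ?exprn_ge0 ?mulr_ge0 ?(ltW K0). Qed.

Let sn0 : 0 < Num.sqrt n%:R :> R.
Proof. by rewrite sqrtr_gt0 ltr0n. Qed.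

Let sn2 : Num.sqrt n%:R ^+ 2 = n%:R :> R.
Proof. by rewrite sqr_sqrtr. Qed.

Let v (s : R) (w : T) : R := n%:R^-1 * \sum_i le_indic s (X i w).

Let v01 s w : 0 <= v s w <= 1.
Proof.
apply/andP; split.
  by rewrite mulr_ge0// sumr_ge0// => i _; case/andP: (le_indic_bounds s (X i w)).
rewrite /v mulrC ler_pdivrMr ?ltr0n// mul1r -[leRHS]mulr1 -[n in leRHS]card_ord mulr_natl -sumr_const.
by apply: ler_sum => i _; case/andP: (le_indic_bounds s (X i w)).
Qed.

Let empE s w : emp s w = Num.sqrt n%:R * (v s w - G s).
Proof.
rewrite /empirical_process sumrB sumr_const card_ord /v mulrBr.
have -> : G s *+ n = G s * n%:R by rewrite mulr_natr.
rewrite !mulrBr; set S := \sum_ _ _.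
have -> : Num.sqrt n%:R * (n%:R^-1 * S) = (Num.sqrt n%:R)^-1 * S.
  by rewrite -[in n%:R^-1]sn2; field; rewrite gt_eqF.
congr (_ - _); rewrite -{2}sn2; field; by rewrite gt_eqF.
Qed.

Let emp_le s w : `|emp s w| <= Num.sqrt n%:R.
Proof.
rewrite empE normrM (gtr0_norm sn0) -[leRHS]mulr1 ler_pM2l//.
by have /andP[? ?] := v01 s w; have /andP[? ?] := G01 s; rewrite ler_norml; apply/andP; split; lra.
Qed.

Let H0 w s : 0 <= H w s.
Proof.
by apply: addr_ge0 => //; apply: mulr_ge0 => //; apply: mulr_ge0; rewrite ?exprn_ge0// /ind indicE.
Qed.

Let cell_out (u : 'I_m.+1 -> R) s : s \notin `]a, b] -> \sum_(j < m.+1) \1_(cell j) s * u j = 0.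
Proof.
move=> sab; rewrite big1// => j _; rewrite indicE; case: (boolP (_ \in _)); rewrite ?mul0r//.
by rewrite inE => /(cell_sub ltab) /=; rewrite (negbTE sab).
Qed.

Let H_in s : s \in `]a, b] -> exists x, [/\ `|s - x| <= step, a <= s <= b, a <= x <= b &
  forall w, H w s = A * `|emp s w| ^+ 3 + `|kap (G s) * emp s w ^+ 2 - kap (G x) * emp x w ^+ 2|].
Proof.
move=> sab; have [j [/andP[h1 h2] h3 h4]] := cell_find m ltab sab.
exists (grid j.+1); split => //.
- by rewrite distrC ger0_norm.
- by move: sab; rewrite in_itv/= => /andP[/ltW -> ->].
- by move=> w; rewrite /H h4 /ind indicE mem_setE sab !mulr1.
Qed.

Let H_out w s : s \notin `]a, b] -> H w s = 0.
Proof.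
by move=> sab; rewrite /H cell_out// /ind indicE mem_setE (negbTE sab) !mulr0 subrr normr0 addr0.
Qed.

Let M : R := A * Num.sqrt n%:R ^+ 3 + (K * n%:R + K * n%:R).

Let HM w s : H w s <= M * \1_(`]a, b]%classic : set R) s.
Proof.
have [sab|sab] := boolP (s \in `]a, b]); last first.
  by rewrite H_out// indicE mem_setE (negbTE sab) mulr0.
rewrite indicE mem_setE sab mulr1.
have [x [_ _ _ ->]] := H_in sab.
have h y : `|kap (G y) * emp y w ^+ 2| <= K * n%:R.
  rewrite normrM (ger0_norm (kap0 y)) normrX -sn2; apply: ler_pM => //.
  by rewrite lerXn2r ?nnegrE// ltW.
apply: lerD; first by apply: ler_wpM2l => //; rewrite lerXn2r ?nnegrE// ltW.
by apply: le_trans (ler_normB _ _) _; exact: lerD.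
Qed.

Let mEmp : measurable_fun setT (fun p : T * measurableTypeR R => emp p.2 p.1).
Proof.
apply: measurable_funM => //; apply: measurable_sum => i; apply: measurable_funB.
  have mS : measurable [set p : T * measurableTypeR R | (X i p.1 <= p.2)%R].
    have := @measurable_fun_le _ (T * measurableTypeR R)%type R setT (fun p => X i p.1) (fun p => p.2) measurableT.
    rewrite setTI; apply; last exact: measurable_snd.
    by apply: measurableT_comp => //; exact: measurable_fst.
  rewrite (_ : (fun p => _) = \1_[set p : T * measurableTypeR R | (X i p.1 <= p.2)%R]).
    exact: measurable_indic.
  by apply/funext => p; rewrite /le_indic indicE mem_setE.
apply: (measurableT_comp _ measurable_snd).
by apply: nondecreasing_measurable => // s t; exact: dfun_nd.
Qed.

Let mH : measurable_fun setT (fun p : T * measurableTypeR R => H p.1 p.2).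
Proof.
have mi (S : set R) : measurable S -> measurable_fun setT (fun p : T * measurableTypeR R => \1_S p.2 : R).
  by move=> mS; apply: (measurableT_comp _ measurable_snd); exact: measurable_indic.
have mx x : measurable_fun setT (fun p : T * measurableTypeR R => emp x p.1).
  by apply: (measurableT_comp _ measurable_fst); exact: measurable_empirical_process.
apply: measurable_funD.
  apply: measurable_funM => //; apply: measurable_funM; last by apply: mi; exact: measurable_itv.
  by apply: measurable_funX; exact: measurableT_comp.
apply: measurableT_comp => //; apply: measurable_funB.
  apply: measurable_funM; last by apply: mi; exact: measurable_itv.
  apply: measurable_funM; last exact: measurable_funX.
  have mkG' : measurable_fun (setT : set (measurableTypeR R)) (fun s => kap (G s)) by exact: mkG.
  exact: (measurableT_comp mkG' measurable_snd).
apply: measurable_sum => j; apply: measurable_funM; first by apply: mi; exact: measurable_itv.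
by apply: measurable_funM => //; exact: measurable_funX.
Qed.

(** The factor [5 / 2] bounds the third absolute moment of the empirical process by
    half the sum of its second and fourth moments.  The other terms pay for replacing
    [s] by a grid point at distance at most [step]: in [kap \o G], and in the square
    of the process through [2 * x * y <= x ^+ 2 / e + e * y ^+ 2]. *)
Definition approximation_error : R :=
  5 / 2 * A + (L' * step + K * (L * step / (2 * e) + 2 * e)).

Let L0 : 0 <= L /\ 0 <= L'.
Proof.
have ba : 0 < `|a - b| by rewrite normr_gt0 subr_eq0 lt_eqF.
have ab' := ltW ltab.
split; rewrite -(pmulr_lge0 _ ba).
  by apply: le_trans (@G_lip a b _ _); rewrite ?lexx ?ab'.
by apply: le_trans (@kapG_lip a b _ _); rewrite ?lexx ?ab'.
Qed.

Let error_ge0 : 0 <= approximation_error.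
Proof.
have [L0' L0''] := L0; have s0 := ltW (step_gt0 m ltab).
have e2 : 0 <= 2 * e by rewrite mulr_ge0// ltW.
apply: addr_ge0; first by rewrite mulr_ge0.
apply: addr_ge0; first exact: mulr_ge0.
apply: mulr_ge0; first exact: ltW.
by apply: addr_ge0 => //; apply: divr_ge0 => //; exact: mulr_ge0.
Qed.

Let HD s : \int[P]_w H w s <= approximation_error.
Proof.
have [sab|sab] := boolP (s \in `]a, b]); last first.
  under eq_Rintegral do rewrite H_out//.
  by rewrite Rintegral_probability_cst.
have [L0' L0''] := L0; have st0 := ltW (step_gt0 m ltab).
have [x [sx sab' h3 HE]] := H_in sab.
pose A1 := A / 2 + L' * step + K * e.
pose A3 := K / (2 * e).
pose rhs w := A1 * emp s w ^+ 2 + A / 2 * emp s w ^+ 4 + (A3 * (emp s w - emp x w) ^+ 2 + K * e * emp x w ^+ 2).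
have Hle w : H w s <= rhs w.
  rewrite HE /rhs; set y := emp s w; set z := emp x w.
  have c1 : `|y| ^+ 3 <= (y ^+ 2 + y ^+ 4) / 2.
    rewrite -(real_normK (num_real y)) (_ : y ^+ 4 = `|y| ^+ 4); last by rewrite -normrX ger0_norm// (exprM y 2 2) sqr_ge0.
    have := normr_ge0 y; set t := `|y| => t0; have := sqr_ge0 (t * (t - 1)); nra.
  have c2 : `|kap (G s) * y ^+ 2 - kap (G x) * z ^+ 2| <=
      L' * step * y ^+ 2 + K * `|y ^+ 2 - z ^+ 2|.
    have -> : kap (G s) * y ^+ 2 - kap (G x) * z ^+ 2 =
      (kap (G s) - kap (G x)) * y ^+ 2 + kap (G x) * (y ^+ 2 - z ^+ 2) by ring.
    apply: le_trans (ler_normD _ _) _; rewrite !(normrM _ (_ - _)) (normrM (_ - _) (y ^+ 2)).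
    apply: lerD; last by rewrite (ger0_norm (kap0 x)) ler_wpM2r.
    rewrite (ger0_norm (sqr_ge0 y)) ler_wpM2r ?sqr_ge0//.
    by apply: le_trans (kapG_lip sab' h3) _; rewrite ler_wpM2l.
  have c3 : `|y ^+ 2 - z ^+ 2| <= (y - z) ^+ 2 / (2 * e) + e * (y ^+ 2 + z ^+ 2).
    have e2 : 0 < 2 * e by rewrite mulr_gt0.
    have key r : r = y + z \/ r = - (y + z) -> (y - z) * r <= (y - z) ^+ 2 / (2 * e) + e * (y ^+ 2 + z ^+ 2).
      move=> hr; rewrite -subr_ge0.
      have -> : (y - z) ^+ 2 / (2 * e) + e * (y ^+ 2 + z ^+ 2) - (y - z) * r =
        ((y - z) - e * r) ^+ 2 / (2 * e) + e / 2 * (2 * (y ^+ 2 + z ^+ 2) - r ^+ 2) by field; rewrite gt_eqF.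
      apply: addr_ge0; first by rewrite divr_ge0 ?sqr_ge0// ltW.
      apply: mulr_ge0; first by rewrite divr_ge0// ltW.
      by have := sqr_ge0 (y - z); case: hr => ->; nra.
    rewrite ler_norml; apply/andP; split.
      have := key _ (or_intror erefl); rewrite mulrN -lerNl (_ : y ^+ 2 - z ^+ 2 = (y - z) * (y + z)) => [//|]; ring.
    have := key _ (or_introl erefl); rewrite (_ : y ^+ 2 - z ^+ 2 = (y - z) * (y + z)) => [//|]; ring.
  have d1 := ler_wpM2l A0 c1; have d3 := ler_wpM2l (ltW K0) c3.
  apply: le_trans (lerD d1 (le_trans c2 (lerD (lexx _) d3))) _.
  rewrite le_eqVlt; apply/orP; left; apply/eqP; rewrite /A1 /A3; field; by rewrite gt_eqF.
have i2 y := integrable_empirical_processX Xiid 2 y.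
have i4 y := integrable_empirical_processX Xiid 4 y.
have [i3 e3] := expectation_empirical_process_dist Xiid s x.
have iH : P.-integrable setT (EFin \o (fun w => H w s)).
  apply: (@bounded_integrable _ _ _ P `|M|) => [|w].
    exact: (measurableT_comp mH (pair2_measurable s)).
  rewrite ger0_norm//; apply: le_trans (HM w s) _; rewrite indicE; case: (_ \in _).
    by rewrite mulr1 ler_norm.
  by rewrite mulr0.
have ir : P.-integrable setT (EFin \o rhs).
  by do 2 (apply: integrable_addr); try apply: integrable_addr; apply: integrable_mulrl.
apply: le_trans (le_Rintegral _ iH ir _) _ => //.
rewrite /rhs; do 3 (rewrite RintegralD//; try (by do 2?(apply: integrable_addr); apply: integrable_mulrl)).
rewrite !RintegralZl//.
have := expectation_empirical_process2 Xiid s; have := expectation_empirical_process4 Xiid s.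
have := expectation_empirical_process2 Xiid x; move: e3.
set E3 := \int[P]_w _; set E2x := \int[P]_w _; set E4 := \int[P]_w _; set E2 := \int[P]_w _.
move=> e3 e2x e4 e2.
have e3' : E3 <= L * step.
  by apply: le_trans e3 _; apply: le_trans (G_lip sab' h3) _; rewrite ler_wpM2l.
have A20 : 0 <= A / 2 by rewrite divr_ge0.
have Ke0 : 0 <= K * e by rewrite mulr_ge0 ?(ltW K0) ?(ltW e0).
have A10 : 0 <= A1 by rewrite /A1; do 2 (apply: addr_ge0 => //); exact: mulr_ge0.
have A30 : 0 <= A3 by rewrite /A3 divr_ge0 ?mulr_ge0 ?(ltW K0) ?(ltW e0).
have b1 := ler_wpM2l A10 e2; have b2 := ler_wpM2l A20 e4.
have b3 := ler_wpM2l A30 e3'; have b4 := ler_wpM2l Ke0 e2x.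
apply: le_trans (lerD (lerD b1 b2) (lerD b3 b4)) _.
rewrite le_eqVlt; apply/orP; left; apply/eqP; rewrite /A1 /A3 /approximation_error; field; by rewrite gt_eqF.
Qed.

Let total w : R := \int[lam]_s H w s.

Let W w : \bar R := wasserstein2_sq (empirical_measure (fun i => X i w)) mu.

Let W0 w : (0 <= W w)%E.
Proof.
rewrite /W wasserstein2_sq_empirical; apply: integral_ge0 => s _; apply: integral_ge0 => t _.
by rewrite lee_fin mulr_ge0// /wgap; case: ifP => _; rewrite le_max lexx.
Qed.

(** When the sample lies in [`]a, b]], both distribution functions agree outside of
    this interval, and the local expansion can be integrated over [s]. *)
Lemma wasserstein_pathwise w : (forall i, X i w \in `]a, b]) ->
  W w \is a fin_num /\ `|n%:R * fine (W w) - quadratic_sum w| <= total w.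
Proof.
move=> Xab.
have n0 : 0 < n%:R :> R by rewrite ltr0n.
have in0 : 0 <= n%:R^-1 :> R by rewrite invr_ge0.
pose u (j : 'I_m.+1) := kap (G (grid j.+1)) * emp (grid j.+1) w ^+ 2.
have u0 j : 0 <= u j by rewrite mulr_ge0 ?sqr_ge0.
pose g s := n%:R^-1 * \sum_(j < m.+1) \1_(cell j) s * u j.
pose h s := n%:R^-1 * H w s.
have mcell (j : 'I_m.+1) : measurable_fun setT (\1_(cell j) : R -> R).
  by apply: measurable_indic; exact: measurable_itv.
have sum0 s : 0 <= \sum_(j < m.+1) \1_(cell j) s * u j.
  by apply: sumr_ge0 => j _; rewrite mulr_ge0// indicE.
have mS : measurable_fun setT (fun s : R => \sum_(j < m.+1) \1_(cell j) s * u j).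
  by apply: measurable_sum => j; exact: measurable_funM.
have mg : measurable_fun setT g by exact: measurable_funM.
have mHw : measurable_fun setT (H w) by exact: (measurableT_comp mH (pair1_measurable w)).
have mh : measurable_fun setT h by exact: measurable_funM.
have gE : (\int[lam]_s (g s)%:E = (n%:R^-1 * quadratic_sum w)%:E)%E.
  under eq_integral do rewrite EFinM.
  rewrite ge0_integralZl ?lee_fin//; last 2 first.
  - exact/measurable_EFinP.
  - by move=> s _; rewrite lee_fin.
  rewrite integral_step// EFinM; congr (_ * _%:E)%E.
  by apply: eq_bigr => j _; rewrite mulrA.
have hE : (\int[lam]_s (h s)%:E = (n%:R^-1 * total w)%:E)%E.
  under eq_integral do rewrite EFinM.
  rewrite ge0_integralZl ?lee_fin//; last 2 first.
  - exact/measurable_EFinP.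
  - by move=> s _; rewrite lee_fin.
  by rewrite EFinM (integral_process_fin (ltW ltab) H0 HM).
pose f s := (\int[lam]_t (2 * wgap G (v s w) s t)%:E)%E.
have f0 s : (0 <= f s)%E.
  apply: integral_ge0 => t _.
  by rewrite lee_fin mulr_ge0// /wgap; case: ifP => _; rewrite le_max lexx.
have fgh s : f s \is a fin_num /\ `|fine (f s) - g s| <= h s.
  have [sab|sab] := boolP (s \in `]a, b]); last first.
    have -> : f s = 0%E.
      apply: (@integral_wgap_out R G a b (@dfun_nd _ mu) Ga Gb).
      move: sab; rewrite in_itv/= negb_and -!leNgt -ltNge => /orP[sa|bs]; [left|right].
        split => //; rewrite /v big1 ?mulr0// => i _; rewrite /le_indic leNgt.
        have := Xab i; rewrite in_itv/= => /andP[aX _].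
        by rewrite (le_lt_trans sa aX).
      split; first exact: ltW.
      rewrite /v (eq_bigr (fun=> 1)) ?sumr_const ?card_ord ?mulVf ?gt_eqF// => i _.
      rewrite /le_indic; have := Xab i; rewrite in_itv/= => /andP[_ Xb].
      by rewrite (le_trans Xb (ltW bs)).
    by rewrite /g /h H_out// cell_out// !mulr0 subrr normr0.
  have sab' : a <= s <= b by move: sab; rewrite in_itv/= => /andP[/ltW -> ->].
  have [fn fle] := @integral_wgap R G kap a b K C C0 kapK (@dfun_nd _ mu) Ga Gb G_expand G_tangent s (v s w) sab' (v01 s w).
  split => //; rewrite /g /h /H /ind indicE mem_setE sab !mulr1.
  set S := \sum_(j < m.+1) _.
  have -> : fine (f s) - n%:R^-1 * S = (fine (f s) - kap (G s) * (v s w - G s) ^+ 2) +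
     n%:R^-1 * (kap (G s) * emp s w ^+ 2 - S).
    rewrite empE exprMn sn2; set N := n%:R; have N0 : N != 0 by rewrite gt_eqF.
    by field.
  apply: le_trans (ler_normD _ _) _; rewrite [leRHS]mulrDr; apply: lerD; last first.
    by rewrite normrM (ger0_norm in0).
  apply: le_trans fle _; rewrite empE normrM (gtr0_norm sn0) exprMn /A.
  rewrite le_eqVlt; apply/orP; left; apply/eqP.
  have E3 : Num.sqrt n%:R ^+ 3 = n%:R * Num.sqrt n%:R :> R by rewrite exprSr sn2.
  rewrite E3; set q := `|_ - _| ^+ 3; set N := n%:R; set r := Num.sqrt N.
  have N0 : N != 0 by rewrite gt_eqF.
  have r0 : r != 0 by rewrite gt_eqF.
  clearbody r; clearbody N; by field; rewrite r0 N0.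
have := @integral_squeeze _ _ _ lam f g h _ _ mg mh f0 _ _ gE hE _ _.
have -> : (\int[lam]_s f s)%E = W w by rewrite /W wasserstein2_sq_empirical.
case.
- by move=> s; rewrite mulr_ge0.
- by move=> s; rewrite mulr_ge0.
- move=> s; have [fn h1] := fgh s; rewrite -(fineK fn) lee_fin.
  by move: h1; rewrite ler_norml => /andP[_ ?]; lra.
- move=> s; have [fn h1] := fgh s; rewrite -(fineK fn) lee_fin.
  by move: h1; rewrite ler_norml => /andP[? _]; lra.
move=> Wfin Wle; split => //.
have -> : n%:R * fine (W w) - quadratic_sum w = n%:R * (fine (W w) - n%:R^-1 * quadratic_sum w).
  by rewrite mulrBr mulrA divff ?mul1r// gt_eqF.
rewrite normrM (gtr0_norm n0); apply: le_trans (ler_wpM2l (ltW n0) Wle) _.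
by rewrite mulrA divff ?mul1r ?pnatr_eq0.
Qed.

Let bad (i : 'I_n) : set T := X i @^-1` (~` `]a, b]%classic).

Let bad0 i : measurable (bad i) /\ P (bad i) = 0%E.
Proof.
have mC : measurable (~` `]a, b]%classic : set R) by exact: measurableC.
split; first by rewrite /bad -[X in measurable X]setTI; exact: measurable_funPT.
have -> : P (bad i) = mu (~` `]a, b]%classic) by rewrite -(Xiid.2 i _ mC).
apply/eqP; rewrite eq_le measure_ge0 andbT.
apply: (@le_trans _ _ (mu (`]-oo, a]%classic `|` ~` `]-oo, b]%classic))).
  apply: le_measure; rewrite ?inE//; first by apply: measurableU => //; exact: measurableC.
  move=> x /=; rewrite !in_itv/=; case: (leP x a) => xa; [by left|right] => /=.
  by move=> xb; apply: H1; rewrite xb.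
have ca : mu `]-oo, a]%classic = 0%E by rewrite EFin_dfun Ga.
have cb : mu (~` `]-oo, b]%classic) = 0%E.
  by rewrite (@probability_setC _ _ _ mu)// EFin_dfun Gb// subee.
apply: le_trans (measureU2 _ _ _) _ => //; first exact: measurableC.
by rewrite -[leRHS]adde0; apply: leeD; rewrite le_eqVlt; apply/orP; left; apply/eqP.
Qed.

(** Samples that leave [`]a, b]] form a null event, and its indicator is added to the
    pathwise error before taking expectations. *)
Lemma wasserstein_laplace_approx :
  (\int[P]_w expeR (- (n%:R%:E * W w)))%E \is a fin_num /\
  `|fine (\int[P]_w expeR (- (n%:R%:E * W w)))%E - \int[P]_w expR (- quadratic_sum w)|
    <= approximation_error * (b - a).
Proof.
have q0 w : 0 <= quadratic_sum w.
  apply: sumr_ge0 => j _; apply: mulr_ge0; last exact: sqr_ge0.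
  by apply: mulr_ge0 => //; apply: ltW; exact: step_gt0.
pose h w := total w + \sum_i \1_(bad i) w.
have ib i : P.-integrable setT (EFin \o (\1_(bad i) : T -> R)).
  by apply: integrable_indicr; have [] := bad0 i.
have is_ : P.-integrable setT (EFin \o (fun w => \sum_i (\1_(bad i) w : R))).
  exact: integrable_sumr.
have it : P.-integrable setT (EFin \o total).
  exact: (@integrable_integral_process _ _ _ P a b H M (ltW ltab) mH H0 HM).
have f01 w : (0 <= expeR (- (n%:R%:E * W w)) <= 1)%E.
  rewrite expeR_ge0 /= -expeR0 lee_expeR oppe_le0; apply: mule_ge0 => //.
have hint : \int[P]_w h w <= approximation_error * (b - a).
  rewrite RintegralD// Rintegral_sumr// big1 ?addr0.
    exact: (expectation_integral_process (ltW ltab) mH H0 HM HD).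
  move=> i _; have [mb b0] := bad0 i.
  have := @integral_indic _ T R P setT measurableT (bad i) mb.
  by rewrite setIT => E; rewrite /Rintegral; apply: (f_equal fine (etrans E b0)).
have [||||fn hle] := @expectation_sandwich _ _ _ P (fun w => expeR (- (n%:R%:E * W w)))
   (fun w => expR (- quadratic_sum w)) h f01.
- by move=> w; rewrite expR_ge0 /= -[leRHS]expR0 ler_expR oppr_le0.
- apply: measurableT_comp => //; apply: measurableT_comp => //.
  apply: measurable_sum => j; apply: measurable_funM => //; apply: measurable_funX.
  exact: measurable_empirical_process.
- exact: integrable_addr.
- move=> w; have sb0 : 0 <= \sum_i \1_(bad i) w :> R by apply: sumr_ge0 => i _; rewrite indicE.
  have t0 : 0 <= total w by apply: Rintegral_ge0 => s _.
  have [good|/existsNP[i /negP Xi]] := pselect (forall i, X i w \in `]a, b]).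
    have [Wn Wle] := wasserstein_pathwise good.
    rewrite -(fineK Wn) -EFinM -EFinN /=.
    apply: le_trans (expRN_lipschitz _ _) _ => //; first by rewrite mulr_ge0// fine_ge0.
    by apply: le_trans Wle _; rewrite /h lerDl.
  have hi : 1 <= \sum_i \1_(bad i) w :> R.
    have bw : bad i w by move=> /= XiI; move/negP: Xi; apply.
    rewrite (bigD1 i)//= (_ : \1_(bad i) w = 1); last by rewrite indicE mem_set.
    by rewrite lerDl; apply: sumr_ge0 => j _; rewrite indicE.
  apply: (@le_trans _ _ 1); last by apply: le_trans hi _; rewrite /h lerDr.
  have := f01 w; set z := expeR _ => /andP[z0 z1].
  have zn : z \is a fin_num by rewrite ge0_fin_numE// (le_lt_trans z1) ?ltry.
  move: z0 z1; rewrite -(fineK zn) !lee_fin /= => z0 z1.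
  have e0' := expR_ge0 (- quadratic_sum w).
  have e1' : expR (- quadratic_sum w) <= 1 by rewrite -expR0 ler_expR oppr_le0.
  by rewrite ler_norml; apply/andP; split; lra.
split => //; exact: le_trans hint.
Qed.

End wasserstein_approximation.
(** * Riemann sums of the Brownian bridge *)

Lemma continuous_comp_within {T U V : topologicalType} (A : set U) (f : T -> U) (g : U -> V) :
  continuous f -> (forall x, A (f x)) -> {within A, continuous g} -> continuous (g \o f).
Proof.
move=> cf Af /subspace_continuousP cg x.
apply: cvg_trans (cg _ (Af x)) => P /= fP.
have h : nbhs x (f @^-1` (fun y => A y -> P (g y))) := cf x _ fP.
by apply: (@filterS _ (nbhs x) _ _ _ _ h) => y /= hy; exact: hy.
Qed.

Lemma cvg_step {R : realType} (a b : R) : step a b m @[m --> \oo] --> (0 : R).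
Proof.
rewrite -(mulr0 (b - a)); apply: cvgM; first exact: cvg_cst.
exact: cvg_harmonic.
Qed.

Section riemann_sums.
Context {R : realType} (Psi : R -> R) (a b : R).
Local Notation lam := (@lebesgue_measure R).
Hypothesis ltab : a < b.
Hypothesis cPsi : continuous Psi.
Hypothesis Psi0 : forall x, 0 <= Psi x.

(** A Riemann sum is the integral of a step function, and the step functions converge
    pointwise and boundedly by continuity. *)
Lemma cvg_riemann_sum : exists I : R, (\int[lam]_(s in `[a, b]) (Psi s)%:E = I%:E)%E /\
  \sum_(j < m.+1) step a b m * Psi (grid a b m j.+1) @[m --> \oo] --> I.
Proof.
have [c cab Mb] := EVT_max (ltW ltab) (continuous_subspaceT cPsi).
set M := Psi c in Mb.
pose D : set (measurableTypeR R) := `]a, b]%classic.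
have mD : measurable D by exact: measurable_itv.
pose f m (s : measurableTypeR R) := (\sum_(j < m.+1) \1_(cell a b m j) s * Psi (grid a b m j.+1))%:E.
have mf m : measurable_fun D (f m).
  apply/measurable_EFinP; apply: measurable_funTS; apply: measurable_sum => j.
  by apply: measurable_funM => //; apply: measurable_indic; exact: measurable_itv.
have mPsi : measurable_fun D (EFin \o (Psi : measurableTypeR R -> R)).
  by apply/measurable_EFinP; apply: measurable_funTS; exact: continuous_measurable_fun.
have near_grid s : s \in `]a, b] -> forall m, exists x,
    [/\ `|s - x| <= step a b m, a <= x <= b & f m s = (Psi x)%:E].
  move=> sab m; have [j [/andP[h1 h2] h3 h4]] := cell_find m ltab sab.
  exists (grid a b m j.+1); split => //; first by rewrite distrC ger0_norm.
  by rewrite /f h4.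
have fM : forall s n, D s -> (`|f n s| <= M%:E)%E.
  move=> s n Ds; have [x [_ xab ->]] := near_grid s Ds n.
  by rewrite /= lee_fin ger0_norm// Mb// in_itv.
have f_cvg : forall s, D s -> f ^~ s @ \oo --> (Psi s)%:E.
  move=> s Ds.
  suff h : (fun m => fine (f m s)) @ \oo --> Psi s.
    by apply/fine_cvgP; split => //; exact: nearW.
  apply/cvgrPdist_le => e e0.
  have /cvgrPdist_le/(_ _ e0)[r /= r0 hr] := @cPsi s.
  have := @cvg_step R a b => /cvgr_lt/(_ _ r0); apply: filterS => m mr.
  have [x [sx _ []]] := near_grid s Ds m; rewrite /= => ->.
  by apply: hr => /=; exact: le_lt_trans mr.
have lD : lam D = (b - a)%:E by apply: lebesgue_measure_segment; exact: ltW.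
have iM : lam.-integrable D (cst M%:E).
  by apply/integrableP; split => //; rewrite integral_cst//= lD ltry.
have [iPsi _ cI] := @dominated_convergence _ _ R lam D mD f (EFin \o Psi) (cst M%:E) mf mPsi
  (aeW _ f_cvg) iM (aeW _ (fun s n => fM s n)).
have fn : (\int[lam]_(x in D) (Psi x)%:E)%E \is a fin_num by exact: integrable_fin_num iPsi.
exists (fine (\int[lam]_(x in D) (Psi x)%:E)%E); split.
  rewrite fineK// integral_itv_obnd_cbnd//.
have -> : (fun m => \sum_(j < m.+1) step a b m * Psi (grid a b m j.+1)) =
    (fun m => fine (\int[lam]_(x in D) f m x)%E).
  apply/funext => m; apply: EFin_inj; rewrite -(integral_step ltab)//.
  have sub : (\int[lam]_x (\sum_(i < m.+1) \1_(cell a b m i) x * Psi (grid a b m i.+1))%:E = \int[lam]_(x in D) f m x)%E.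
    rewrite [RHS]integral_mkcond; apply: eq_integral => x _; rewrite patchE mem_setE.
    case: ifPn => // xD; rewrite big1// => j _; rewrite indicE; case: (boolP (_ \in _)); rewrite ?mul0r//.
    by rewrite inE => /(cell_sub ltab) /=; rewrite (negbTE xD).
  by rewrite sub fineK// -sub integral_step.
by apply: fine_cvg; rewrite fineK.
Qed.

End riemann_sums.

Section time_change.
Context {R : realType} (G kap : R -> R) (a b k K C L : R).
Local Notation lam := (@lebesgue_measure R).
Hypothesis ltab : a < b.
Hypothesis k0 : 0 < k.
Hypothesis kapkK : forall u, 0 <= u <= 1 -> k <= kap u <= K.
Hypothesis G01 : forall t, 0 <= G t <= 1.
Hypothesis Ga : G a = 0.
Hypothesis Gb : G b = 1.
Hypothesis cG : continuous G.
Hypothesis ckapG : continuous (kap \o G).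
Hypothesis G_expand : forall s t, a <= s -> s <= t -> t <= b -> (t - s) / K <= G t - G s.
Hypothesis G_tangent : forall s t, a <= s <= b -> a <= t <= b ->
  `|G t - G s - (t - s) / kap (G s)| <= C * (t - s) ^+ 2.

Let kap_gt0 t : 0 < kap (G t).
Proof. by have /andP[h _] := kapkK (G01 t); exact: lt_le_trans h. Qed.

Let K0 : 0 < K.
Proof. by have /andP[h h'] := kapkK (G01 a); exact: lt_le_trans k0 (le_trans h h'). Qed.

Let G_derive (s : R) : s \in `]a, b[ -> is_derive s (1 : R) G (kap (G s))^-1.
Proof.
rewrite in_itv/= => /andP[as_ sb].
suff h : h^-1 *: (G (h *: 1 + s) - G s) @[h --> 0^'] --> (kap (G s))^-1.
  by apply: DeriveDef; [apply: cvgP h|exact: cvg_lim h].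
have C1 : 0 < `|C| + 1 by rewrite ltr_pwDr.
apply/cvgrPdist_le => e e0; rewrite near_withinE.
exists (Num.min (e / (`|C| + 1)) (Num.min (s - a) (b - s))) => /=.
  by rewrite !lt_min divr_gt0// !subr_gt0 as_ sb.
move=> h /=; rewrite sub0r normrN !lt_min => /and3P[he ha hb] h0.
have hA : (h *: (1 : R) : R) = h by rewrite /GRing.scale/= mulr1.
rewrite hA {hA}; have := @G_tangent s (h + s).
have -> : a <= s <= b by rewrite !ltW.
have -> : a <= h + s <= b.
  by move: ha hb; rewrite !ltr_norml => /andP[? ?] /andP[? ?]; apply/andP; split; lra.
rewrite addrK => /(_ isT isT) H.
have -> : (kap (G s))^-1 - h^-1 *: (G (h + s) - G s) = - (h^-1 * (G (h + s) - G s - h / kap (G s))).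
  by rewrite /GRing.scale/=; field; rewrite h0 gt_eqF.
rewrite normrN normrM normfV ler_pdivrMl ?normr_gt0//.
apply: le_trans H _; rewrite -(real_normK (num_real h)) expr2 mulrA [leRHS]mulrC ler_wpM2r//.
apply: (@le_trans _ _ ((`|C| + 1) * (e / (`|C| + 1)))); last by rewrite mulrC divfK// gt_eqF.
apply: le_trans (ler_wpM2r (normr_ge0 h) (ler_norm C)) _.
by apply: ler_pM => //; [rewrite lerDl|exact: ltW].
Qed.

Let dG (s : R) : s \in `]a, b[ -> (G^`())%classic s = (kap (G s))^-1.
Proof. by move=> /G_derive h; rewrite derive1E derive_val. Qed.

Let cq : continuous (fun s => (kap (G s))^-1).
Proof. by move=> s; apply: cvgV; [rewrite gt_eqF|exact: ckapG]. Qed.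

Let dG_cvg (Fi : set_system R) (s : R) : Filter Fi -> (\forall x \near Fi, x \in `]a, b[) ->
  Fi --> s -> (G^`())%classic x @[x --> Fi] --> (kap (G s))^-1.
Proof.
move=> FFi Fab Fs; apply: (@cvg_trans _ ((fun x => (kap (G x))^-1) @ Fi)).
  by apply: near_eq_cvg; apply: filterS Fab => x xab; rewrite dG.
by apply: cvg_trans (@cq s); exact: cvg_app.
Qed.

Section density.
Context (beta : R -> R).
Hypothesis cbk : {within `[0, 1], continuous (fun u => beta u ^+ 2 * kap u ^+ 2)}.

Lemma continuous_density : continuous (fun s => kap (G s) * beta (G s) ^+ 2).
Proof.
have -> : (fun s => kap (G s) * beta (G s) ^+ 2) =
    (fun s => ((fun u => beta u ^+ 2 * kap u ^+ 2) \o G) s * (kap (G s))^-1).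
  by apply/funext => s /=; field; rewrite gt_eqF.
move=> s; apply: cvgM; last exact: cq.
by apply: (continuous_comp_within cG _ cbk) => x; rewrite /= in_itv/=.
Qed.

(** Substitution [u = G s], whose derivative is [1 / kap (G s)] by the tangent
    estimate. *)
Lemma time_change :
  (\int[lam]_(u in `[0%R, 1%R]) (beta u ^+ 2 * kap u ^+ 2)%:E =
   \int[lam]_(s in `[a, b]) (kap (G s) * beta (G s) ^+ 2)%:E)%E.
Proof.
have cpsi := cbk; rewrite -Ga -Gb in cpsi *.
rewrite (@integration_by_substitution_increasing _ G (fun u => beta u ^+ 2 * kap u ^+ 2) a b (ltW ltab)) //.
- have eqi : forall s, s \in `]a, b[ -> (beta (G s) ^+ 2 * kap (G s) ^+ 2) * (G^`())%classic s = kap (G s) * beta (G s) ^+ 2.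
    by move=> s /dG ->; field; rewrite gt_eqF.
  have mR : measurable_fun `]a, b[ (fun s : measurableTypeR R => (kap (G s) * beta (G s) ^+ 2)%:E).
    apply/measurable_EFinP; apply: measurable_funTS; apply: continuous_measurable_fun.
    exact: continuous_density.
  rewrite [RHS]integral_itv_bndoo// integral_itv_bndoo.
    by apply: eq_integral => s; rewrite inE/= => sab; rewrite -eqi.
  apply: eq_measurable_fun mR => s; rewrite inE/= => sab; rewrite -eqi//.
- move=> x y; rewrite !in_itv/= => /andP[ax xb] /andP[ay yb] xy.
  rewrite -subr_gt0; apply: lt_le_trans (G_expand ax (ltW xy) yb).
  by rewrite divr_gt0// subr_gt0.
- move=> s sab; rewrite /continuous_at dG//; apply: dG_cvg => //.
  by apply: near_in_itvoo.
- apply: cvgP; apply: (@dG_cvg _ a).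
    near=> x; rewrite in_itv/=; apply/andP; split; near: x; [exact: nbhs_right_gt|exact: nbhs_right_lt].
  exact: cvg_at_right_filter.
- apply: cvgP; apply: (@dG_cvg _ b).
    near=> x; rewrite in_itv/=; apply/andP; split; near: x; [exact: nbhs_left_gt|exact: nbhs_left_lt].
  exact: cvg_at_left_filter.
- split.
  + by move=> s /G_derive h; apply: ex_derive.
  + by apply: cvg_at_right_filter; exact: cG.
  + by apply: cvg_at_left_filter; exact: cG.
Unshelve. all: by end_near.
Qed.

End density.
End time_change.
(** * Passage to the limit *)

Section almost_sure_limit.
Context {d : measure_display} {T : measurableType d} {R : realType} (P : probability T R).
Context (f : T -> \bar R) (g : nat -> T -> R).
Hypothesis f01 : forall w, (0 <= f w <= 1)%E.
Hypothesis g01 : forall m w, 0 <= g m w <= 1.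
Hypothesis mg : forall m, measurable_fun setT (g m).
Hypothesis gf : {ae P, forall w, g m w @[m --> \oo] --> fine (f w)}.

(** Off a null set the function [f] is a pointwise limit of measurable functions, to
    which dominated convergence applies; the null set is absorbed by its indicator. *)
Lemma ae_limit_expectation : (\int[P]_w f w)%E \is a fin_num /\
  \int[P]_w g m w @[m --> \oo] --> fine (\int[P]_w f w)%E.
Proof.
have [N [mN N0 sN]] := gf.
have iN : P.-integrable setT (EFin \o (\1_N : T -> R)) by exact: integrable_indicr.
have EN : \int[P]_w (\1_N w : R) = 0.
  have := @integral_indic _ T R P setT measurableT N mN.
  by rewrite setIT => E; rewrite /Rintegral; apply: (f_equal fine (etrans E N0)).
pose gN m w := g m w * \1_(~` N) w.
pose fN w := fine (f w) * \1_(~` N) w.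
have mgN m : measurable_fun setT (gN m).
  by apply: measurable_funM => //; apply: measurable_indic; exact: measurableC.
have c01 (A : set T) w : 0 <= (\1_A w : R) <= 1.
  by rewrite indicE; case: (_ \in _); rewrite ?lexx ?ler01.
have ff01 w : 0 <= fine (f w) <= 1.
  have /andP[h0 h1] := f01 w.
  have fn : f w \is a fin_num by rewrite ge0_fin_numE// (le_lt_trans h1) ?ltry.
  by move: h0 h1; rewrite -{1 2}(fineK fn) !lee_fin => -> ->.
have fN01 w : 0 <= fN w <= 1.
  have /andP[h0 h1] := ff01 w; have /andP[k0 k1] := c01 (~` N) w.
  by rewrite mulr_ge0//= mulr_ile1.
have gN01 m w : 0 <= gN m w <= 1.
  have /andP[h0 h1] := g01 m w; have /andP[k0 k1] := c01 (~` N) w.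
  by rewrite mulr_ge0//= mulr_ile1.
have gNf w : gN m w @[m --> \oo] --> fN w.
  rewrite /gN /fN indicE; case: (boolP (w \in ~` N)) => wN.
    under eq_fun do rewrite mulr1.
    rewrite mulr1; apply: contrapT => h; move: wN; rewrite inE; apply; exact: sN.
  under eq_fun do rewrite mulr0.
  by rewrite mulr0; exact: cvg_cst.
have mfN : measurable_fun setT fN.
  by apply: (measurable_fun_cvg mgN) => w _; exact: gNf.
have bd (u : R) (u01 : 0 <= u <= 1) : `|u| <= 1 by case/andP: u01 => ? ?; rewrite ger0_norm.
have igN m : P.-integrable setT (EFin \o gN m).
  by apply: (@bounded_integrable _ _ _ P 1) => // w; exact: bd.
have ig m : P.-integrable setT (EFin \o g m).
  by apply: (@bounded_integrable _ _ _ P 1) => // w; exact: bd.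
have ifN : P.-integrable setT (EFin \o fN).
  by apply: (@bounded_integrable _ _ _ P 1) => // w; exact: bd.
have offN w (u : R) : 0 <= u <= 1 -> `|u - u * \1_(~` N) w| <= \1_N w.
  move=> /andP[u0 u1]; rewrite !indicE in_setC; case: (boolP (w \in N)) => _ /=.
    by rewrite mulr0 subr0 ger0_norm.
  by rewrite mulr1 subrr normr0.
have [fn fle] := @expectation_sandwich _ _ _ P f fN (\1_N) f01 fN01 mfN iN (fun w => offN w _ (ff01 w)).
have feq : fine (\int[P]_w f w)%E = \int[P]_w fN w.
  by apply/eqP; rewrite -subr_eq0 -normr_le0 -EN.
have geq m : \int[P]_w g m w = \int[P]_w gN m w.
  apply/eqP; rewrite -subr_eq0 -normr_le0 -EN.
  exact: (expectation_dist_le (ig m) (igN m) iN (fun w => offN w _ (g01 m w))).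
split => //; rewrite feq.
have -> : (fun m => \int[P]_w g m w) = (fun m => \int[P]_w gN m w) by apply/funext.
have gNf' w : [set: T] w -> (EFin \o gN m) w @[m --> \oo] --> (EFin \o fN) w.
  by move=> _; apply: cvg_EFin; [exact: nearW|exact: gNf].
have mE (u : T -> R) : measurable_fun setT u -> measurable_fun setT (EFin \o u).
  by move=> mu; exact/measurable_EFinP.
have [_ _ cI] := @dominated_convergence _ _ R P setT measurableT (fun m => EFin \o gN m) (EFin \o fN) (cst 1%E)
  (fun m => mE _ (mgN m)) (mE _ mfN) (aeW _ gNf') (integrable_cstr P 1)
  (aeW _ (fun w m _ => bd _ (gN01 m w))).
by apply: fine_cvg; rewrite (EFin_Rintegral ifN).
Qed.

End almost_sure_limit.

Section bridge_functional.
Context {R : realType} {d : nat} (gamma : R -> 'rV[R]_d) (mu : probability R R) (a b k K C : R).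
Local Notation lam := (@lebesgue_measure R).
Local Notation G := (dfun mu).
Local Notation kap := (curvature gamma).
Hypothesis ltab : a < b.
Hypothesis k0 : 0 < k.
Hypothesis kapkK : forall u, 0 <= u <= 1 -> k <= kap u <= K.
Hypothesis ckap : {within `[0, 1], continuous kap}.
Hypothesis Ga : G a = 0.
Hypothesis Gb : G b = 1.
Hypothesis cG : continuous G.
Hypothesis G_expand : forall s t, a <= s -> s <= t -> t <= b -> (t - s) / K <= G t - G s.
Hypothesis G_tangent : forall s t, a <= s <= b -> a <= t <= b ->
  `|G t - G s - (t - s) / kap (G s)| <= C * (t - s) ^+ 2.
Context (disp : measure_display) (T : measurableType disp) (P : probability T R)
  (B : R -> {RV P >-> R}).
Hypothesis BB : brownian_bridge B.

(** On a continuous path the sums are Riemann sums of [kap (G s) * B (G s) ^+ 2] over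
    [`[a, b]], and the time change turns their limit into the integral of
    [B ^+ 2 * kap ^+ 2] over [`[0, 1]]. *)
Lemma bridge_functional_limit :
  (\int[P]_w expeR (- \int[lam]_(s in `[0%R, 1%R]) (B s w ^+ 2 * kap s ^+ 2)%:E))%E \is a fin_num /\
  \int[P]_w expR (- \sum_(j < m.+1) step a b m * kap (G (grid a b m j.+1)) *
      B (G (grid a b m j.+1)) w ^+ 2) @[m --> \oo] -->
  fine (\int[P]_w expeR (- \int[lam]_(s in `[0%R, 1%R]) (B s w ^+ 2 * kap s ^+ 2)%:E))%E.
Proof.
have G01 t : 0 <= G t <= 1 by rewrite dfun_ge0 dfun_le1.
have kap0 t : 0 <= kap (G t).
  by have /andP[h _] := kapkK (G01 t); apply: le_trans h; exact: ltW.
apply: ae_limit_expectation.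
- move=> w; rewrite expeR_ge0 /= -expeR0 lee_expeR oppe_le0.
  by apply: integral_ge0 => s _; rewrite lee_fin mulr_ge0// sqr_ge0.
- move=> m w; rewrite expR_ge0 /= -[leRHS]expR0 ler_expR oppr_le0.
  apply: sumr_ge0 => j _; apply: mulr_ge0; last exact: sqr_ge0.
  by apply: mulr_ge0 => //; apply: ltW; exact: step_gt0.
- move=> m; apply: measurableT_comp => //; apply: measurableT_comp => //.
  apply: measurable_sum => j; apply: measurable_funM => //; exact: measurable_funX.
apply: filterS (bb_continuous BB) => w cB.
have cbk : {within `[0, 1], continuous (fun u => B u w ^+ 2 * kap u ^+ 2)}.
  rewrite (_ : (fun u : R => _) = (fun u : R => B u w * B u w * (kap u * kap u))); last first.
    by apply/funext => u; rewrite !expr2.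
  by move=> u; apply: cvgM; apply: cvgM; (exact: cB || exact: ckap).
have ckG : continuous (kap \o G).
  by apply: (continuous_comp_within cG _ ckap) => x; rewrite /= in_itv/=.
have cPsi := continuous_density k0 kapkK G01 cG ckG cbk.
have [|I [II cI]] := cvg_riemann_sum ltab cPsi.
  by move=> x; rewrite mulr_ge0// sqr_ge0.
rewrite (time_change ltab k0 kapkK G01 Ga Gb cG ckG G_expand G_tangent cbk) II -EFinN /=.
pose S m := \sum_(j < m.+1) step a b m * (kap (G (grid a b m j.+1)) * B (G (grid a b m j.+1)) w ^+ 2).
have cS : - S m @[m --> \oo] --> - I by exact: cvgN.
rewrite (_ : (fun m => _) = expR \o (fun m => - S m)); first by apply: continuous_cvg; [exact: continuous_expR|exact: cS].
apply/funext => m /=; congr (expR (- _)).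
by apply: eq_bigr => j _; rewrite mulrA.
Qed.

End bridge_functional.

Lemma cvg_uniform_approx {R : realType} (u A' : nat -> R) (A : nat -> nat -> R) (l : R) :
  (forall e, 0 < e -> \forall m \near \oo, \forall n \near \oo, `|u n - A m n| <= e) ->
  (forall m, A m n @[n --> \oo] --> A' m) -> A' m @[m --> \oo] --> l -> u n @[n --> \oo] --> l.
Proof.
move=> uA cA cl; apply/cvgrPdist_le => e e0.
have e3 : 0 < e / 3 by rewrite divr_gt0.
have /cvgrPdist_le/(_ _ e3) near_l := cl.
near \oo => m.
have lm : `|l - A' m| <= e / 3 by near: m.
have near_u : \forall n \near \oo, `|u n - A m n| <= e / 3 by near: m; exact: uA.
have /cvgrPdist_le/(_ _ e3) near_A := cA m.
near=> n.
have h1 : `|u n - A m n| <= e / 3 by near: n.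
have h2 : `|A' m - A m n| <= e / 3 by near: n.
have -> : l - u n = (l - A' m) + ((A' m - A m n) - (u n - A m n)) by ring.
apply: le_trans (ler_normD _ _) _; apply: le_trans (lerD lm (ler_normB _ _)) _.
by apply: le_trans (lerD (lexx _) (lerD h2 h1)) _; lra.
Unshelve. all: by end_near. Qed.

Lemma curvature_range {R : realType} {d : nat} (gamma : R -> 'rV[R]_d) :
  {within `[0, 1], continuous (curvature gamma)} ->
  (forall s : R, s \in `[0, 1] -> curvature gamma s != 0) ->
  exists k K : R, 0 < k /\ forall u, 0 <= u <= 1 -> k <= curvature gamma u <= K.
Proof.
move=> ckap kap_neq0.
have [c c01 kmin] := EVT_min ler01 ckap; have [c' _ kmax] := EVT_max ler01 ckap.
exists (curvature gamma c), (curvature gamma c'); split.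
  by rewrite lt_neqAle eq_sym kap_neq0//= /curvature /enorm sqrtr_ge0.
move=> u u01; have uI : u \in `[0, 1] by rewrite in_itv.
by apply/andP; split; [exact: kmin|exact: kmax].
Qed.

Lemma approximation_error_small {R : realType} (a b K C L L' eta : R) :
  a < b -> 0 < K -> 0 <= C -> 0 < eta -> exists2 e : R, 0 < e &
  \forall m \near \oo, \forall n \near \oo,
    @approximation_error R n a b K C L L' m e * (b - a) <= eta.
Proof.
move=> ltab K0 C0 eta0.
have ba0 : 0 < b - a by rewrite subr_gt0.
have Kba : 0 < 6 * K * (b - a) by rewrite !mulr_gt0.
(* this weight makes the last term of the error contribute eta / 3 *)
exists (eta / (6 * K * (b - a))); first by rewrite divr_gt0.
set e := eta / _.
have e0 : 0 < e by rewrite divr_gt0.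
have eta3 : 0 < eta / 3 by rewrite divr_gt0.
have cm : (L' + K * (L / (2 * e))) * (b - a) * step a b m @[m --> \oo] --> (0 : R).
  rewrite -(mulr0 ((L' + K * (L / (2 * e))) * (b - a))).
  by apply: cvgM; [exact: cvg_cst|exact: cvg_step].
have /cvgr_le/(_ _ eta3) near_m := cm.
apply: filterS near_m => m hm; near=> n.
pose D := 5 / 2 * (2 * C * K ^+ 3) * (b - a).
have s0 : 0 < Num.sqrt n.+1%:R :> R by rewrite sqrtr_gt0 ltr0n.
have hn : D / Num.sqrt n.+1%:R <= eta / 3.
  rewrite ler_pdivrMr// -ler_pdivrMl// (le_trans (ler_norm _))//.
  rewrite -sqrtr_sqr ler_wsqrtr//; apply: (@le_trans _ _ n%:R); last by rewrite ler_nat.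
  near: n; exact: nbhs_infty_ger.
have he : K * (2 * e) * (b - a) = eta / 3.
  by rewrite /e; field; rewrite !gt_eqF.
have -> : @approximation_error R n a b K C L L' m e * (b - a) =
   D / Num.sqrt n.+1%:R + ((L' + K * (L / (2 * e))) * (b - a) * step a b m + K * (2 * e) * (b - a)).
  rewrite /approximation_error /D; set r := Num.sqrt _ in s0 *; clearbody r.
  by field; rewrite !gt_eqF.
by rewrite he; lra.
Unshelve. all: by end_near. Qed.

Theorem proposition10 (R : realType) (d : nat) (gamma : R -> 'rV[R]_d)
  (gammaC2 : twice_continuously_derivable_on `[0, 1] gamma)
  (gamma_unit_speed : forall s : R, s \in `[0, 1] -> enorm (velocity gamma s) = 1)
  (curvature_neq0 : forall s : R, s \in `[0, 1] -> curvature gamma s != 0)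
  (curvature_derivable : derivable_on `[0, 1] (curvature gamma))
  (curvature_bounded : exists M : R, forall s : R, s \in `[0, 1] ->
     `|derive_on `[0, 1] (curvature gamma) s| <= M)
  (a b : R) (ltab : a < b) (F : R -> R)
  (F01 : forall t : R, t \in `]a, b[ -> F t \in `[0, 1])
  (F_derivable2 : forall t : R, t \in `]a, b[ ->
     derivable F t 1 /\ derivable (F^`())%classic t 1)
  (F_eq : forall t : R, t \in `]a, b[ ->
     (F t)%:E = (\int[lebesgue_measure]_(s in `]a, t])
                   ((curvature gamma (F s))^-1)%:E)%E)
  (F_a : F s @[s --> a^'+] --> (0 : R))
  (F_b : F s @[s --> b^'-] --> (1 : R))
  (mu : probability R R)
  (mu_cdf : forall t : R, t \in `]a, b[ -> mu [set` `]-oo, t]] = (F t)%:E)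
  (disp : nat -> measure_display) (T : forall n, measurableType (disp n))
  (P : forall n, probability (T n) R)
  (X : forall n, 'I_n -> {RV P n >-> R})
  (X_iid : forall n, iid (X n) mu)
  (disp' : measure_display) (T' : measurableType disp') (P' : probability T' R)
  (B : R -> {RV P' >-> R}) (B_bridge : brownian_bridge B) :
  ((\int[P n]_w expeR (- (n%:R%:E *
       wasserstein2_sq (empirical_measure (fun i => X n i w)) mu))) `^ 2^-1)%E
    @[n --> \oo] --> hambly_lyons_limit gamma B.
Proof.
have ckap := derivable_on_continuous curvature_derivable.
have [k [K [k0 kapkK]]] := curvature_range ckap curvature_neq0.
have [L kapL'] := curvature_bounded.
have kapL := derivable_on_lipschitz curvature_derivable kapL'.
set kap := curvature gamma in ckap kapkK kapL F_eq *.
set G := dfun mu.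
have kapL01 u v : 0 <= u <= 1 -> 0 <= v <= 1 -> `|kap u - kap v| <= L * `|u - v|.
  by move=> u01 v01; apply: kapL; rewrite in_itv.
have Ga := profile_before ltab F_a mu_cdf.
have Gb := profile_after ltab F_b mu_cdf.
have G_expand s t : a <= s -> s <= t -> t <= b -> (t - s) / K <= G t - G s.
  move=> as_ st tb.
  by have /andP[] := profile_bounds k0 kapkK kapL01 ltab F_eq F_a F_b mu_cdf as_ st tb.
have G_tangent s t := @profile_tangent R kap k K L k0 kapkK kapL01 mu a b F ltab F_eq F_a F_b mu_cdf s t.
have G_lip := profile_lipschitz k0 kapkK kapL01 ltab F_eq F_a F_b mu_cdf.
have kapG_lip := profile_curvature_lipschitz k0 kapkK kapL01 ltab F_eq F_a F_b mu_cdf.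
have mkG := measurable_profile_curvature kapL01 mu.
have L0 : 0 <= L.
  by have := @kapL01 0 1; rewrite !lexx ler01 sub0r normrN normr1 mulr1 => /(_ isT isT); apply: le_trans.
have C0 : 0 <= L / k ^+ 3 by rewrite divr_ge0// exprn_ge0// ltW.
have kapK u : 0 <= u <= 1 -> 0 < kap u <= K.
  by move=> /kapkK /andP[h1 h2]; rewrite h2 (lt_le_trans k0).
have K0 : 0 < K by have /andP[h1 h2] := @kapK 0 (introT andP (conj (lexx 0) ler01)); exact: lt_le_trans h2.
pose W n w := expeR (- (n%:R%:E * wasserstein2_sq (empirical_measure (fun i => X n i w)) mu))%E.
pose A m n := \int[P n]_w expR (- \sum_(j < m.+1) step a b m * kap (G (grid a b m j.+1)) *
  empirical_process (X n) mu (grid a b m j.+1) w ^+ 2).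
have approx m n e (e0 : 0 < e) := wasserstein_laplace_approx (X_iid n.+1) ltab C0 kapK Ga Gb
  G_expand G_tangent (fun s t _ _ => G_lip s t) (fun s t _ _ => kapG_lip s t) mkG m e0.
have Wfin n : (\int[P n.+1]_w W n.+1 w)%E \is a fin_num by have [] := approx 0%N n 1 ltr01.
have [Bfin cB] := bridge_functional_limit ltab k0 kapkK ckap (Ga _ (lexx a)) (Gb _ (lexx b))
  (lipschitz_continuous G_lip) G_expand G_tangent B_bridge.
have cu : fine (\int[P n.+1]_w W n.+1 w)%E @[n --> \oo] -->
    fine (\int[P']_w expeR (- \int[lebesgue_measure]_(s in `[0%R, 1%R]) (B s w ^+ 2 * kap s ^+ 2)%:E))%E.
  apply: (cvg_uniform_approx (A := fun m n => A m n.+1) _ _ cB).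
    move=> eta eta0; have [e e0 he] := approximation_error_small k^-1 (L / k) ltab K0 C0 eta0.
    apply: filterS he => m; apply: filterS => n; apply: le_trans.
    by have [_] := approx m n e e0.
  move=> m; rewrite (cvg_shiftS (A m)).
  apply: (@cvg_empirical_laplace R mu disp T P X disp' T' P' B m.+1
    (fun j => grid a b m j.+1) (fun j => step a b m * kap (G (grid a b m j.+1))) X_iid B_bridge) => j.
  have /andP[/ltW h _] : 0 < kap (G (grid a b m j.+1)) <= K by apply: kapK; rewrite dfun_ge0 dfun_le1.
  by rewrite mulr_ge0// ltW// step_gt0.
rewrite -(cvg_shiftS (fun n => ((\int[P n]_w W n w) `^ 2^-1)%E)) /hambly_lyons_limit -/kap.
have sq01 (x : \bar R) : x \is a fin_num -> (0 <= x)%E -> (x `^ 2^-1)%E = (Num.sqrt (fine x))%:E.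
  by move=> xf x0; rewrite -{1}(fineK xf) poweR_EFin powR12_sqrt// fine_ge0.
rewrite sq01//; last by apply: integral_ge0 => w _; exact: expeR_ge0.
rewrite (_ : [sequence _]_n = (fun n => (Num.sqrt (fine (\int[P n.+1]_w W n.+1 w)))%:E)); last first.
  by apply/funext => n; apply: sq01 => //; apply: integral_ge0 => w _; exact: expeR_ge0.
apply: cvg_EFin; first exact: nearW.
by apply: continuous_cvg; [exact: sqrt_continuous|exact: cu].
Qed.
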